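(* Let $k$ be an algebraically closed field of characteristic $\neq 2$. For every odd prime $p$, there exists a $(p+1)$-dimensional smooth affine variety over the rational function field $k(T)$ and a stably trivial non-trivial $\operatorname{Sp}_{p-1}$-torsor over it. Moreover (clearing denominators), for every odd prime $p$ there exists a $(p+2)$-dimensional smooth affine variety over $k$ with a stably trivial non-trivial $\operatorname{Sp}_{p-1}$-torsor over it.
   Context: For even $m$, $\operatorname{Sp}_m$ denotes the symplectic group of $m\times m$ matrices preserving the standard symplectic form; $\operatorname{Sp}_m$-torsors correspond to symplectic vector bundles of rank $m$ (vector bundles with a non-degenerate alternating form). An $\operatorname{Sp}_{p-1}$-torsor is called stably trivial if it becomes trivial after extension of the structure group along the standard stabilization embedding $\operatorname{Sp}_{p-1}\hookrightarrow\operatorname{Sp}_{p+1}$, i.e. if the associated symplectic bundle becomes isomorphic to the trivial (hyperbolic) symplectic bundle after adding orthogonally a trivial symplectic bundle of rank $2$ (a symplectic line). *)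

(* Defs.v *)
(* Mathematical Components, with the multinomials library for {mpoly K[n]}. *)
From HB Require Import structures.
From mathcomp Require Import all_boot all_order all_algebra.
From mathcomp Require Import mpoly.

Set Implicit Arguments.
Unset Strict Implicit.
Unset Printing Implicit Defensive.

Import GRing.Theory.
Local Open Scope ring_scope.

(* An affine scheme Spec A over a field K is given by its coordinate ring,     *)
(* a commutative K-algebra A. The elements of comAlgType are nonzero rings.    *)

Definition finitely_generated_algebra (K : fieldType) (A : comAlgType K) : Prop :=
  exists (n : nat) (x : 'I_n -> A),
    forall a : A, exists f : {mpoly K[n]}, a = mmap (in_alg A) x f.

Definition integral_ring (A : comNzRingType) : Prop :=
  forall a b : A, a * b = 0 -> a = 0 \/ b = 0.

(* Infinitesimal lifting along surjections B -> C with square-zero kernel. *)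
Definition formally_smooth (K : fieldType) (A : comAlgType K) : Prop :=
  forall (B C : comAlgType K) (q : {lrmorphism B -> C}),
    (forall c : C, exists b : B, q b = c) ->
    (forall x y : B, q x = 0 -> q y = 0 -> x * y = 0) ->
    forall f : {lrmorphism A -> C},
      exists g : {lrmorphism A -> B}, forall a : A, q (g a) = f a.

(* Smooth means formally smooth and of finite presentation; over a field,      *)
(* finite generation already gives finite presentation (Hilbert).              *)
Definition smooth_affine_variety (K : fieldType) (A : comAlgType K) : Prop :=
  [/\ finitely_generated_algebra A, integral_ring A & formally_smooth A].

Definition prime_chain (A : comNzRingType) (n : nat)
    (I : 'I_n.+1 -> prime_idealr A) : Prop :=
  forall i j : 'I_n.+1, (i < j)%N ->
    {subset I i <= I j} /\ exists a : A, a \in I j /\ a \notin I i.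

Definition krull_dimension (A : comNzRingType) (d : nat) : Prop :=
  (exists I : 'I_d.+1 -> prime_idealr A, prime_chain I) /\
  (forall (n : nat) (I : 'I_n.+1 -> prime_idealr A), prime_chain I -> (n <= d)%N).

(* The images of v_1, ..., v_m form a basis of the localization P[1/s] over    *)
(* A[1/s]; the two conditions are those for P[1/s] with denominators cleared.  *)
Definition basis_away (A : comNzRingType) (P : lmodType A) (s : A) (m : nat)
    (v : 'I_m -> P) : Prop :=
  (forall x : P, exists (N : nat) (a : 'I_m -> A),
      s ^+ N *: x = \sum_(i < m) a i *: v i) /\
  (forall a : 'I_m -> A, \sum_(i < m) a i *: v i = 0 ->
      forall i, exists N : nat, s ^+ N * a i = 0).

(* The quasi-coherent sheaf of P is a vector bundle of rank m on Spec A: every *)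
(* point has a principal open neighbourhood D(s) over which P is free of rank  *)
(* m. Any basis of P[1/s] can be rescaled by powers of s to come from P.       *)
Definition vector_bundle (A : comNzRingType) (m : nat) (P : lmodType A) : Prop :=
  forall I : prime_idealr A,
    exists (s : A) (v : 'I_m -> P), s \notin I /\ basis_away s v.

Definition alternating_form (A : comNzRingType) (P : lmodType A)
    (b : P -> P -> A) : Prop :=
  forall x : P, b x x = 0.

(* The adjoint map P -> Hom_A(P, A), x |-> b x, is bijective. *)
Definition perfect_form (A : comNzRingType) (P : lmodType A)
    (b : P -> P -> A) : Prop :=
  (forall x : P, (forall y : P, b x y = 0) -> x = 0) /\
  (forall f : {scalar P}, exists x : P, forall y : P, b x y = f y).

(* Symplectic vector bundles of rank m on Spec A; through their bundles of     *)
(* symplectic frames these are the Sp_m-torsors over Spec A.                   *)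
Definition symplectic_bundle (A : comNzRingType) (m : nat) (P : lmodType A)
    (b : {biscalar P}) : Prop :=
  [/\ vector_bundle m P, alternating_form b & perfect_form b].

Definition isometric (A : comNzRingType) (P Q : lmodType A)
    (b : P -> P -> A) (c : Q -> Q -> A) : Prop :=
  exists f : {linear P -> Q},
    bijective f /\ forall x y : P, c (f x) (f y) = b x y.

(* For even m, the block-diagonal matrix with m/2 blocks (0 1; -1 0), so that  *)
(* M |-> diag(M, 1_2) embeds Sp_m into Sp_(m+2).                               *)
Definition symplectic_mx (A : comNzRingType) (m : nat) : 'M[A]_m :=
  \matrix_(i, j) if ~~ odd i && (j == i.+1 :> nat) then 1
                 else if odd i && (i == j.+1 :> nat) then -1 else 0.

(* The trivial symplectic bundle of (even) rank m is 'rV[A]_m with this form. *)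
Definition standard_form (A : comNzRingType) (m : nat) (u v : 'rV[A]_m) : A :=
  (u *m symplectic_mx A m *m v^T) 0 0.
Arguments standard_form : clear implicits.

Definition orthogonal_sum (A : comNzRingType) (P Q : lmodType A)
    (b : P -> P -> A) (c : Q -> Q -> A) : (P * Q)%type -> (P * Q)%type -> A :=
  fun x y => b x.1 y.1 + c x.2 y.2.

Definition trivial_symplectic (A : comNzRingType) (m : nat) (P : lmodType A)
    (b : P -> P -> A) : Prop :=
  isometric b (standard_form A m).

Definition stably_trivial_symplectic (A : comNzRingType) (m : nat)
    (P : lmodType A) (b : P -> P -> A) : Prop :=
  isometric (orthogonal_sum b (standard_form A 2)) (standard_form A m.+2).

(* Main.v *)
(** Over [K = k(T)] let [F_0 = x_0], [F_(j+1) = F_j^p + T x_(j+1)^(p^(j+1))] and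
    [A = K[x_0, ..., x_p][1/F]] with [F = F_p], the ring of an open subset of affine
    [(p+1)]-space. Since [F] is in the ideal of the [x_i], the row [x] is unimodular over
    [A] and lies in a hyperbolic plane [H] of [A^(p+1)]. The complement of [H] is stably
    trivial, and its triviality would make [x] a row of an invertible matrix over [A].

    That is impossible. As [T^d] is a [p]-th power only if [p] divides [d], the pieces of
    high degree of a graded module killed by a power of [F] have dimension divisible by
    [p]. So for modules [N' <= N <= R^a], with [R = K[x_0, ..., x_p]] and [F^k N <= N'],
    the dimension mod [p] of a high step of [N / N'] does not depend on the filtration of
    [R^a]. Applied to exterior powers, this attaches to a matrix [B] of size [N], invertible
    after inverting [F], elements [delta_i(B)] of [F_p]. The polynomial
    [sum_i delta_i(B) (1 - t)^i t^(N-i)] is additive in [B] and stable; a filtered free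
    resolution of the row space of [B] reduces its computation to matrices with bounded
    degrees, for which Hilbert series and Newton's identities mod [p] show that the
    coefficient of [t^(p+1)] vanishes. But if [x] is a row of [B] of size [p+1], Clifford
    multiplication by [x] and a dual vector exchanges even and odd exterior powers and
    makes this coefficient [1].

    Over [k] the parameter [T] becomes one more variable. *)

Require Import Defs.
From Stdlib Require Import Classical ClassicalEpsilon.
From HB Require Import structures.
From mathcomp Require Import all_boot all_order all_algebra.
From mathcomp Require Import mpoly finfield sesquilinear zify ring.

Set Implicit Arguments.
Unset Strict Implicit.
Unset Printing Implicit Defensive.

Import GRing.Theory.
Local Open Scope ring_scope.

(** * Relative dimension *)

(** Three choices shape the proof. The matrix [B] is not graded, and its inverse away from F may
    lose degrees, so the cokernels of its exterior powers have no intrinsic Hilbert function; only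
    dimensions mod p survive a change of filtration. Where the inverse loses no more than the degree
    of F^k, the invariants are exact differences of Hilbert functions. A syzygy step replaces any
    other [B] by a matrix with the opposite invariant and a shorter resolution. The single delta_i
    cannot be used alone, since adding an identity block mixes delta_i with delta_(i-1); the powers
    of 1 - t and t undo this mixing. The number p + 1 plays two roles. With p + 1 variables, the
    order of the pole at X = 1 shows that the elementary symmetric functions of the degrees of
    source and target agree mod p in degrees up to p, and just then degree p + 1 follows, because p
    + 1 = 1 in F_p and d^p = d. For a matrix of size p + 1 this same coefficient is the top one, the
    even invariants minus the odd ones, which the row [x] forces to be (1 + p^p)^(p+1) = 1. *)

Section RelativeDimension.
Variables (K : fieldType).

Section Def.
Variables (R : comNzRingType) (io : {rmorphism K -> R}) (a : nat).
Implicit Types (P Q : 'rV[R]_a -> Prop) (d e : nat).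

Definition lincomb d e (c : 'M[K]_(d, e)) (b : 'M[R]_(e, a)) : 'M[R]_(d, a) :=
  map_mx io c *m b.

Definition ksubspace P := P 0 /\ forall c u v, P u -> P v -> P (io c *: u + v).

(* [b] is a basis of [P] modulo [Q]; [Q] need not be contained in [P]. *)
Definition reldim P Q d := exists b : 'M[R]_(d, a),
  [/\ forall i, P (row i b),
      forall u, P u -> exists c : 'rV[K]_d, Q (u - lincomb c b)
    & forall c : 'rV[K]_d, Q (lincomb c b) -> c = 0].

(** A bound on independent families, rather than a basis, passes to subspaces and back along
    injections without any choice. *)
Definition findim P := exists D, forall d (b : 'M[R]_(d, a)), (forall i, P (row i b)) ->
  (forall c : 'rV[K]_d, lincomb c b = 0 -> c = 0) -> (d <= D)%N.

Definition zerov (u : 'rV[R]_a) := u = 0.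

Lemma ksubspace0 P : ksubspace P -> P 0. Proof. by case. Qed.
Lemma ksubspaceD P u v : ksubspace P -> P u -> P v -> P (u + v).
Proof. by case=> _ h pu pv; have := h 1 u v pu pv; rewrite rmorph1 scale1r. Qed.
Lemma ksubspaceZ P c u : ksubspace P -> P u -> P (io c *: u).
Proof. by case=> h0 h pu; have := h c u 0 pu h0; rewrite addr0. Qed.
Lemma ksubspaceN P u : ksubspace P -> P u -> P (- u).
Proof. by move=> hP /(ksubspaceZ (-1) hP); rewrite rmorphN rmorph1 scaleN1r. Qed.
Lemma ksubspaceB P u v : ksubspace P -> P u -> P v -> P (u - v).
Proof. by move=> hP pu pv; apply: ksubspaceD => //; apply: ksubspaceN. Qed.
Lemma ksubspace_sum P (I : finType) (f : I -> 'rV[R]_a) : ksubspace P ->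
  (forall i, P (f i)) -> P (\sum_i f i).
Proof.
by move=> hP hf; elim/big_ind: _ => //; [apply: ksubspace0|move=> *; apply: ksubspaceD].
Qed.
Lemma ksubspace_zerov : ksubspace zerov.
Proof. by split=> // c u v -> ->; rewrite /zerov scaler0 addr0. Qed.
Lemma ksubspaceI P Q : ksubspace P -> ksubspace Q -> ksubspace (fun u => P u /\ Q u).
Proof. by move=> [p0 pc] [q0 qc]; split=> // c u v [? ?] [? ?]; split; auto. Qed.

Lemma lcE d (c : 'rV[K]_d) b : lincomb c b = \sum_i io (c 0 i) *: row i b.
Proof. by rewrite /lincomb mulmx_sum_row; apply: eq_bigr => i _; rewrite mxE. Qed.

Lemma row_lincomb d e (c : 'M[K]_(d, e)) b i : row i (lincomb c b) = lincomb (row i c) b.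
Proof. by rewrite /lincomb row_mul map_row. Qed.

Lemma lcM d e f (c : 'M[K]_(d, e)) (c' : 'M[K]_(e, f)) b :
  lincomb c (lincomb c' b) = lincomb (c *m c') b.
Proof. by rewrite /lincomb mulmxA map_mxM. Qed.

Lemma lcBr d e (c : 'M[K]_(d, e)) b b' : lincomb c (b - b') = lincomb c b - lincomb c b'.
Proof. by rewrite /lincomb mulmxBr. Qed.

Lemma ksubspace_lincomb P d (c : 'rV[K]_d) b : ksubspace P -> (forall i, P (row i b)) -> P (lincomb c b).
Proof. by move=> hP hb; rewrite lcE; apply: ksubspace_sum => // i; apply: ksubspaceZ. Qed.

Lemma rows_exist d n (S : 'I_d -> 'rV[R]_n -> Prop) :
  (forall i, exists c, S i c) -> exists M : 'M[R]_(d, n), forall i, S i (row i M).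
Proof.
move=> h; exists (\matrix_i proj1_sig (constructive_indefinite_description _ (h i))).
by move=> i; rewrite rowK; case: constructive_indefinite_description.
Qed.

End Def.

Lemma krows_exist d n (S : 'I_d -> 'rV[K]_n -> Prop) :
  (forall i, exists c, S i c) -> exists M : 'M[K]_(d, n), forall i, S i (row i M).
Proof.
move=> h; exists (\matrix_i proj1_sig (constructive_indefinite_description _ (h i))).
by move=> i; rewrite rowK; case: constructive_indefinite_description.
Qed.

Section Theory.
Variables (R : comNzRingType) (io : {rmorphism K -> R}) (a : nat).
Implicit Types (P Q : 'rV[R]_a -> Prop) (d e : nat).
Local Notation lincomb := (lincomb io).
Local Notation ksubspace := (@ksubspace R io a).
Local Notation reldim := (@reldim R io a).
Local Notation findim := (@findim R io a).

Lemma span_le Q d e (b : 'M[R]_(d, a)) (b' : 'M[R]_(e, a)) : ksubspace Q ->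
  (forall i, exists c : 'rV_e, Q (row i b - lincomb c b')) ->
  (forall c : 'rV_d, Q (lincomb c b) -> c = 0) -> (d <= e)%N.
Proof.
move=> hQ hs hi.
have [T hT] := krows_exist hs.
rewrite leqNgt; apply/negP => ltde.
have : kermx T != 0 by rewrite kermx_eq0 -row_leq_rank -ltnNge (leq_ltn_trans (rank_leq_col _)).
case/rowV0Pn => c cT c0; case/negP: c0; apply/eqP; apply: hi.
have cT0 : c *m T = 0 by apply/sub_kermxP.
have -> : lincomb c b = lincomb c (b - lincomb T b').
  by rewrite lcBr lcM cT0 /lincomb map_mx0 mul0mx subr0.
by apply: ksubspace_lincomb => // i; rewrite linearB /= row_lincomb.
Qed.

Lemma reldim_uniq P Q d e : ksubspace Q -> reldim P Q d -> reldim P Q e -> d = e.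
Proof.
move=> hQ [b [b1 b2 b3]] [b' [c1 c2 c3]]; apply/eqP; rewrite eqn_leq.
apply/andP; split.
  by apply: (@span_le Q d e b b') => // i; apply/c2/b1.
by apply: (@span_le Q e d b' b) => // i; apply/b2/c1.
Qed.

Lemma findim_sub P Q : (forall u, P u -> Q u) -> findim Q -> findim P.
Proof. by move=> h [D hD]; exists D => d b hb; apply: hD => i; apply/h/hb. Qed.

Lemma findim_rdim0 P d : reldim P (@zerov R a) d -> findim P.
Proof.
move=> [b [b1 b2 b3]]; exists d => e b' hb' hi.
by apply: (@span_le (@zerov R a)) hi; [apply: ksubspace_zerov|auto].
Qed.

(** A family in [P] that is independent modulo [Q] and of maximal size is a basis; the maximum
    exists because such a family is also independent over [K]. *)
Lemma reldim_exists P Q : findim P -> ksubspace Q -> exists d, reldim P Q d.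
Proof.
move=> [D hD] hQ.
pose ind d := exists b : 'M[R]_(d, a), (forall i, P (row i b)) /\
  (forall c : 'rV_d, Q (lincomb c b) -> c = 0).
have bnd d : ind d -> (d <= D)%N.
  case=> b [b1 b2]; apply: hD b1 _ => c hc; apply: b2; rewrite hc; exact: ksubspace0 hQ.
have ind0 : ind 0%N by exists 0; split=> [[]//|c _]; apply/rowP => -[].
have [d [hd hd']] : exists d, ind d /\ ~ ind d.+1.
  apply: NNPP => hn.
  have H d : ind d by elim: d => // d IH; apply: NNPP => hh; apply: hn; exists d.
  by have := bnd _ (H D.+1); rewrite ltnn.
exists d; case: hd => b [b1 b2]; exists b; split=> // u pu.
apply: NNPP => hu; apply: hd'.
rewrite -addn1; exists (col_mx b u); split=> [i|c].
  by case: (split_ordP i) => j ->; rewrite ?rowKu ?rowKd // ord1 row_id.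
rewrite -(hsubmxK c) /lincomb map_row_mx mul_row_col => hc.
have E : map_mx io (rsubmx c) *m u = io (rsubmx c 0 0) *: u.
  by rewrite [map_mx io _]mx11_scalar mul_scalar_mx mxE.
have [r0|r0] := eqVneq (rsubmx c 0 0) 0.
  have R0 : rsubmx c = 0 by apply/rowP => j; rewrite ord1 r0 mxE.
  rewrite R0; move: hc; rewrite R0 map_mx0 mul0mx addr0 => /b2 ->.
  by rewrite row_mx0.
case: hu; exists (- (rsubmx c 0 0)^-1 *: lsubmx c).
have := ksubspaceZ (rsubmx c 0 0)^-1 hQ hc; congr Q.
rewrite E scalerDr scalerA -rmorphM mulVf // rmorph1 scale1r addrC /lincomb.
by rewrite map_mxZ -scalemxAl rmorphN scaleNr opprK.
Qed.

Lemma reldim_add P Q S d e : ksubspace S -> (forall u, Q u -> P u) -> (forall u, S u -> Q u) -> ksubspace Q ->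
  reldim P Q d -> reldim Q S e -> reldim P S (d + e).
Proof.
move=> hS hQP hSQ hQ [b [b1 b2 b3]] [b' [c1 c2 c3]]; exists (col_mx b b'); split.
- by move=> i; case: (split_ordP i) => j ->; rewrite ?rowKu ?rowKd; auto.
- move=> u /b2 [c /c2 [c' hc]]; exists (row_mx c c').
  by rewrite /lincomb map_row_mx mul_row_col opprD addrA.
- move=> c; rewrite -(hsubmxK c) /lincomb map_row_mx mul_row_col => h.
  have hr : Q (map_mx io (rsubmx c) *m b') by apply: ksubspace_lincomb.
  have /b3 l0 : Q (lincomb (lsubmx c) b).
    by have := ksubspaceB hQ (hSQ _ h) hr; rewrite addrK.
  by move: h; rewrite l0 map_mx0 mul0mx add0r => /c3 ->; rewrite row_mx0.
Qed.

Lemma reldim_ext P Q P' Q' d : (forall u, P u <-> P' u) -> (forall u, Q u <-> Q' u) ->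
  reldim P Q d -> reldim P' Q' d.
Proof.
move=> hP hQ [b [b1 b2 b3]]; exists b; split.
- by move=> i; apply/hP.
- by move=> u /hP /b2 [c hc]; exists c; apply/hQ.
- by move=> c /hQ /b3.
Qed.

Lemma reldim_refl P Q : (forall u, P u -> Q u) -> reldim P Q 0.
Proof.
move=> h; exists 0; split=> [[]//|u pu|c _]; last by apply/rowP => -[].
by exists 0; rewrite /lincomb mulmx0 subr0; apply: h.
Qed.

End Theory.

Section Maps.
Variables (R R' : comNzRingType) (io : {rmorphism K -> R}) (io' : {rmorphism K -> R'}).
Variables (a a' : nat) (phi : 'rV[R]_a -> 'rV[R']_a').
Hypothesis phiL : forall c u v, phi (io c *: u + v) = io' c *: phi u + phi v.
Implicit Types (P Q : 'rV[R]_a -> Prop).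

Lemma phi0 : phi 0 = 0.
Proof.
have := phiL 0 0 0; rewrite !rmorph0 !scale0r !add0r => _.
by have := phiL (-1) 0 0; rewrite !rmorphN !rmorph1 !scaleN1r oppr0 addr0 addNr.
Qed.

Lemma phi_lincomb d (c : 'rV[K]_d) b :
  phi (lincomb io c b) = lincomb io' c (\matrix_i phi (row i b)).
Proof.
rewrite !lcE.
elim: (index_enum _) => [|i s IH]; first by rewrite !big_nil phi0.
by rewrite !big_cons phiL IH rowK.
Qed.

Lemma phiB u v : phi (u - v) = phi u - phi v.
Proof.
have := phiL (-1) v u; rewrite !rmorphN !rmorph1 !scaleN1r addrC => ->.
by rewrite addrC.
Qed.

(** A basis is transported along [phi]. As [P] need not be a subspace, injectivity is asked on
    linear combinations of its elements. *)
Lemma reldim_map P Q (P' Q' : 'rV[R']_a' -> Prop) d : ksubspace io' Q' ->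
  (forall u, P u -> P' (phi u)) ->
  (forall u, Q u -> Q' (phi u)) ->
  (forall d (c : 'rV[K]_d) b, (forall i, P (row i b)) -> Q' (phi (lincomb io c b)) -> Q (lincomb io c b)) ->
  (forall v, P' v -> exists u, P u /\ Q' (v - phi u)) ->
  reldim io P Q d -> reldim io' P' Q' d.
Proof.
move=> hQ' h1 h2 h2' h3 [b [b1 b2 b3]]; exists (\matrix_i phi (row i b)); split.
- by move=> i; rewrite rowK; auto.
- move=> v /h3 [u [pu hu]]; have [c hc] := b2 u pu; exists c.
  have := ksubspaceD hQ' hu (h2 _ hc); rewrite phiB phi_lincomb addrA subrK; exact.
- by move=> c; rewrite -phi_lincomb => /h2' h; apply/b3/h.
Qed.

Lemma findim_inj P (P' : 'rV[R']_a' -> Prop) : (forall u, P u -> P' (phi u)) ->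
  (forall u, phi u = 0 -> u = 0) -> findim io' P' -> findim io P.
Proof.
move=> h1 h2 [D hD]; exists D => d b hb hi.
apply: (hD d (\matrix_i phi (row i b))) => [i|c]; first by rewrite rowK; auto.
by rewrite -phi_lincomb => /h2 /hi.
Qed.
End Maps.

End RelativeDimension.

(** * Graded modules over polynomial rings *)

Section IteratedPolynomials.
Variable K : fieldType.

(* [K[x_0, ..., x_(n-1)]], with the last variable outermost. *)
Fixpoint ipoly n : idomainType := if n is n'.+1 then {poly (ipoly n')} else K.

Fixpoint ipolyC n : {rmorphism K -> ipoly n} :=
  if n is n'.+1 then (polyC \o ipolyC n' : {rmorphism K -> {poly (ipoly n')}}) else idfun.

Fixpoint ipolyX n i : ipoly n :=
  match n return ipoly n with
  | 0 => 0
  | n'.+1 => if i == n' then 'X else (ipolyX n' i)%:P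
  end.

Definition hstep n (h : {rmorphism ipoly n -> {poly (ipoly n)}}) :
    {rmorphism {poly (ipoly n)} -> {poly {poly (ipoly n)}}} :=
  horner_morph (fun x => mulrC ('X%:P * 'X) ((map_poly (@polyC (ipoly n)) \o h) x)).

(* [f |-> f(x_0 X, ..., x_(n-1) X)]: the coefficient of [X^e] is the degree [e] part of [f]. *)
Fixpoint homogenize n : {rmorphism ipoly n -> {poly (ipoly n)}} :=
  if n is n'.+1 then hstep (homogenize n') else polyC.

Lemma homogenizeSC n (c : ipoly n) : homogenize n.+1 c%:P = map_poly polyC (homogenize n c).
Proof. by rewrite /= /hstep horner_morphC. Qed.

Lemma homogenizeSX n : homogenize n.+1 'X = 'X%:P * 'X.
Proof. by rewrite /= /hstep horner_morphX. Qed.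

Lemma ipoly_ind n (P : ipoly n -> Prop) :
  (forall c, P (ipolyC n c)) -> (forall i, (i < n)%N -> P (ipolyX n i)) ->
  (forall f g, P f -> P g -> P (f + g)) -> (forall f g, P f -> P g -> P (f * g)) ->
  forall f, P f.
Proof.
elim: n P => [|n IH] P hC hX hD homogM; first exact: hC.
have hP (c : ipoly n) : P c%:P.
  apply: (IH (fun c => P c%:P)) => [d|i lti|f g pf pg|f g pf pg].
  - exact: hC.
  - by have := hX i (ltnW lti); rewrite /= ltn_eqF.
  - by rewrite polyCD; apply: hD.
  - by rewrite polyCM; apply: homogM.
have hPX : P 'X by have := hX n (ltnSn n); rewrite /= eqxx.
apply: poly_ind => [|f c pf]; first by have := hP 0; rewrite polyC0.
by apply: hD => //; apply: homogM.
Qed.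

Lemma homogenizeC n c : homogenize n (ipolyC n c) = (ipolyC n c)%:P.
Proof. by elim: n => [//|n IH]; rewrite homogenizeSC IH map_polyC. Qed.

Lemma homogenizeX n i : (i < n)%N -> homogenize n (ipolyX n i) = (ipolyX n i)%:P * 'X.
Proof.
elim: n => [//|n IH]; rewrite ltnS leq_eqVlt => /orP[/eqP->|lti].
  by rewrite [ipolyX _ _]/= eqxx homogenizeSX.
by rewrite [ipolyX _ _]/= ltn_eqF // homogenizeSC IH // rmorphM /= map_polyC map_polyX.
Qed.

Lemma homogenize1 n f : (homogenize n f).[1] = f.
Proof.
elim/ipoly_ind: f => [c|i lti|f g IHf IHg|f g IHf IHg].
- by rewrite homogenizeC hornerC.
- by rewrite homogenizeX // hornerM hornerC hornerX mulr1.
- by rewrite rmorphD hornerD IHf IHg.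
- by rewrite rmorphM hornerM IHf IHg.
Qed.

Lemma homogenize_inj n : injective (homogenize n).
Proof. by move=> f g /(congr1 (horner^~ 1)); rewrite !homogenize1. Qed.

Lemma homogenize_coef n f e : homogenize n (homogenize n f)`_e = ((homogenize n f)`_e)%:P * 'X^e.
Proof.
elim/ipoly_ind: f e => [c|i lti|f g IHf IHg|f g IHf IHg] e.
- rewrite homogenizeC coefC; case: e => [|e] /=; first by rewrite homogenizeC expr0 mulr1.
  by rewrite rmorph0 mul0r.
- rewrite homogenizeX // coefMX coefC; case: e => [|[|e]] /=; rewrite ?rmorph0 ?mul0r //.
  by rewrite expr1 homogenizeX.
- by rewrite rmorphD coefD rmorphD IHf IHg rmorphD mulrDl.
- rewrite rmorphM coefM [LHS]rmorph_sum (big_morph _ (@polyCD _) (polyC0 _)) mulr_suml.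
  apply: eq_bigr => i _.
  rewrite [homogenize n (_ * _)]rmorphM IHf IHg polyCM mulrACA -exprD subnKC //.
  by rewrite -ltnS.
Qed.

(** Setting the last variable to 0 respects degrees, so gradings survive induction on the number of
    variables. *)
Lemma homogenize_coef0 n (f : ipoly n.+1) :
  map_poly (horner_eval 0) (homogenize n.+1 f) = homogenize n (f : {poly _}).[0].
Proof.
elim/poly_ind: f => [|f c IH]; first by rewrite rmorph0 rmorph0 horner0 rmorph0.
rewrite rmorphD [homogenize n.+1 (f * 'X)]rmorphM homogenizeSC homogenizeSX rmorphD.
rewrite !rmorphM [X in _ * (X * _) + _](_ : _ = 0); last first.
  by rewrite /= map_polyC /= /horner_eval hornerX.
rewrite mul0r mulr0 add0r hornerMXaddC mulr0 add0r.
apply/polyP => i.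
by rewrite !coef_map_id0 /= /horner_eval ?hornerC.
Qed.

Section Vectors.
Variable n : nat.
Local Notation R := (ipoly n).
Local Notation lincomb := (lincomb (ipolyC n)).

Section Graded.
Variables (a : nat) (w : 'I_a -> nat).
Implicit Types (u v : 'rV[R]_a) (S : 'rV[R]_a -> Prop).

(* ['rV_a] is graded with its [j]-th generator in degree [w j]: [hpart m u] is the
   degree [m] part of [u], [ishomog m u] says that [u] is homogeneous of degree [m],
   and [degle m u] that its parts of degree above [m] vanish. *)
Definition homv u : 'rV[{poly R}]_a := \row_j ('X^(w j) * homogenize n (u 0 j)).
Definition hpart m u : 'rV[R]_a := \row_j (homv u 0 j)`_m.
Definition ishomog (m : nat) u := forall j, 'X^(w j) * homogenize n (u 0 j) = (u 0 j)%:P * 'X^m.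
Definition degle (m : nat) u := forall j, (size ('X^(w j) * homogenize n (u 0 j))%R <= m.+1)%N.

Definition submod S := S 0 /\ forall (r : R) u v, S u -> S v -> S (r *: u + v).
Definition gsubmod S := submod S /\ forall m u, S u -> S (hpart m u).

Lemma hpartE m u j : hpart m u 0 j = ('X^(w j) * homogenize n (u 0 j))`_m.
Proof. by rewrite !mxE. Qed.

Lemma hpartD m u v : hpart m (u + v) = hpart m u + hpart m v.
Proof. by apply/rowP => j; rewrite [RHS]mxE !hpartE mxE rmorphD mulrDr coefD. Qed.
Lemma hpart0 m : hpart m 0 = 0.
Proof. by apply/rowP => j; rewrite hpartE !mxE rmorph0 mulr0 coef0. Qed.
Lemma hpart_sum m (I : finType) (f : I -> 'rV[R]_a) :
  hpart m (\sum_i f i) = \sum_i hpart m (f i).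
Proof.
by elim/big_rec2: _ => [|i x y _ <-]; rewrite ?hpart0 ?hpartD.
Qed.

Lemma hpartM m (f : R) u : hpart m (f *: u) = \sum_(i < m.+1) (homogenize n f)`_i *: hpart (m - i) u.
Proof.
apply/rowP => j; rewrite summxE hpartE mxE rmorphM mulrCA coefM.
by apply: eq_bigr => i _; rewrite mxE hpartE.
Qed.

Lemma hpart_homM m e (f : R) u : homogenize n f = f%:P * 'X^e ->
  hpart (m + e) (f *: u) = f *: hpart m u.
Proof.
move=> hf; apply/rowP => j; rewrite [RHS]mxE !hpartE mxE rmorphM hf -mulrA mulrCA coefCM.
by rewrite ['X^_ * ('X^_ * _)]mulrCA [in LHS]coefXnM ltnNge leq_addl /= addnK.
Qed.

Lemma hpartZ c m u : hpart m (ipolyC n c *: u) = ipolyC n c *: hpart m u.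
Proof. by rewrite -[m in LHS]addn0 hpart_homM // homogenizeC expr0 mulr1. Qed.

Lemma hpartN m u : hpart m (- u) = - hpart m u.
Proof. by rewrite -scaleN1r -(rmorph1 (ipolyC n)) -rmorphN hpartZ rmorphN rmorph1 scaleN1r. Qed.

Lemma ishomog_hpart m u : ishomog m (hpart m u).
Proof.
move=> j; rewrite hpartE coefXnM; case: ltnP => h; first by rewrite rmorph0 mulr0 mul0r.
by rewrite homogenize_coef mulrCA -exprD subnKC.
Qed.

Lemma hpart_ishomog m u : ishomog m u -> hpart m u = u.
Proof. by move=> h; apply/rowP => j; rewrite hpartE h coefCM coefXn eqxx mulr1. Qed.

Lemma hpart_homog0 m e u : ishomog m u -> e != m -> hpart e u = 0.
Proof.
move=> h he; apply/rowP => j; rewrite hpartE h coefCM coefXn (negbTE he) mulr0.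
by rewrite mxE.
Qed.

Lemma homog0 m : ishomog m 0. Proof. by move=> j; rewrite mxE rmorph0 mulr0 mul0r. Qed.
Lemma homogP m u : ishomog m u <-> hpart m u = u.
Proof. by split=> [/hpart_ishomog //|<-]; apply: ishomog_hpart. Qed.
Lemma ksubspace_ishomog m : ksubspace (ipolyC n) (ishomog m).
Proof.
split=> [|c u v /homogP hu /homogP hv']; first exact: homog0.
by apply/homogP; rewrite hpartD hpartZ hu hv'.
Qed.

Lemma degleP m u : degle m u <-> forall e, (m < e)%N -> hpart e u = 0.
Proof.
split=> h.
  by move=> e lte; apply/rowP => j; rewrite hpartE nth_default ?mxE // (leq_trans (h j)).
move=> j; apply/leq_sizeP => e lte.
by have := h e lte => /rowP/(_ j); rewrite hpartE mxE.
Qed.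

Lemma degle_sum_hpart m u : degle m u -> u = \sum_(i < m.+1) hpart i u.
Proof.
move=> h; apply/rowP => j; rewrite summxE.
have {1}-> : u 0 j = ('X^(w j) * homogenize n (u 0 j)).[1].
  by rewrite hornerM hornerXn expr1n mul1r homogenize1.
rewrite (horner_coef_wide _ (h j)).
by apply: eq_bigr => i _; rewrite expr1n mulr1 hpartE.
Qed.

Lemma degle_exists u : exists m, degle m u.
Proof.
exists (\max_j size ('X^(w j) * homogenize n (u 0 j))%R) => j.
by apply: leqW; apply: (@leq_bigmax _ (fun j => size ('X^(w j) * homogenize n (u 0 j))%R)).
Qed.

Lemma ksubspace_degle m : ksubspace (ipolyC n) (degle m).
Proof.
split=> [j|c u v hu hv'].
  by rewrite mxE rmorph0 mulr0 size_poly0.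
apply/degleP => e lte; rewrite hpartD hpartZ.
by move/degleP: hu => ->//; move/degleP: hv' => -> //; rewrite scaler0 addr0.
Qed.

Lemma degle_leq m m' u : (m <= m')%N -> degle m u -> degle m' u.
Proof. by move=> le h j; apply: leq_trans (h j) _; rewrite ltnS. Qed.

Lemma ishomog_degle m u : ishomog m u -> degle m u.
Proof. by move=> h; apply/degleP => e lte; rewrite (hpart_homog0 h) // gtn_eqF. Qed.

Lemma degleZ m e (f : R) u : (size (homogenize n f) <= e.+1)%N -> degle m u -> degle (m + e) (f *: u).
Proof.
move=> hf hu j; rewrite mxE rmorphM mulrCA.
apply: leq_trans (size_polyMleq _ _) _.
by rewrite -subn1 leq_subLR add1n addnC -addSn -addnS leq_add.
Qed.

Lemma submodD S u v : submod S -> S u -> S v -> S (u + v).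
Proof. by case=> _ h su sv; have := h 1 u v su sv; rewrite scale1r. Qed.
Lemma submodZ S f u : submod S -> S u -> S (f *: u).
Proof. by case=> s0 h su; have := h f u 0 su s0; rewrite addr0. Qed.
Lemma submodN S u : submod S -> S u -> S (- u).
Proof. by move=> hS /(submodZ (-1) hS); rewrite scaleN1r. Qed.
Lemma submodB S u v : submod S -> S u -> S v -> S (u - v).
Proof. by move=> hS su sv; apply: submodD => //; apply: submodN. Qed.
Lemma submod_sum S (I : finType) (f : I -> 'rV[R]_a) : submod S ->
  (forall i, S (f i)) -> S (\sum_i f i).
Proof. by move=> hS hf; elim/big_ind: _ => //; [case: hS|move=> *; apply: submodD]. Qed.
Lemma submod_lin S b (r : 'rV[R]_b) (U : 'M_(b, a)) : submod S ->
  (forall i, S (row i U)) -> S (r *m U).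
Proof. by move=> hS hU; rewrite mulmx_sum_row; apply: submod_sum => // i; apply: submodZ. Qed.
Lemma submod_ksubspace S : submod S -> ksubspace (ipolyC n) S.
Proof. by case=> s0 h; split=> // c u v; apply: h. Qed.

End Graded.

(** Exact in both directions because [ipoly n] is a domain: powers of F can later be cancelled
    without loss of degree. *)
Lemma degle_hom a (w : 'I_a -> nat) m e (f : R) u : f != 0 -> homogenize n f = f%:P * 'X^e ->
  degle w m (f *: u) <-> degle (fun j => w j + e)%N m u.
Proof.
move=> f0 hf; suff E j : size ('X^(w j) * homogenize n ((f *: u) 0 j)) =
    size ('X^(w j + e) * homogenize n (u 0 j)).
  by split=> h j; move: (h j); rewrite ?E // -?E.
by rewrite mxE rmorphM hf mulrCA -mulrA size_Cmul // mulrCA mulrA -exprD addnC.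
Qed.

Lemma degle_shift a (w : 'I_a -> nat) m e u :
  degle (fun j => w j + e)%N (m + e) u <-> degle w m u.
Proof.
suff E j : (size ('X^(w j + e) * homogenize n (u 0 j))%R <= (m + e).+1)%N =
    (size ('X^(w j) * homogenize n (u 0 j))%R <= m.+1)%N.
  by split=> h j; have := h j; rewrite E.
have [->|u0] := eqVneq (u 0 j) 0; first by rewrite rmorph0 !mulr0 size_poly0.
have h0 : homogenize n (u 0 j) != 0 by rewrite -(rmorph0 (homogenize n)) (inj_eq (@homogenize_inj n)).
by rewrite ![_ * homogenize _ _]mulrC !size_Mmonic ?monicXn // !size_polyXn !addnS /=
  addnA -addSn leq_add2r.
Qed.

Section Matrices.
Variables (a b : nat) (w : 'I_a -> nat) (e : 'I_b -> nat) (U : 'M[R]_(b, a)).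

Definition homogM := forall i, ishomog w (e i) (row i U).
Definition degleM := forall i, degle w (e i) (row i U).

Lemma hpart_mul m r : homogM -> hpart w m (r *m U) = hpart e m r *m U.
Proof.
move=> h; apply/rowP => j; rewrite hpartE !mxE rmorph_sum mulr_sumr coef_sum.
apply: eq_bigr => i _; rewrite rmorphM mulrCA.
have := h i j; rewrite !mxE => ->.
by rewrite mulrA mulrAC coefMC [_ * 'X^_]mulrC.
Qed.

Lemma degle_mul m r : degleM -> degle e m r -> degle w m (r *m U).
Proof.
move=> h hr j; rewrite mxE rmorph_sum mulr_sumr.
elim/big_ind: _ => [|p q hp hq|i _].
- by rewrite size_poly0.
- by apply: leq_trans (size_polyD _ _) _; rewrite geq_max hp.
have [->|r0] := eqVneq (r 0 i) 0; first by rewrite mul0r rmorph0 mulr0 size_poly0.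
have h0 : homogenize n (r 0 i) != 0 by rewrite -(rmorph0 (homogenize n)) (inj_eq (@homogenize_inj n)).
have hU := h i j; rewrite mxE in hU; have hr' := hr i.
rewrite mulrC size_Mmonic ?monicXn // size_polyXn addnS /= in hr'.
rewrite rmorphM mulrCA; apply: leq_trans (size_polyMleq _ _) _.
rewrite -subn1 leq_subLR add1n (leq_trans (leq_add (leqnn _) hU)) //.
by rewrite addnS ltnS.
Qed.

Lemma homogM_degleM : homogM -> degleM. Proof. by move=> h i; apply/ishomog_degle/h. Qed.
End Matrices.
End Vectors.

End IteratedPolynomials.

(** * Hilbert functions of free modules *)

Section Dimension.
Variable K : fieldType.
Local Notation ipoly := (ipoly K).

Section Coef0.
Variables (n a : nat) (w : 'I_a -> nat).

Definition ev0 (u : 'rV[ipoly n.+1]_a) : 'rV[ipoly n]_a := \row_j (u 0 j : {poly ipoly n}).[0].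
Definition inC (u : 'rV[ipoly n]_a) : 'rV[ipoly n.+1]_a := \row_j (u 0 j)%:P.

Lemma hpart_ev0 m u : hpart w m (ev0 u) = ev0 (hpart w m u).
Proof.
apply/rowP => j; rewrite hpartE !mxE -homogenize_coef0 !coefXnM; case: ltnP => _.
  by rewrite horner0.
by rewrite coef_map.
Qed.

Lemma hpart_inC m u : hpart w m (inC u) = inC (hpart w m u).
Proof.
apply/rowP => j; rewrite hpartE [RHS]mxE hpartE mxE homogenizeSC !coefXnM; case: ltnP => _.
  by rewrite polyC0.
by rewrite coef_map.
Qed.

Lemma inCK u : ev0 (inC u) = u.
Proof. by apply/rowP => j; rewrite !mxE hornerC. Qed.
Lemma ev0_0 : ev0 0 = 0. Proof. by apply/rowP => j; rewrite !mxE horner0. Qed.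
Lemma inC_0 : inC 0 = 0. Proof. by apply/rowP => j; rewrite !mxE. Qed.
Lemma ev0B u v : ev0 (u - v) = ev0 u - ev0 v.
Proof. by apply/rowP => j; rewrite !mxE hornerD hornerN. Qed.
Lemma ev0D u v : ev0 (u + v) = ev0 u + ev0 v.
Proof. by apply/rowP => j; rewrite !mxE hornerD. Qed.
Lemma ev0Z (f : {poly ipoly n}) u : ev0 ((f : ipoly n.+1) *: u) = f.[0] *: ev0 u.
Proof. by apply/rowP => j; rewrite !mxE hornerM. Qed.

Lemma degle_ev0 m u : degle w m u -> degle w m (ev0 u).
Proof. by move/degleP=> h; apply/degleP => e lte; rewrite hpart_ev0 h // ev0_0. Qed.
Lemma degle_inC m u : degle w m u -> degle w m (inC u).
Proof. by move/degleP=> h; apply/degleP => e lte; rewrite hpart_inC h // inC_0. Qed.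

Lemma ev0_eq0 u : ev0 u = 0 -> exists v, u = ('X : ipoly n.+1) *: v.
Proof.
move=> h; have H j : exists q : {poly ipoly n}, (u 0 j : {poly ipoly n}) = q * 'X.
  have /factor_theorem [q hq] : root (u 0 j : {poly ipoly n}) 0.
    by move/rowP/(_ j): h; rewrite !mxE => /eqP.
  by exists q; rewrite hq polyC0 subr0.
exists (\row_j proj1_sig (constructive_indefinite_description _ (H j))).
apply/rowP => j; rewrite !mxE; case: constructive_indefinite_description => q /= ->.
by rewrite mulrC.
Qed.
End Coef0.

(** The number of monomials of degree at most m - w in n variables, the contribution of a generator
    of degree w; the test guards against truncated subtraction. *)
Definition hdim n m w := if (w <= m)%N then 'C(m - w + n, n) else 0%N.

Lemma reldim_dl0 a (w : 'I_a -> nat) m :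
  reldim (ipolyC K 0) (degle w m) (@zerov _ a) (\sum_j hdim 0 m (w j))%N.
Proof.
have dlE (u : 'rV[ipoly 0]_a) : degle w m u <-> forall j, (m < w j)%N -> u 0 j = 0.
  split=> h j.
    have := h j => /= hj lt; apply/eqP; apply: contraTT hj => u0.
    rewrite -ltnNge mulrC size_Mmonic ?monicXn ?polyC_eq0 // size_polyXn size_polyC u0.
    by rewrite add1n /= ltnS.
  rewrite /=; have [le|lt] := leqP (w j) m; last by rewrite h // polyC0 mulr0 size_poly0.
  have [->|u0] := eqVneq (u 0 j) 0; first by rewrite polyC0 mulr0 size_poly0.
  rewrite mulrC size_Mmonic ?monicXn ?polyC_eq0 // size_polyXn size_polyC u0.
  by rewrite add1n ltnS.
pose A := [pred j | (w j <= m)%N].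
have -> : (\sum_j hdim 0 m (w j) = #|A|)%N.
  by rewrite -sum1_card [RHS]big_mkcond; apply: eq_bigr => j _; rewrite /hdim bin0 inE.
exists (\matrix_(i, j) (enum_val i == j)%:R); split.
- move=> i; apply/dlE => j lt; rewrite !mxE.
  by case: eqP => // E; have := enum_valP i; rewrite inE E leqNgt lt.
- move=> u /dlE hu; exists (\row_i u 0 (enum_val i)).
  apply/eqP; rewrite subr_eq0; apply/eqP/rowP => j; rewrite mxE.
  under eq_bigr do rewrite !mxE /=.
  have [le|lt] := leqP (w j) m; last first.
    rewrite hu // big1 // => i _; case: eqP => [E|]; last by rewrite mulr0.
    by have := enum_valP i; rewrite inE E leqNgt lt.
  have hA : j \in A by [].
  rewrite (bigD1 (enum_rank_in hA j)) //= enum_rankK_in // eqxx mulr1 big1 ?addr0 //.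
  move=> i ne; case: eqP => [E|]; last by rewrite mulr0.
  by case/eqP: ne; apply: enum_val_inj; rewrite enum_rankK_in.
- move=> c /rowP h; apply/rowP => i; have := h (enum_val i); rewrite !mxE.
  rewrite (bigD1 i) //= !mxE eqxx mulr1 big1 ?addr0 //= => i' ne; rewrite !mxE.
  by rewrite (inj_eq enum_val_inj) (negbTE ne) mulr0.
Qed.

(** Double induction on [n] and [m], along the exact sequence in which the last variable embeds
    degree at most m - 1 into degree at most m, with quotient the polynomials in one variable
    less. *)
Lemma reldim_degle n a (w : 'I_a -> nat) m :
  reldim (ipolyC K n) (degle w m) (@zerov _ a) (\sum_j hdim n m (w j))%N.
Proof.
elim: n m => [|n IHn] m; first exact: reldim_dl0.
pose Q m (u : 'rV[ipoly n.+1]_a) := degle w m u /\ ev0 u = 0.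
have kQ m' : ksubspace (ipolyC K n.+1) (Q m').
  split=> [|c u v [h1 h2] [h3 h4]].
    by split; [apply: (ksubspace0 (@ksubspace_degle K n.+1 a w m'))|exact: ev0_0].
  split; first by apply: (proj2 (@ksubspace_degle K n.+1 a w m')).
  by rewrite ev0D ev0Z h2 h4 scaler0 addr0.
have stepP m' : reldim (ipolyC K n.+1) (degle w m') (Q m') (\sum_j hdim n m' (w j))%N.
  apply: (reldim_map (phi := @inC n a)) (IHn m') => //.
  - move=> c u v; apply/rowP => j; rewrite !mxE polyCD polyCM //.
  - exact: degle_inC.
  - move=> u ->; rewrite inC_0; exact: ksubspace0 (kQ m').
  - by move=> d c b _ [_]; rewrite inCK.
  - move=> u hu; exists (ev0 u); split; first exact: degle_ev0.
    split; last by rewrite ev0B inCK subrr.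
    by apply: ksubspaceB (@ksubspace_degle K n.+1 a w m') _ _ => //; apply/degle_inC/degle_ev0.
have QE m' u : Q m' u -> exists v, u = ('X : ipoly n.+1) *: v /\ degle (fun j => w j + 1)%N m' v.
  case=> h1 /ev0_eq0 [v E]; exists v; split=> //.
  by apply/(@degle_hom K n.+1 _ w m' 1 'X); rewrite -?E ?polyX_eq0 ?homogenizeSX ?expr1.
have dlX m' v : degle (fun j => w j + 1)%N m' v -> Q m' (('X : ipoly n.+1) *: v).
  move=> h; split; last by rewrite ev0Z hornerX scale0r.
  by apply/(@degle_hom K n.+1 _ w m' 1 'X); rewrite ?polyX_eq0 ?homogenizeSX ?expr1.
elim: m => [|m IHm].
  have Q0 u : Q 0 u <-> u = 0.
    split=> [/QE [v [-> h]]|->]; last by apply: ksubspace0 (kQ 0).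
    rewrite (degle_sum_hpart h) big_ord1 [X in _ *: X](_ : _ = 0) ?scaler0 //.
    by apply/rowP => j; rewrite hpartE coefXnM addn1 /= mxE.
  have -> : (\sum_j hdim n.+1 0 (w j) = \sum_j hdim n 0 (w j))%N.
    by apply: eq_bigr => j _; rewrite /hdim; case: ltnP; rewrite // sub0n !add0n !binn.
  by apply: reldim_ext (stepP 0%N).
(* Pascal's rule for each generator; one of degree m + 1 contributes only to the first sum on the
   right. *)
have -> : (\sum_j hdim n.+1 m.+1 (w j) =
           \sum_j hdim n m.+1 (w j) + \sum_j hdim n.+1 m (w j))%N.
  rewrite -big_split; apply: eq_bigr => j _; rewrite /hdim /=.
  have [hlt|hlt|->] := ltngtP (w j) m.+1; [|by rewrite leqNgt (ltnW hlt)|]; last first.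
    by rewrite ltnn subnn !add0n !binn addn0.
  by rewrite -ltnS hlt (subSn (hlt : (w j <= m)%N)) addSn binS addnC addSnnS.
apply: reldim_add (stepP m.+1) _ => //; first exact: ksubspace_zerov.
- by move=> u [].
- by move=> u ->; apply: ksubspace0 (kQ _).
apply: (reldim_map (phi := fun u => ('X : ipoly n.+1) *: u)) IHm => //.
- by move=> c u v; rewrite scalerDr !scalerA mulrC.
- exact: ksubspace_zerov.
- by move=> u hu; apply: dlX; rewrite -[m.+1]addn1; apply/degle_shift.
- by move=> u ->; rewrite /zerov scaler0.
- by move=> d c b _; rewrite /zerov => /eqP; rewrite scalemx_eq0 polyX_eq0 => /eqP.
- move=> v /QE [u [E h]]; exists u; split; last by rewrite E subrr.
  by move: h; rewrite -[m.+1]addn1 => /degle_shift.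
Qed.

Lemma findim_degle n a (w : 'I_a -> nat) m : findim (ipolyC K n) (degle w m).
Proof. exact: findim_rdim0 (reldim_degle _ _ _). Qed.
Lemma findim_ishomog n a (w : 'I_a -> nat) m : findim (ipolyC K n) (ishomog w m).
Proof. apply: (@findim_sub _ _ (ipolyC K n) _ (ishomog w m) (degle w m)); [exact: ishomog_degle|exact: findim_degle]. Qed.

End Dimension.

(** * Hilbert's basis theorem for submodules of free modules *)

Section Noetherian.

Definition noetherian (R : comNzRingType) := forall a (S : 'rV[R]_a -> Prop),
  S 0 -> (forall (r : R) u v, S u -> S v -> S (r *: u + v)) ->
  exists b (U : 'M[R]_(b, a)), (forall i, S (row i U)) /\
    forall u, S u -> exists r : 'rV_b, u = r *m U.

Lemma noetherian_field (K : fieldType) : noetherian K.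
Proof.
move=> a S S0 Sc.
have lc1 d (c : 'rV[K]_d) (b : 'M[K]_(d, a)) : lincomb idfun c b = c *m b.
  by rewrite /lincomb map_mx_id.
have hfd : findim (idfun : {rmorphism K -> K}) S.
  exists a => d b _ hi; rewrite leqNgt; apply/negP => lt.
  have : kermx b != 0 by rewrite kermx_eq0 -row_leq_rank -ltnNge (leq_ltn_trans (rank_leq_col _)).
  by case/rowV0Pn => c cb /negP []; apply/eqP/hi; rewrite lc1; apply/sub_kermxP.
have [d [U [h1 h2 h3]]] := reldim_exists hfd (ksubspace_zerov _ _).
exists d, U; split=> // u /h2 [c]; rewrite /zerov lc1 => /eqP; rewrite subr_eq0.
by move/eqP=> ->; exists c.
Qed.

Section HilbertBasis.
Variable R : idomainType.
Hypothesis nR : noetherian R.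
Variables (a : nat) (S : 'rV[{poly R}]_a -> Prop).
Hypotheses (S0 : S 0) (Sc : forall (r : {poly R}) u v, S u -> S v -> S (r *: u + v)).

Let SD u v : S u -> S v -> S (u + v).
Proof. by move=> su sv; have := Sc 1 su sv; rewrite scale1r. Qed.
Let SZ r u : S u -> S (r *: u).
Proof. by move=> su; have := Sc r su S0; rewrite addr0. Qed.
Let Slin b (r : 'rV_b) (U : 'M_(b, a)) : (forall i, S (row i U)) -> S (r *m U).
Proof.
move=> hU; rewrite mulmx_sum_row; by elim/big_ind: _ => // i _; apply: SZ.
Qed.

Definition vsz d (u : 'rV[{poly R}]_a) := forall j, (size (u 0%R j) <= d)%N.

Lemma vsz_cV d (u : 'rV[{poly R}]_a) : vsz d.+1 u -> (forall j, (u 0 j)`_d = 0) -> vsz d u.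
Proof.
move=> h hc j; apply/leq_sizeP => i; rewrite leq_eqVlt => /orP[/eqP<-//|lt].
by apply: nth_default; apply: leq_trans (h j) _.
Qed.

Lemma vszB d (u v : 'rV[{poly R}]_a) : vsz d u -> vsz d v -> vsz d (u - v).
Proof.
move=> hu homv j; rewrite !mxE; apply: leq_trans (size_polyD _ _) _.
by rewrite size_polyN geq_max hu homv.
Qed.

Definition leadc d (c : 'rV[R]_a) := exists u, [/\ S u, vsz d.+1 u & c = map_mx (coefp d) u].

Lemma leadc0 d : leadc d 0.
Proof.
exists 0; split=> // [j|]; first by rewrite mxE size_poly0.
by apply/rowP => j; rewrite !mxE /= coef0.
Qed.

Lemma leadcD d (r : R) c c' : leadc d c -> leadc d c' -> leadc d (r *: c + c').
Proof.
move=> [u [su hu ->]] [v [sv homv ->]]; exists (r%:P *: u + v); split=> //; first exact: Sc.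
  move=> j; rewrite !mxE; apply: leq_trans (size_polyD _ _) _; rewrite geq_max homv andbT.
  by rewrite mul_polyC (leq_trans (size_scale_leq _ _)).
by apply/rowP => j; rewrite !mxE /= coefD coefCM.
Qed.

Lemma leadcX d e c : (d <= e)%N -> leadc d c -> leadc e c.
Proof.
move=> le [u [su hu ->]]; exists ('X^(e - d) *: u); split; first exact: SZ.
  move=> j; rewrite mxE; apply: leq_trans (size_polyMleq _ _) _.
  by rewrite size_polyXn addSn /= -{2}(subnK le) -addnS leq_add2l.
apply/rowP => j; rewrite !mxE /= coefXnM ltnNge leq_subr /=.
by rewrite subKn.
Qed.

Lemma lead_gens d : exists b (V : 'M[{poly R}]_(b, a)), [/\ forall i, S (row i V),
  forall i, vsz d.+1 (row i V)
  & forall u, S u -> vsz d.+1 u -> exists r : 'rV[R]_b, vsz d (u - map_mx polyC r *m V)].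
Proof.
have [b [U [hU gU]]] := nR (leadc0 d) (@leadcD d).
have [V hV] := @rows_exist {poly R} b a (fun i u => [/\ S u, vsz d.+1 u & row i U = map_mx (coefp d) u]) hU.
exists b, V; split=> [i|i|u su hu]; try by case: (hV i).
have [r hr] : exists r : 'rV_b, map_mx (coefp d) u = r *m U by apply: gU; exists u.
exists r; apply: vsz_cV => [|j].
  apply: vszB => // j; rewrite mxE; elim/big_ind: _ => [|p q hp hq|i _].
  - by rewrite size_poly0.
  - by apply: leq_trans (size_polyD _ _) _; rewrite geq_max hp.
  - rewrite mxE mul_polyC (leq_trans (size_scale_leq _ _)) //.
    by have [_ /(_ j)] := hV i; rewrite mxE.
have := congr1 (fun M : 'rV__ => M 0 j) hr; rewrite !mxE /= coefB => ->.
apply/eqP; rewrite subr_eq0 coef_sum; apply/eqP/eq_bigr => i _; rewrite !mxE coefCM.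
by have [_ _ /rowP/(_ j)] := hV i; rewrite !mxE => ->.
Qed.

Lemma bounded_gens d : exists b (V : 'M[{poly R}]_(b, a)), (forall i, S (row i V)) /\
  forall u, S u -> vsz d u -> exists r : 'rV_b, u = r *m V.
Proof.
elim: d => [|d [b [V [hV gV]]]].
  exists 0%N, 0; split=> [[]//|u _ hu]; exists 0; rewrite mul0mx.
  by apply/rowP => j; apply/eqP; rewrite mxE -size_poly_eq0 -leqn0.
have [b' [V' [h1 h2 h3]]] := lead_gens d.
exists (b + b')%N, (col_mx V V'); split=> [i|u su hu].
  by case: (split_ordP i) => k ->; rewrite ?rowKu ?rowKd.
have [r hr] := h3 u su hu.
have [r' hr'] : exists r' : 'rV_b, u - map_mx polyC r *m V' = r' *m V.
  by apply: gV => //; rewrite -scaleN1r addrC; apply: Sc => //; apply: Slin.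
exists (row_mx r' (map_mx polyC r)); rewrite mul_row_col -hr'.
by rewrite subrK.
Qed.

(** Leading coefficient vectors can only become more numerous as the degree grows, so generators of
    all of them occur in one degree [D]. Elements of higher degree are lowered by subtracting a
    shifted element of degree [D]. *)
Lemma hilbert_basis_gens : exists b (V : 'M[{poly R}]_(b, a)), (forall i, S (row i V)) /\
  forall u, S u -> exists r : 'rV_b, u = r *m V.
Proof.
pose L c := exists d, leadc d c.
have [||b [U [hU gU]]] := nR (S := L).
- by exists 0%N; apply: leadc0.
- move=> r u v [d hd] [e he]; exists (maxn d e); apply: leadcD.
    by apply: leadcX hd; apply: leq_maxl.
  by apply: leadcX he; apply: leq_maxr.
have [D hD] : exists D, forall i, leadc D (row i U).
  exists (\max_i proj1_sig (constructive_indefinite_description _ (hU i))) => i.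
  have := proj2_sig (constructive_indefinite_description _ (hU i)); apply: leadcX.
  exact: (@leq_bigmax _ (fun i => proj1_sig (constructive_indefinite_description _ (hU i)))).
have LD c : L c -> leadc D c.
  move/gU=> [r ->]; rewrite mulmx_sum_row; elim/big_ind: _ => [|x y hx hy|i _].
  - exact: leadc0.
  - by have := leadcD 1 hx hy; rewrite scale1r.
  - by have := leadcD (r 0 i) (hD i) (leadc0 D); rewrite addr0.
have [b1 [V [hV gV]]] := bounded_gens D.+1.
exists b1, V; split=> // u; have [d] : exists d, vsz d u.
  by exists (\max_j size (u 0%R j)) => j; apply: (@leq_bigmax _ (fun j => size (u 0%R j))).
elim: d u => [|d IH] u hu su.
  by apply: gV => // j; apply: leq_trans (hu j) _.
have [le|lt] := leqP d D; first by apply: gV => // j; apply: leq_trans (hu j) _.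
have [v [sv homv E]] : leadc D (map_mx (coefp d) u) by apply: LD; exists d, u.
have S1 : S ('X^(d - D) *: v) by apply: SZ.
have [r hr] : exists r : 'rV_b1, u - 'X^(d - D) *: v = r *m V.
  apply: IH; last by rewrite addrC -scaleN1r; apply: Sc.
  apply: vsz_cV => [|j].
    apply: vszB => // j; rewrite mxE; apply: leq_trans (size_polyMleq _ _) _.
    by rewrite size_polyXn addSn /= -{2}(subnK (ltnW lt)) -addnS leq_add2l.
  rewrite !mxE coefB coefXnM ltnNge leq_subr /= subKn ?(ltnW lt) //.
  by move/rowP/(_ j): E; rewrite !mxE /= => ->; rewrite subrr.
have [r' hr'] := gV v sv homv.
exists (r + 'X^(d - D) *: r'); rewrite mulmxDl -hr -scalemxAl -hr'.
by rewrite subrK.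
Qed.
End HilbertBasis.

Lemma noetherian_poly (R : idomainType) : noetherian R -> noetherian {poly R}.
Proof. by move=> nR a S S0 Sc; apply: hilbert_basis_gens. Qed.

Lemma noetherian_ipoly (K : fieldType) n : noetherian (ipoly K n).
Proof. by elim: n => [|n IH]; [apply: noetherian_field|apply: noetherian_poly]. Qed.

Section Graded.
Variables (K : fieldType) (n a : nat) (w : 'I_a -> nat).
Local Notation R := (ipoly K n).

Lemma graded_gens (S : 'rV[R]_a -> Prop) : gsubmod w S ->
  exists b (e : 'I_b -> nat) (U : 'M[R]_(b, a)), [/\ homogM w e U,
   forall i, S (row i U) & forall u, S u -> exists r : 'rV_b, u = r *m U].
Proof.
move=> [hS hc]; have [b [U [hU gU]]] := noetherian_ipoly (proj1 hS) (proj2 hS).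
have [D hD] : exists D, forall i, degle w D (row i U).
  have hx i := degle_exists w (row i U).
  exists (\max_i proj1_sig (constructive_indefinite_description _ (hx i))) => i.
  have := proj2_sig (constructive_indefinite_description _ (hx i)); apply: degle_leq.
  exact: (@leq_bigmax _ (fun i => proj1_sig (constructive_indefinite_description _ (hx i)))).
pose I := ('I_b * 'I_D.+1)%type.
pose V := \matrix_(k < #|{: I}|) hpart w (enum_val k).2 (row (enum_val k).1 U).
exists #|{: I}|, (fun k => nat_of_ord (enum_val k : 'I_b * 'I_D.+1).2), V; split.
- by move=> k; rewrite rowK; apply: ishomog_hpart.
- by move=> k; rewrite rowK; apply/hc/hU.
move=> u /gU [r ->]; exists (\row_k r 0 (enum_val k).1).
rewrite !mulmx_sum_row.
under [RHS]eq_bigr do rewrite mxE rowK.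
rewrite [RHS](reindex (@enum_rank {: I})) /=; last first.
  by exists enum_val => ? _; rewrite ?enum_rankK ?enum_valK.
under [RHS]eq_bigr do rewrite enum_rankK.
rewrite -(pair_bigA _ (fun i (k : 'I_D.+1) => r 0 i *: hpart w k (row i U))) /=.
by apply: eq_bigr => i _; rewrite -scaler_sumr -degle_sum_hpart.
Qed.

End Graded.
End Noetherian.

(** * Divisibility of graded dimensions by p *)

(** A monomial of degree above n k contains the k-th power of some variable. The argument runs
    without monomials, by peeling off the last variable. *)
Lemma ideal_large (K : fieldType) n k (I : ipoly K n -> Prop) : I 0 ->
  (forall r f g, I f -> I g -> I (r * f + g)) ->
  (forall i, (i < n)%N -> I (ipolyX K n i ^+ k)) ->
  forall f d, (n * k < d)%N -> homogenize K n f = f%:P * 'X^d -> I f.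
Proof.
elim: n I => [|n IHn] I I0 IL IX f d lt hf.
  suff -> : f = 0 by [].
  have := congr1 (coefp d) hf; rewrite /= coefC coefCM coefXn eqxx mulr1.
  by rewrite gtn_eqF // (leq_ltn_trans _ lt).
have IM r g : I g -> I (r * g) by move=> hg; have := IL r g 0 hg I0; rewrite addr0.
(* [l] counts the factors ['X] still missing from the k-th power. The constant coefficient of [g]
   falls under the induction on [n]; the rest gains a factor ['X]. *)
have claim l : forall j (g : {poly ipoly K n}) e, (j + l = k)%N -> (n * k + l < e)%N ->
    homogenize K n.+1 g = (g : ipoly K n.+1)%:P * 'X^e -> I ('X^j * g).
  elim: l => [|l IHl] j g e.
    rewrite !addn0 => -> _ _; rewrite mulrC; apply: IM.
    by have := IX n (ltnSn n); rewrite /= eqxx.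
  case: e => [|e]; first by rewrite ltn0.
  move=> jl le hg.
  have h0 : homogenize K n g.[0] = g.[0]%:P * 'X^(e.+1).
    rewrite -homogenize_coef0 hg rmorphM /= map_polyC /= rmorphXn /= map_polyX //.
  have [g' E] : exists g' : {poly ipoly K n}, g = g' * 'X + (g.[0])%:P.
    have /factor_theorem [g' hg'] : root (g - (g.[0])%:P) 0.
      by rewrite rootE hornerD hornerN hornerC subrr.
    by exists g'; move: hg'; rewrite polyC0 subr0 => <-; rewrite subrK.
  have hg' : homogenize K n.+1 g' = (g' : ipoly K n.+1)%:P * 'X^e.
    have nz : ('X%:P * 'X : {poly ipoly K n.+1}) != 0.
      by rewrite mulf_neq0 ?polyC_eq0 ?polyX_eq0.
    apply: (mulIf nz); rewrite -homogenizeSX -rmorphM.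
    have -> : g' * 'X = g - (g.[0])%:P by rewrite {1}E addrK.
    rewrite rmorphB homogenizeSC h0 hg [map_poly _ _]rmorphM /= map_polyC rmorphXn /= map_polyX.
    rewrite -mulrBl -polyCB {1}E addrK polyCM exprS homogenizeSX.
    by rewrite -!mulrA; congr (_ * _); rewrite mulrA mulrC.
  rewrite {1}E mulrDr addrC.
  apply: (IL).
    apply: (IHn (fun c => I c%:P) I0 _ _ (g.[0]) e.+1) => //.
    - by move=> r a b ha hb; rewrite polyCD polyCM; apply: IL.
    - move=> i lti; rewrite rmorphXn /=; have := IX i (ltnW lti).
      by rewrite /= ltn_eqF.
    - by apply: leq_ltn_trans le; apply: leq_addr.
  have := IHl j.+1 g' e; rewrite exprSr -mulrA ['X * g']mulrC; apply => //.
    by rewrite addSnnS.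
  by move: le; rewrite addnS ltnS.
have := claim k 0%N f d; rewrite expr0 mul1r; apply => //.
by rewrite -mulSnr.
Qed.

Section DClaim.
Variables (K : fieldType) (T : K) (p : nat).
Hypotheses (p_pr : prime p) (p_odd : odd p).
Hypothesis T_pow : forall d (t : K), t ^+ p = T ^+ d -> (p %| d)%N.

(** Over any ring and any sequence [x], so that it commutes with morphisms: the generic, the
    evaluated and the base-changed polynomial are all instances. *)
Fixpoint tower (R : comNzRingType) (t : R) (x : nat -> R) j : R :=
  if j is j'.+1 then tower t x j' ^+ p + t * x j ^+ (p ^ j) else x 0.

Section Devissage.
Variables (n a : nat) (w : 'I_a -> nat).
Local Notation R := (ipoly K n.+1).
Local Notation io := (ipolyC K n.+1).
Local Notation X := (ipolyX K n.+1).
Local Notation Fj := (tower (io T) X).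
Implicit Types (u v : 'rV[R]_a) (S : 'rV[R]_a -> Prop).

Lemma tower_hom j : (j <= n)%N -> homogenize K n.+1 (Fj j) = (Fj j)%:P * 'X^(p ^ j).
Proof.
elim: j => [|j IH] lt; first by rewrite expn0 expr1 homogenizeX.
rewrite [Fj j.+1]/= [homogenize _ _ _]rmorphD rmorphXn rmorphM rmorphXn IH ?(ltnW lt) // homogenizeX // homogenizeC.
by rewrite !exprMn -!exprM expnSr mulrA -mulrDl rmorphD rmorphM !rmorphXn.
Qed.

Definition pdim S1 S2 := exists m0, forall m, (m0 <= m)%N -> forall d,
  reldim io (fun u => S1 u /\ ishomog w m u) (fun u => S2 u /\ ishomog w m u) d -> (p %| d)%N.

Definition spair S1 S2 := [/\ gsubmod w S1, gsubmod w S2 & forall u, S2 u -> S1 u].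

Definition nilp S1 S2 (f : R) := exists k, forall u, S1 u -> S2 (f ^+ k *: u).

Lemma gsubmod_ksubspace S m : gsubmod w S -> ksubspace io (fun u => S u /\ ishomog w m u).
Proof. by case=> hS _; apply: ksubspaceI; [apply: submod_ksubspace|apply: ksubspace_ishomog]. Qed.

Lemma findim_gr S m : findim io (fun u => S u /\ ishomog w m u).
Proof. by apply: (@findim_sub _ _ io _ _ (ishomog w m)); [move=> u []|apply: findim_ishomog]. Qed.

Lemma pdim_trans S1 S2 S3 : spair S1 S2 -> spair S2 S3 -> pdim S1 S2 -> pdim S2 S3 -> pdim S1 S3.
Proof.
move=> [g1 g2 h12] [_ g3 h23] [m1 H1] [m2 H2]; exists (maxn m1 m2) => m.
rewrite geq_max => /andP[le1 le2] d hd.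
have [d1 hd1] := reldim_exists (findim_gr S1 m) (gsubmod_ksubspace m g2).
have [d2 hd2] := reldim_exists (findim_gr S2 m) (gsubmod_ksubspace m g3).
have hd' : reldim io (fun u => S1 u /\ ishomog w m u) (fun u => S3 u /\ ishomog w m u) (d1 + d2).
  by apply: (reldim_add (gsubmod_ksubspace m g3) _ _ (gsubmod_ksubspace m g2) hd1 hd2) => u [? ?]; auto.
rewrite (reldim_uniq (gsubmod_ksubspace m g3) hd hd') dvdn_add //.
  exact: H1 hd1.
exact: H2 hd2.
Qed.

Lemma gsubZ S1 S2 (f : R) e : homogenize K n.+1 f = f%:P * 'X^e -> gsubmod w S1 -> gsubmod w S2 ->
  gsubmod w (fun u => exists s t, [/\ S1 s, S2 t & u = f *: s + t]).
Proof.
move=> hf [m1 c1] [m2 c2]; split; first split.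
- by exists 0, 0; split; [case: m1|case: m2|rewrite scaler0 addr0].
- move=> r u v [s [t [hs ht ->]]] [s' [t' [hs' ht' ->]]].
  exists (r *: s + s'), (r *: t + t'); split; [by apply: (proj2 m1)|by apply: (proj2 m2)|].
  by rewrite !scalerDr !scalerA [f * r]mulrC addrACA.
- move=> m u [s [t [hs ht ->]]]; have [le|lt] := leqP e m.
    exists (hpart w (m - e) s), (hpart w m t); split; auto.
    by rewrite hpartD -{1}(subnK le) hpart_homM.
  exists 0, (hpart w m t); split; [by case: m1|exact: c2|].
  rewrite hpartD scaler0 hpartM big1 // => i _; rewrite hf coefCM coefXn.
  by rewrite ltn_eqF ?mulr0 ?scale0r // (leq_ltn_trans _ lt) // -ltnS.
Qed.

Section TorsionFree.
Variables (b c : R) (e : nat) (S1 S2 : 'rV[R]_a -> Prop).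
Hypotheses (hb : homogenize K n.+1 b = b%:P * 'X^e) (hc : homogenize K n.+1 c = c%:P * 'X^e).
Hypothesis hS : spair S1 S2.
Hypothesis bpcp : forall u, S1 u -> S2 (b ^+ p *: u - (io T * c ^+ p) *: u).
Hypothesis ctf : forall u, S1 u -> S2 (c *: u) -> S2 u.
Hypothesis bc : forall u, S1 u -> exists v, S1 v /\ S2 (b *: u - c *: v).

(* On [S1 / S2] the element [theta = b / c] is defined and satisfies [theta^p = T];
   its determinant [D] on a piece of dimension [d] has [D^p = T^d]. *)
Lemma torsion_free_dvd m d :
  reldim io (fun u => S1 u /\ ishomog w m u) (fun u => S2 u /\ ishomog w m u) d -> (p %| d)%N.
Proof.
move=> [B [B1 B2 B3]]; have [[m1 c1] [m2 c2] h12] := hS.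
(* The rows of [Th] are the coordinates of theta on the basis. Theta preserves degree [m] because
   [b] and [c] have the same degree [e]. *)
have [Th hTh] : exists Th : 'M[K]_d, forall i, S2 (b *: row i B - c *: lincomb io (row i Th) B).
  apply: (@krows_exist K d d (fun i t => S2 (b *: row i B - c *: lincomb io t B))) => i.
 have [s1 h1] := B1 i; have [v [sv homv]] := bc s1.
    have [t [ht _]] := B2 (hpart w m v) (conj (c1 m _ sv) (ishomog_hpart w m v)).
    exists t.
    have E : S2 (b *: row i B - c *: hpart w m v).
      have := c2 (m + e)%N _ homv; rewrite hpartD hpartN !hpart_homM // (hpart_ishomog h1) //.
    have -> : b *: row i B - c *: lincomb io t B =
      (b *: row i B - c *: hpart w m v) + c *: (hpart w m v - lincomb io t B).
      by rewrite scalerBr addrA subrK.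
    by apply: submodD => //; apply: submodZ.
pose lcS (k : nat) (Y : 'M[K]_d) := forall i, S2 (b ^+ k *: row i B - c ^+ k *: lincomb io (row i Y) B).
have k2 := submod_ksubspace m2.
have pw k : lcS k (Th ^+ k).
  elim: k => [|k IH] i.
    rewrite !expr0 !scale1r /lincomb map_row -row_mul map_mx1 mul1mx subrr; exact: (proj1 m2).
  have -> : b ^+ k.+1 *: row i B - c ^+ k.+1 *: lincomb io (row i (Th ^+ k.+1)) B =
    b ^+ k *: (b *: row i B - c *: lincomb io (row i Th) B) +
    c *: (lincomb io (row i Th) (b ^+ k *: B - c ^+ k *: lincomb io (Th ^+ k) B)).
    rewrite scalerBr scalerA -exprSr /lincomb mulmxBr scalerBr !scalerA.
    rewrite -!scalemxAr !scalerA [c * b ^+ k]mulrC addrA subrK; congr (_ - _).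
    by rewrite -exprS mulmxA -map_mxM -row_mul [Th ^+ k.+1]exprS.
  apply: submodD => //; first exact: submodZ.
  apply: submodZ => //; apply: ksubspace_lincomb => // j.
  by have := IH j; rewrite linearB /= !linearZ /= row_lincomb.
have TT : Th ^+ p = T%:M.
  apply/eqP; rewrite -subr_eq0; apply/eqP/row_matrixP => i; rewrite row0; apply: B3.
  have hz : ishomog w m (lincomb io (row i (Th ^+ p - T%:M)) B).
    by apply: ksubspace_lincomb => [|j]; [apply: ksubspace_ishomog|case: (B1 j)].
  split=> //.
  have s1 : S1 (lincomb io (row i (Th ^+ p - T%:M)) B).
    by apply: ksubspace_lincomb => [|j]; [apply: submod_ksubspace|case: (B1 j)].
  have : S2 (c ^+ p *: lincomb io (row i (Th ^+ p - T%:M)) B).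
    have := submodB m2 (bpcp (proj1 (B1 i))) (pw p i); congr S2.
    rewrite opprB addrC addrA subrK linearB /= /lincomb map_mxB mulmxBl scalerBr; congr (_ - _).
    by rewrite map_row -row_mul map_scalar_mx mul_scalar_mx linearZ /= scalerA mulrC.
  move: (lincomb io _ B) s1 => x sx; elim: (p) => [|k IH]; first by rewrite expr0 scale1r.
  by rewrite exprS -scalerA => h; apply: IH; apply: ctf h; apply: submodZ.
apply: (@T_pow d (\det Th)); rewrite -(det_scalar d T) -TT.
elim: (p) => [|k IH]; first by rewrite !expr0 det1.
by rewrite exprS IH [Th ^+ k.+1]exprS -det_mulmx.
Qed.
End TorsionFree.

(** [S1] is finitely generated, so exponents depending on [u] can be replaced by their maximum over
    the generators. *)
Lemma nilp_local S1 S2 (f : R) : gsubmod w S1 -> gsubmod w S2 ->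
  (forall u, S1 u -> exists l, S2 (f ^+ l *: u)) -> nilp S1 S2 f.
Proof.
move=> g1 [m2 _] h; have [b [e [U [_ sU gU]]]] := graded_gens g1.
have hx i := h _ (sU i).
exists (\max_i proj1_sig (constructive_indefinite_description _ (hx i)))%N => u /gU [r ->].
rewrite mulmx_sum_row scaler_sumr; apply: submod_sum => // i.
rewrite scalerA mulrC -scalerA; apply: submodZ => //.
have := proj2_sig (constructive_indefinite_description _ (hx i)).
set l := sval _ => hl.
have le : (l <= \max_i proj1_sig (constructive_indefinite_description _ (hx i)))%N.
  exact: (@leq_bigmax _ (fun i => proj1_sig (constructive_indefinite_description _ (hx i)))).
by rewrite -(subnK le) exprD -scalerA; apply: submodZ.
Qed.

Lemma nilp_sub S1 S2 S1' S2' f : (forall u, S1' u -> S1 u) -> (forall u, S2 u -> S2' u) ->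
  nilp S1 S2 f -> nilp S1' S2' f.
Proof. by move=> h1 h2 [k hk]; exists k => u /h1 /hk /h2. Qed.

(** Induction on [j]. For j = 0 all variables are nilpotent and high degrees vanish. In the step put
    b = - F_j and c = x_(j+1)^(p^j), so that b^p - T c^p = - F_(j+1). Where [c] is regular, b / c is
    a p-th root of T; where [c] is nilpotent, so is F_j and the induction hypothesis applies. *)
Lemma devissage j : (j <= n)%N -> forall S1 S2, spair S1 S2 -> nilp S1 S2 (Fj j) ->
  (forall i, (j < i)%N -> (i <= n)%N -> nilp S1 S2 (X i)) -> pdim S1 S2.
Proof.
elim: j => [|j IHj] jn.
  move=> S1 S2 [g1 g2 h12] h0 hX.
  have hX' i : (i <= n)%N -> nilp S1 S2 (X i) by case: i => // i; apply: hX.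
  have [k hk] : exists k, forall i, (i <= n)%N -> forall u, S1 u -> S2 (X i ^+ k *: u).
    have hx (i : 'I_n.+1) := hX' i (ltn_ord i).
    exists (\max_i proj1_sig (constructive_indefinite_description _ (hx i))) => i lei u su.
    have := proj2_sig (constructive_indefinite_description _ (hx (Ordinal (lei : i < n.+1)%N))) u su.
    set l := sval _; move=> hl.
    have le : (l <= \max_i proj1_sig (constructive_indefinite_description _ (hx i)))%N.
      exact: (@leq_bigmax _ (fun i => proj1_sig (constructive_indefinite_description _ (hx i)))).
    by rewrite -(subnK le) exprD -scalerA; apply: submodZ => //; case: g2.
  have [b [e [U [hU sU gU]]]] := graded_gens g1.
  (* Above this degree the coefficient of each generator has degree above n.+1 * k, hence lies in
     the ideal that carries [S1] into [S2]. *)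
  pose N := (\max_i e i + n.+1 * k).+1%N.
  exists N => m leN d hd.
  suff -> : d = 0%N by rewrite dvdn0.
  apply: (reldim_uniq (gsubmod_ksubspace m g2) hd); apply: reldim_refl => u [su hu]; split=> //.
  have [r E] := gU u su; rewrite -(hpart_ishomog hu) E (hpart_mul m r hU) mulmx_sum_row.
  apply: submod_sum; first by case: g2.
  move=> i; pose I (f : R) := forall v, S1 v -> S2 (f *: v).
  have le : (e i + n.+1 * k < m)%N.
    by apply: leq_trans leN; rewrite ltnS leq_add2r; apply: (@leq_bigmax _ e).
  have : I (hpart e m r 0 i).
    apply: (@ideal_large K n.+1 k I _ _ _ _ (m - e i)%N).
    - by move=> v _; rewrite scale0r; case: g2 => -[].
    - move=> f f1 f2 h1 h2 v sv; rewrite scalerDl -scalerA.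
      by case: g2 => -[_ h] _; apply: h; auto.
    - by move=> l ltl v sv; apply: hk.
    - by rewrite ltn_subRL.
    - have := ishomog_hpart e m r i; have le' : (e i <= m)%N.
        by apply: leq_trans (ltnW le); apply: leq_addr.
      have Xm : 'X^m = 'X^(m - e i) * 'X^(e i) :> {poly R} by rewrite -exprD subnK.
      rewrite Xm mulrA mulrC => /mulIf; apply.
      by rewrite monic_neq0 ?monicXn.
  by apply.
pose F := Fj j.+1; pose b := - Fj j; pose c := X j.+1 ^+ (p ^ j); pose e := (p ^ j)%N.
have hF : homogenize K n.+1 F = F%:P * 'X^(p ^ j.+1) by apply: tower_hom.
have hb : homogenize K n.+1 b = b%:P * 'X^e.
  by rewrite rmorphN tower_hom ?(ltnW jn) // rmorphN mulNr.
have hc : homogenize K n.+1 c = c%:P * 'X^e by rewrite rmorphXn homogenizeX // exprMn rmorphXn.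
have hcl l : homogenize K n.+1 (c ^+ l) = (c ^+ l)%:P * 'X^(e * l).
  by rewrite rmorphXn hc exprMn -rmorphXn exprM.
have FE : b ^+ p - io T * c ^+ p = - F.
  rewrite /F /= exprNn -signr_odd p_odd expr1 mulN1r opprD; congr (_ - _ * _).
  by rewrite /c -exprM expnSr.
(* If [F] and a power of [c] annihilate the quotient, so does a power of F_j, since F_j^p = F - T
   c^p. *)
have torsion S S' : spair S S' -> (forall u, S u -> S' (F *: u)) -> nilp S S' c ->
    (forall i, (j.+1 < i)%N -> (i <= n)%N -> nilp S S' (X i)) -> pdim S S'.
  move=> hS hFS [L hL] hX; have [g g' _] := hS; have [m' _] := g'.
  apply: IHj => //; first exact: ltnW.
    apply: nilp_local => // u su; exists (p * L)%N.
    have : S' (c ^+ (p * L) *: u).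
      have le : (L <= p * L)%N by rewrite leq_pmull ?prime_gt0.
      rewrite -(subnK le) exprD -scalerA.
      by apply: submodZ => //; apply: hL.
    elim: (L) u su => [|l IHl] u su; first by rewrite muln0 !expr0.
    rewrite mulnS addnC !exprD -!scalerA => h.
    have -> : Fj j ^+ p *: u = F *: u - (io T * c ^+ p) *: u.
      by rewrite -scalerBl; congr (_ *: u); rewrite /F /= /c -exprM -expnSr addrK.
    rewrite scalerBr; apply: submodB => //; first by apply: submodZ => //; apply: hFS.
    rewrite scalerA mulrCA -!scalerA; apply: submodZ => //; apply: IHl => //.
    by apply: submodZ => //; case: g.
  move=> i; rewrite leq_eqVlt => /orP[/eqP<- _|]; last exact: hX.
  by exists (p ^ j * L)%N => u su; rewrite exprM; apply: hL.
have claim S1 S2 : spair S1 S2 -> (forall u, S1 u -> S2 (F *: u)) ->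
    (forall i, (j.+1 < i)%N -> (i <= n)%N -> nilp S1 S2 (X i)) -> pdim S1 S2.
  move=> hS hFS hX; have [g1 g2 h12] := hS; have [[m1 c1] [m2 c2]] := (g1, g2).
  (* Three layers: [c] is nilpotent on S1 / Sf and on Tor / S2, while theta = b / c acts on the
     middle layer Sf / Tor. *)
  pose Tor u := S1 u /\ exists l, S2 (c ^+ l *: u).
  have Tup u l l' : (l <= l')%N -> S2 (c ^+ l *: u) -> S2 (c ^+ l' *: u).
    by move=> le h; rewrite -(subnK le) exprD -scalerA; apply: submodZ.
  have TorS2 u : S2 u -> Tor u.
    by move=> su; split; [apply: h12|exists 0%N; rewrite expr0 scale1r].
  have gT : gsubmod w Tor.
    split; first split.
    - by apply: TorS2; case: m2.
    - move=> r u v [su [l hl]] [sv [l' hl']]; split; first exact: (proj2 m1).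
      exists (maxn l l'); rewrite scalerDr scalerA mulrC -scalerA.
      by apply: (proj2 m2); [apply: Tup hl; apply: leq_maxl|apply: Tup hl'; apply: leq_maxr].
    - move=> m u [su [l hl]]; split; first exact: c1.
      by exists l; rewrite -(hpart_homM _ _ _ (hcl l)); apply: c2.
  have mT := proj1 gT.
  (* The elements on which theta can be iterated for ever; [v i] represents theta^i u modulo
     [Tor]. *)
  pose Sf u := exists v : nat -> 'rV[R]_a, v 0%N = u /\
    forall i, S1 (v i) /\ Tor (b *: v i - c *: v i.+1).
  have Sf1 u : Sf u -> S1 u by case=> v [<- /(_ 0%N) []].
  have TorSf u : Tor u -> Sf u.
    move=> tu; exists (fun i => if i == 0%N then u else 0); split=> // -[|i] /=.
      by split; [case: tu|rewrite scaler0 subr0; exact: (submodZ b mT tu)].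
    by rewrite !scaler0 subr0; split; [case: m1|case: mT].
  have gSf : gsubmod w Sf.
    split; first split.
    - by apply: TorSf; case: mT.
    - move=> r u u' [v [<- homv]] [v' [<- hv']]; exists (fun i => r *: v i + v' i).
      split=> // i; have [[s1 t1] [s2 t2]] := (homv i, hv' i).
      split; first exact: (proj2 m1).
      have -> : b *: (r *: v i + v' i) - c *: (r *: v i.+1 + v' i.+1) =
        r *: (b *: v i - c *: v i.+1) + (b *: v' i - c *: v' i.+1).
        by rewrite !scalerDr scalerN !scalerA ![_ * r]mulrC opprD addrACA.
      exact: (proj2 mT).
    - move=> m u [v [<- homv]]; exists (fun i => hpart w m (v i)); split=> // i.
      have [s1 t1] := homv i; split; first exact: c1.
      by rewrite -(hpart_homM _ _ _ hb) -(hpart_homM _ _ _ hc) -hpartN -hpartD; apply: (proj2 gT).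
  have p0 := prime_gt0 p_pr.
  have cS u : S1 u -> Sf (c ^+ p.-1 *: u).
    (* This is theta^i applied to c^(p-1) u, reduced by theta^p = T: the power of T grows by one
       every [p] steps. *)
    move=> su; exists (fun i => (io T ^+ (i %/ p) * (b ^+ (i %% p) * c ^+ (p.-1 - i %% p))) *: u).
    split=> [|i]; first by rewrite div0n mod0n !expr0 !mul1r subn0.
    split; first exact: submodZ.
    rewrite !scalerA -scalerBl; have ltp := ltn_pmod i p0.
    have Ei := divn_eq i p; set q := (i %/ p)%N in Ei *; set r := (i %% p)%N in Ei ltp *.
    have [lt|ge] := ltnP r.+1 p.
      have -> : (i.+1 %/ p = q)%N by rewrite Ei -addnS divnMDl // divn_small // addn0.
      have -> : (i.+1 %% p = r.+1)%N by rewrite Ei -addnS modnMDl modn_small.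
      have -> : (p.-1 - r = (p.-1 - r.+1).+1)%N by rewrite subnSK // -ltnS prednK.
      rewrite [X in X *: u](_ : _ = 0) ?scale0r; first by case: mT.
      rewrite !exprS (mulrCA b (io T ^+ q)) (mulrCA c (io T ^+ q)) -[b * b ^+ r * _]mulrA.
      by rewrite (mulrCA c b) (mulrCA (b ^+ r) c) subrr.
    have rE : r = p.-1 by apply/eqP; rewrite eqn_leq -ltnS prednK // ltp -ltnS prednK.
    have rS : r.+1 = p by rewrite rE prednK.
    have -> : (i.+1 %/ p = q.+1)%N by rewrite Ei -addnS rS addnC -mulSn mulnK.
    have -> : (i.+1 %% p = 0)%N by rewrite Ei -addnS rS addnC -mulSn modnMl.
    rewrite subn0 -rE subnn !expr0 mulr1 mul1r.
    have E1 : b * (io T ^+ q * b ^+ r) = io T ^+ q * b ^+ p by rewrite mulrCA -exprS rS.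
    have E2 : c * (io T ^+ q.+1 * c ^+ r) = io T ^+ q * (io T * c ^+ p).
      by rewrite mulrCA -exprS rS exprSr mulrA.
    rewrite E1 E2 -mulrBr FE.
    rewrite -scalerA scaleNr.
    exact: (submodZ _ mT (submodN mT (TorS2 _ (hFS _ su)))).
  have hnil1 : nilp S1 Sf c by exists p.-1.
  have hT : nilp Tor S2 c by apply: nilp_local => // u [].
  have p1 : pdim Tor S2.
    apply: torsion => //.
      by move=> u [su _]; apply: hFS.
    by move=> i lt le; apply: nilp_sub (hX i lt le) => // u [].
  have p2 : pdim Sf Tor.
    exists 0%N => m _ d; apply: (@torsion_free_dvd b c e Sf Tor) => //.
    - move=> u /Sf1 su; rewrite -scalerBl FE scaleNr.
      exact: (submodN mT (TorS2 _ (hFS _ su))).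
    - move=> u /Sf1 su [_ [l hl]]; split=> //; exists l.+1.
      by rewrite exprSr -scalerA.
    - move=> u [v [<- homv]]; exists (v 1%N); split; last by case: (homv 0%N).
      by exists (fun i => v i.+1).
  have p3 : pdim S1 Sf.
    apply: torsion => //.
      by move=> u su; apply/TorSf/TorS2/hFS.
    by move=> i lt le; apply: nilp_sub (hX i lt le) => // u /TorS2 /TorSf.
  apply: (pdim_trans _ _ p3); [by split|by split=> // u /TorS2 /TorSf|].
  by apply: (pdim_trans _ _ p2); [split|split=> // u []|].
move=> S1 S2 hS [k hk]; elim: k S1 S2 hS hk => [|k IHk] S1 S2 hS hk hX.
  apply: claim => // u su; have [_ g2 _] := hS.
  by apply: submodZ; [case: g2|have := hk u su; rewrite expr0 scale1r].
have [g1 g2 h12] := hS; have m2 := proj1 g2; have m1 := proj1 g1.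
(* Between [S1] and [S2] insert F S1 + S2: [F] kills the upper quotient, and F^k the lower one. *)
pose S' u := exists s t, [/\ S1 s, S2 t & u = F *: s + t].
have gS' : gsubmod w S' by apply: gsubZ hF g1 g2.
have S2S' u : S2 u -> S' u.
  by move=> su; exists 0, u; rewrite scaler0 add0r; split=> //; case: m1.
have S'S1 u : S' u -> S1 u.
  by move=> [s [t [hs ht ->]]]; apply: (proj2 m1) => //; apply: h12.
apply: (@pdim_trans S1 S' S2); try by split.
  apply: claim => //.
    by move=> u su; exists u, 0; rewrite addr0; split=> //; case: m2.
  by move=> i lt le; apply: nilp_sub (hX i lt le).
apply: IHk => //.
  move=> u [s [t [hs ht ->]]]; rewrite scalerDr scalerA -exprSr.
  by apply: submodD => //; [apply: hk|apply: submodZ].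
by move=> i lt le; apply: nilp_sub (hX i lt le).
Qed.

Lemma graded_dim_dvd S1 S2 : spair S1 S2 -> nilp S1 S2 (Fj n) -> pdim S1 S2.
Proof.
move=> hS hF; apply: (devissage (leqnn n)) => // i lt le.
by rewrite ltnNge le in lt.
Qed.
End Devissage.
End DClaim.

(** * Euler characteristics modulo p *)

Section Evaluation.
Variables (K : fieldType) (B : comNzRingType) (f : {rmorphism K -> B}) (x : nat -> B).

Definition evstep n (h : {rmorphism ipoly K n -> B}) (b : B) : {rmorphism {poly (ipoly K n)} -> B} :=
  horner_morph (fun c => mulrC b (h c)).

Fixpoint ipoly_eval n : {rmorphism ipoly K n -> B} :=
  if n is n'.+1 then evstep (ipoly_eval n') (x n') else f.

Lemma ipoly_eval_polyC n (c : ipoly K n) : ipoly_eval n.+1 c%:P = ipoly_eval n c.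
Proof. exact: horner_morphC. Qed.

Lemma ipevC n c : ipoly_eval n (ipolyC K n c) = f c.
Proof. by elim: n => [//|n IH]; rewrite ipoly_eval_polyC. Qed.

Lemma ipevX n i : (i < n)%N -> ipoly_eval n (ipolyX K n i) = x i.
Proof.
elim: n => [//|n IH]; rewrite ltnS leq_eqVlt => /orP[/eqP->|lt].
  by rewrite [ipolyX _ _ _]/= eqxx; apply: horner_morphX.
by rewrite [ipolyX _ _ _]/= ltn_eqF // ipoly_eval_polyC IH.
Qed.
End Evaluation.

Lemma rmorph_tower p (R S : comNzRingType) (h : {rmorphism R -> S}) t x j :
  h (tower p t x j) = tower p (h t) (fun i => h (x i)) j.
Proof. by elim: j => [//|j IH]; rewrite /= rmorphD rmorphM !rmorphXn IH. Qed.

Lemma eq_tower p (R : comNzRingType) (t : R) x y j : (forall i, (i <= j)%N -> x i = y i) ->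
  tower p t x j = tower p t y j.
Proof.
elim: j => [|j IH] h /=; first exact: h.
by rewrite IH ?h // => i lei; apply: h; apply: leqW.
Qed.

(** The point (1, 0, ..., 0) lies off the hypersurface. It shows that F is nonzero, and later serves
    as the rational point at which a chain of primes ends. *)
Lemma tower_basepoint p (R : comNzRingType) (t : R) j : (0 < p)%N ->
  tower p t (fun i => (i == 0%N)%:R) j = 1.
Proof.
by move=> p0; elim: j => [//|j IH]; rewrite /= IH expr1n expr0n expn_eq0 gtn_eqF //= mulr0 addr0.
Qed.

Section EulerCharacteristic.
Variables (K : fieldType) (T : K) (p : nat).
Hypotheses (p_pr : prime p) (p_odd : odd p).
Hypothesis T_pow : forall d (t : K), t ^+ p = T ^+ d -> (p %| d)%N.
Variable n : nat.
Local Notation R := (ipoly K n.+1).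
Local Notation io := (ipolyC K n.+1).
Definition towerF : R := tower p (io T) (ipolyX K n.+1) n.
Local Notation F := towerF.
Local Notation q := (p ^ n)%N.

Lemma towerF_hom : homogenize K n.+1 F = F%:P * 'X^q.
Proof. exact: tower_hom. Qed.

Lemma towerFX_hom k : homogenize K n.+1 (F ^+ k) = (F ^+ k)%:P * 'X^(k * q).
Proof. by rewrite rmorphXn towerF_hom exprMn -rmorphXn -exprM mulnC. Qed.

Lemma degle_weight a (w : 'I_a -> nat) e m (u : 'rV[R]_a) :
  degle (fun j => w j + e)%N m u -> degle w m u.
Proof. by move=> h; apply/(degle_shift w m e); apply: degle_leq h; apply: leq_addr. Qed.

Section Compare.
Variables (a a1 a2 : nat) (w : 'I_a1 -> nat) (w' : 'I_a2 -> nat).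
Variables (Phi : 'M[R]_(a, a1)) (Psi : 'M[R]_(a, a2)).
Hypothesis Phi_inj : forall u : 'rV_a, u *m Phi = 0 -> u = 0.
Variable c : nat.
Hypothesis cmp1 : forall m (u : 'rV_a), degle w m (u *m Phi) -> degle w' (m + c) (u *m Psi).
Hypothesis cmp2 : forall m (u : 'rV_a), degle w' m (u *m Psi) -> degle w (m + c) (u *m Phi).
Implicit Types E : 'rV[R]_a -> Prop.

Lemma ksubspace_dlmul a3 (v : 'I_a3 -> nat) (M : 'M[R]_(a, a3)) m : ksubspace io (fun u => degle v m (u *m M)).
Proof.
have k := ksubspace_degle K n.+1 v m; split; first by rewrite mul0mx; apply: ksubspace0 k.
by move=> d x y hx hy; rewrite mulmxDl -scalemxAl; apply: (proj2 k).
Qed.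

Lemma findim_dlmul m : findim io (fun u => degle w m (u *m Phi)).
Proof.
apply: (findim_inj (phi := fun u => u *m Phi)) (findim_degle K n.+1 w m) => //.
by move=> d u v; rewrite mulmxDl -scalemxAl.
Qed.

(* Moves from the filtration by [w] through [Phi] at [j = 0] to the one by [w'] through
   [Psi] at [j = c + c]; consecutive steps differ by graded pieces of leading modules. *)
Definition interp j m u := degle w (m + j) (u *m Phi) /\ degle w' (m + c) (u *m Psi).

Lemma ksubspace_EI E j m : submod E -> ksubspace io (fun u => E u /\ interp j m u).
Proof.
move=> hE; apply: ksubspaceI; first exact: submod_ksubspace.
by apply: ksubspaceI; apply: ksubspace_dlmul.
Qed.

Lemma findim_EI E j m : findim io (fun u => E u /\ interp j m u).
Proof. by apply: (@findim_sub _ _ io _ _ (fun u => degle w (m + j) (u *m Phi))); [move=> u [_ []]|apply: findim_dlmul]. Qed.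

Section Step.
Variable j : nat.
Let w2 i := (w' i + j.+1)%N.

(** Leading forms for [w] of those elements of [E] that also obey the bound by [w']. The shift in
    [w2] makes the part of degree m + j + 1 the step from [interp j m] to [interp j.+1 m], and
    letting [M] vary collects these steps into one graded module. *)
Definition leadmod E (y : 'rV[R]_a1) := forall M, exists u,
  [/\ E u, degle w M (u *m Phi), degle w2 (M + c) (u *m Psi) & hpart w M (u *m Phi) = hpart w M y].

Lemma gsubmod_leadmod E : submod E -> gsubmod w (leadmod E).
Proof.
move=> hE; have E0 : E 0 by case: hE.
have dl0 a3 (v : 'I_a3 -> nat) m (M : 'M[R]_(a, a3)) : degle v m (0 *m M).
  by apply: ksubspace0 (ksubspace_dlmul v M m).
split; first split.
- by move=> M; exists 0; split=> //; rewrite mul0mx.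
- move=> r x y hx hy M; have [u hu] := choice _ hx; have [v [v1 v2 v3 v4]] := hy M.
  (* [r] need not be homogeneous, so degree [M] of r x collects lifts from the degrees M - i. *)
  pose t := \sum_(i < M.+1) (homogenize K n.+1 r)`_i *: u (M - i)%N.
  have tM a3 (A : 'M[R]_(a, a3)) : t *m A = \sum_(i < M.+1) (homogenize K n.+1 r)`_i *: (u (M - i)%N *m A).
    by rewrite mulmx_suml; apply: eq_bigr => i _; rewrite -scalemxAl.
  have dlt a3 (z : 'I_a3 -> nat) (A : 'M[R]_(a, a3)) C :
    (forall m, degle z (m + C) (u m *m A)) -> degle z (M + C) (t *m A).
    move=> h; rewrite tM; apply: ksubspace_sum (ksubspace_degle _ _ z (M + C)) _ => i.
    have -> : (M + C = M - i + C + i)%N by rewrite addnAC subnK // -ltnS.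
    apply: degleZ (h _); rewrite homogenize_coef.
    by apply: leq_trans (size_polyMleq _ _) _; rewrite size_polyXn addnS /= size_polyC;
      case: eqP.
  exists (t + v); split.
  - by apply: submodD => //; apply: submod_sum => // i; apply: submodZ => //; case: (hu (M - i)%N).
  - rewrite mulmxDl; apply: ksubspaceD (ksubspace_degle _ _ w M) _ v2; rewrite -[M]addn0; apply: dlt => m.
    by rewrite addn0; case: (hu m).
  - rewrite mulmxDl; apply: ksubspaceD (ksubspace_degle _ _ w2 (M + c)) _ v3; apply: dlt => m.
    by case: (hu m).
  - rewrite mulmxDl !hpartD v4; congr (_ + _); rewrite hpartM tM hpart_sum; apply: eq_bigr => i _.
    have le : (i <= M)%N by rewrite -ltnS.
    rewrite -{1}(subnK le) hpart_homM; first by case: (hu (M - i)%N) => _ _ _ ->.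
    exact: homogenize_coef.
- move=> m y hy M; have [->|ne] := eqVneq M m.
    have [u [h1 h2 h3 h4]] := hy m; exists u; split=> //.
    by rewrite (hpart_ishomog (ishomog_hpart w m y)).
  exists 0; split=> //; rewrite mul0mx hpart0.
  by rewrite (hpart_homog0 (ishomog_hpart w m y)).
Qed.

Lemma reldim_leadmod E m d : submod E ->
  reldim io (fun u => E u /\ interp j.+1 m u) (fun u => E u /\ interp j m u) d ->
  reldim io (fun y => leadmod E y /\ ishomog w (m + j.+1) y) (@zerov _ _) d.
Proof.
move=> hE; apply: (reldim_map (phi := fun u => hpart w (m + j.+1) (u *m Phi))).
- by move=> x u v; rewrite mulmxDl hpartD -scalemxAl hpartZ.
- exact: ksubspace_zerov.
- move=> u [eu [h1 h2]]; split; last exact: ishomog_hpart.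
  move=> M; have [->|ne] := eqVneq M (m + j.+1)%N.
    exists u; split=> //; last by rewrite (hpart_ishomog (ishomog_hpart w _ _)).
    by rewrite addnAC; apply/degle_shift.
  exists 0; rewrite !mul0mx hpart0 (hpart_homog0 (ishomog_hpart w _ _)) //; split=> //; first by case: hE.
    exact: ksubspace0 (ksubspace_degle _ _ _ _).
  exact: ksubspace0 (ksubspace_degle _ _ _ _).
- by move=> u [eu [/degleP h1 h2]]; rewrite /zerov h1 // addnS.
- move=> e x b hb; have [eb [h1 h2]] : E (lincomb io x b) /\ interp j.+1 m (lincomb io x b).
    exact: (ksubspace_lincomb x (ksubspace_EI j.+1 m hE) hb).
  rewrite /zerov => h0; split=> //; split=> //; apply/degleP => M.
  rewrite leq_eqVlt => /orP[/eqP<-|lt]; first by rewrite -addnS.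
  by move/degleP: h1; apply; rewrite addnS.
- move=> v [homv hw']; have [u [u1 u2 u3 u4]] := homv (m + j.+1)%N.
  exists u; split; last by rewrite /zerov u4 (hpart_ishomog hw') subrr.
  by split=> //; split=> //; move: u3; rewrite addnAC => /degle_shift.
Qed.

(** From j to j + 1 the bounded pieces of [E1] and [E2] grow by the degree m + j + 1 parts of their
    leading modules. A power of the homogeneous F carries the first leading module into the second,
    so the two gains differ by a multiple of [p]. *)
Lemma interp_step E1 E2 k : submod E1 -> submod E2 -> (forall u, E2 u -> E1 u) ->
  (forall u, E1 u -> E2 (F ^+ k *: u)) ->
  exists m0, forall m, (m0 <= m)%N -> forall d d',
    reldim io (fun u => E1 u /\ interp j m u) (fun u => E2 u /\ interp j m u) d ->
    reldim io (fun u => E1 u /\ interp j.+1 m u) (fun u => E2 u /\ interp j.+1 m u) d' ->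
    d%:R = d'%:R :> 'F_p.
Proof.
move=> s1 s2 h12 hF; have g1 := gsubmod_leadmod s1; have g2 := gsubmod_leadmod s2.
have sp : spair w (leadmod E1) (leadmod E2).
  by split=> // y hy M; have [u [? ? ? ?]] := hy M; exists u; split; auto.
have np : nilp (leadmod E1) (leadmod E2) F.
  exists k => y hy M; have [le|lt] := leqP (k * q)%N M.
    have [u [u1 u2 u3 u4]] := hy (M - k * q)%N; exists (F ^+ k *: u).
    have sz : (size (homogenize K n.+1 (F ^+ k)) <= (k * q).+1)%N.
      rewrite towerFX_hom; apply: leq_trans (size_polyMleq _ _) _.
      by rewrite size_polyXn addnS /= size_polyC; case: eqP.
    split; first exact: hF.
    - by rewrite -scalemxAl -(subnK le); apply: degleZ.
    - by rewrite -scalemxAl -(subnK le) addnAC; apply: degleZ.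
    - by rewrite -scalemxAl -(subnK le) !(hpart_homM _ _ _ (towerFX_hom k)) u4.
  exists 0; rewrite !mul0mx hpart0; split; first by case: s2.
  - exact: ksubspace0 (ksubspace_degle _ _ _ _).
  - exact: ksubspace0 (ksubspace_degle _ _ _ _).
  rewrite hpartM big1 // => i _; rewrite towerFX_hom coefCM coefXn.
  by rewrite ltn_eqF ?mulr0 ?scale0r // (leq_ltn_trans _ lt) // -ltnS.
have [m0 hm0] := graded_dim_dvd p_pr p_odd T_pow sp np.
exists m0 => m lem d d' hd hd'.
have kE i E (s : submod E) := ksubspace_EI i m s.
have mono E u : E u /\ interp j m u -> E u /\ interp j.+1 m u.
  by case=> eu [h1 h2]; split=> //; split=> //; apply: degle_leq h1; rewrite addnS.
have [d1 hd1] := reldim_exists (findim_EI E1 j.+1 m) (kE j _ s1).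
have [d2 hd2] := reldim_exists (findim_EI E2 j.+1 m) (kE j _ s2).
have k0 := ksubspace_zerov io a1.
have e1 := reldim_leadmod s1 hd1; have e2 := reldim_leadmod s2 hd2.
have [d3 hd3] := reldim_exists (findim_gr w (leadmod E1) (m + j.+1)) (gsubmod_ksubspace (m + j.+1) g2).
have zg E u : gsubmod w (leadmod E) -> @zerov _ a1 u -> leadmod E u /\ ishomog w (m + j.+1) u.
  by move=> g ->; apply: ksubspace0 (gsubmod_ksubspace _ g).
have E13 : d1 = (d3 + d2)%N.
  apply: (reldim_uniq k0 e1); apply: (reldim_add k0 _ _ (gsubmod_ksubspace (m + j.+1) g2) hd3 e2).
    by move=> u [h1 h2]; split=> //; case: sp => _ _; apply.
  by move=> u; apply: zg.
have p3 : (p %| d3)%N by apply: (hm0 (m + j.+1)%N) hd3; apply: leq_trans lem _; apply: leq_addr.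
(* Both sides are the dimension of the larger piece of [E1] modulo the smaller piece of [E2],
   counted through [E2] and through [E1]. *)
have E4 : (d' + d2 = d1 + d)%N.
  apply: (@reldim_uniq _ _ io a (fun u => E1 u /\ interp j.+1 m u) (fun u => E2 u /\ interp j m u)).
  - exact: kE.
  - apply: (reldim_add _ _ _ _ hd' hd2); [exact: kE| |exact: mono|exact: kE].
    by move=> u [? ?]; split; auto.
  - apply: (reldim_add _ _ _ _ hd1 hd); [exact: kE|exact: mono| |exact: kE].
    by move=> u [? ?]; split; auto.
have {E4}-> : d' = (d + d3)%N.
  by apply/eqP; rewrite -(eqn_add2r d2) E4 E13 addnAC [(d3 + d)%N]addnC.
by rewrite natrD; case/dvdnP: p3 => z ->; rewrite natrM pchar_Fp_0 // mulr0 addr0.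
Qed.
End Step.

Definition fdim E1 E2 a3 (v : 'I_a3 -> nat) (M : 'M[R]_(a, a3)) m d :=
  reldim io (fun u => E1 u /\ degle v m (u *m M)) (fun u => E2 u /\ degle v m (u *m M)) d.

(** Both ends of the interpolation are honest filtrations: at j = 0 the second bound follows from
    [cmp1], at j = c + c the first follows from [cmp2]. None of the steps in between changes the
    dimension mod [p]. *)
Lemma fdim_compare E1 E2 k : submod E1 -> submod E2 -> (forall u, E2 u -> E1 u) ->
  (forall u, E1 u -> E2 (F ^+ k *: u)) ->
  exists m0, forall m, (m0 <= m)%N -> forall d d',
    fdim E1 E2 w Phi m d -> fdim E1 E2 w' Psi (m + c) d' -> d%:R = d'%:R :> 'F_p.
Proof.
move=> s1 s2 h12 hF.
have H j : exists m0, forall m, (m0 <= m)%N -> forall d d',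
    fdim E1 E2 w Phi m d ->
    reldim io (fun u => E1 u /\ interp j m u) (fun u => E2 u /\ interp j m u) d' ->
    d%:R = d'%:R :> 'F_p.
  elim: j => [|j [m1 H1]].
    exists 0%N => m _ d d' hd hd'; congr _%:R; apply: reldim_uniq hd'; first exact: ksubspace_EI.
    by apply: reldim_ext hd => u; rewrite /interp addn0; split=> [[h1 h2]|[h1 [h2 h3]]]; split=> //;
      split=> //; apply: cmp1.
  have [m2 H2] := interp_step j s1 s2 h12 hF.
  exists (maxn m1 m2) => m; rewrite geq_max => /andP[le1 le2] d d' hd hd'.
  have [d2 hd2] := reldim_exists (findim_EI E1 j m) (ksubspace_EI j m s2).
  by rewrite (H1 m le1 d d2 hd hd2); apply: (H2 m le2 d2 d' hd2 hd').
have [m0 H0] := H (c + c)%N; exists m0 => m lem d d' hd hd'.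
apply: (H0 m lem d d' hd).
apply: reldim_ext hd' => u; rewrite /interp addnA; split=> [[h1 h2]|[h1 [h2 h3]]]; split=> //.
  by split=> //; apply: cmp2.
by split=> //; apply: cmp2.
Qed.
End Compare.

(** One-sided, so that embeddings into a larger free module qualify; for square matrices [tinv_comm]
    supplies the other side. *)
Definition tinv a b (M : 'M[R]_(a, b)) := exists k (N : 'M[R]_(b, a)), M *m N = (F ^+ k)%:M.

Definition commensurable a (E1 E2 : 'rV[R]_a -> Prop) := [/\ submod E1, submod E2, forall u, E2 u -> E1 u
  & exists k, forall u, E1 u -> E2 (F ^+ k *: u)].

Definition is_eulerW a (E1 E2 : 'rV[R]_a -> Prop) b (v : 'I_b -> nat) (M : 'M[R]_(a, b)) (c : 'F_p) :=
  exists m0, forall m, (m0 <= m)%N -> forall d, fdim E1 E2 v M m d -> d%:R = c.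

Definition is_euler a E1 E2 c := @is_eulerW a E1 E2 a (fun=> 0%N) 1%:M c.

(* Meaningful for commensurable pairs only, where the dimension mod [p] stabilizes. *)
Definition euler a E1 E2 : 'F_p := epsilon (inhabits 0) (@is_euler a E1 E2).

Definition rowimg a b (E : 'rV[R]_a -> Prop) (M : 'M[R]_(a, b)) v := exists u, E u /\ v = u *m M.

Lemma towerF_neq0 : F != 0.
Proof.
pose h := ipoly_eval idfun (fun i => (i == 0%N)%:R : K) n.+1.
apply: contra_neq (oner_neq0 K) => F0; rewrite -[LHS](tower_basepoint T n (prime_gt0 p_pr)).
rewrite -(rmorph0 h) -F0 rmorph_tower ipevC; apply: eq_tower => i lei.
by rewrite ipevX.
Qed.

Lemma FX_neq0 k : F ^+ k != 0. Proof. exact: expf_neq0 towerF_neq0. Qed.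

Lemma tinv_inj a b (M : 'M[R]_(a, b)) (u : 'rV_a) : tinv M -> u *m M = 0 -> u = 0.
Proof.
move=> [k [N hN]] h; apply/eqP; have := mul0mx 1 N; rewrite -h -mulmxA hN mul_mx_scalar.
by move/eqP; rewrite scalemx_eq0 (negbTE (FX_neq0 k)).
Qed.

Lemma tinv1 a : tinv (1%:M : 'M_a).
Proof. by exists 0%N, 1%:M; rewrite mulmx1 expr0. Qed.

Lemma tinvM a b c (M : 'M[R]_(a, b)) (N : 'M[R]_(b, c)) : tinv M -> tinv N -> tinv (M *m N).
Proof.
move=> [k [M' homogM]] [l [N' hN]]; exists (k + l)%N, (N' *m M').
by rewrite mulmxA -(mulmxA M) hN mul_mx_scalar -scalemxAl homogM exprD mulrC scale_scalar_mx.
Qed.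

Lemma tinv_unit a b (M : 'M[R]_(a, b)) N : M *m N = 1%:M -> tinv M.
Proof. by move=> h; exists 0%N, N; rewrite h expr0. Qed.

Lemma mx_bounded a b (w : 'I_b -> nat) (M : 'M[R]_(a, b)) : exists c, degleM w (fun=> c) M.
Proof.
have hx i := degle_exists w (row i M).
exists (\max_i proj1_sig (constructive_indefinite_description _ (hx i)))%N => i.
have := proj2_sig (constructive_indefinite_description _ (hx i)); apply: degle_leq.
exact: (@leq_bigmax _ (fun i => proj1_sig (constructive_indefinite_description _ (hx i)))).
Qed.

Lemma degle_lew a (w v : 'I_a -> nat) m (u : 'rV[R]_a) :
  (forall j, w j <= v j)%N -> degle v m u -> degle w m u.
Proof.
move=> h hu j; have [->|u0] := eqVneq (u 0 j) 0; first by rewrite rmorph0 mulr0 size_poly0.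
have h0 : homogenize K n.+1 (u 0 j) != 0 by rewrite -(rmorph0 (homogenize K n.+1)) (inj_eq (@homogenize_inj K n.+1)).
apply: leq_trans (hu j); rewrite ![_ * homogenize _ _ _]mulrC !size_Mmonic ?monicXn //.
by rewrite !size_polyXn !addnS leq_add2l.
Qed.

Lemma degle_const a (u : 'rV[R]_a) m c : degle (fun=> 0%N) m u <-> degle (fun=> c) (m + c) u.
Proof. by split; move/(degle_shift (fun=> 0%N) m c u). Qed.

(** [M] raises degrees by a bounded amount, and the degree of [u] is recovered from u M N = F^k
    u. *)
Lemma tinv_cmp a b (w : 'I_b -> nat) (M : 'M[R]_(a, b)) : tinv M -> exists c,
  (forall m (u : 'rV_a), degle (fun=> 0%N) m (u *m 1%:M) -> degle w (m + c) (u *m M)) /\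
  (forall m (u : 'rV_a), degle w m (u *m M) -> degle (fun=> 0%N) (m + c) (u *m 1%:M)).
Proof.
move=> [k [N hN]]; have [c1 h1] := mx_bounded w M; have [c2 h2] := mx_bounded (fun=> 0%N) N.
exists (c1 + c2)%N; split=> m u; rewrite mulmx1 => hu.
  by apply: (degle_mul h1); apply: degle_leq (proj1 (degle_const u m c1) hu); rewrite leq_add2l leq_addr.
have h3 : degle (fun=> 0%N) (m + c2) (u *m M *m N).
  by apply: (degle_mul h2); apply/degle_const; apply: degle_lew hu.
rewrite -mulmxA hN mul_mx_scalar in h3.
have := proj1 (degle_hom _ _ _ (FX_neq0 k) (towerFX_hom k)) h3.
move/degle_weight; apply: degle_leq; by rewrite leq_add2l leq_addl.
Qed.

Section Chi.
Variable a : nat.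
Implicit Types E : 'rV[R]_a -> Prop.

Lemma commensurable_fdim E1 E2 b (v : 'I_b -> nat) (M : 'M[R]_(a, b)) m : tinv M -> commensurable E1 E2 ->
  exists d, fdim E1 E2 v M m d.
Proof.
move=> fM [s1 s2 _ _]; apply: reldim_exists.
  apply: (@findim_sub _ _ io _ _ (fun u => degle v m (u *m M))); first by move=> u [].
  by apply: findim_dlmul => u; apply: tinv_inj.
by apply: ksubspaceI; [apply: submod_ksubspace|apply: ksubspace_dlmul].
Qed.

Lemma is_eulerW_uniq E1 E2 b (v : 'I_b -> nat) (M : 'M[R]_(a, b)) c c' : tinv M -> commensurable E1 E2 ->
  is_eulerW E1 E2 v M c -> is_eulerW E1 E2 v M c' -> c = c'.
Proof.
move=> fM hE [m0 h0] [m1 h1]; have [d hd] := commensurable_fdim v (maxn m0 m1) fM hE.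
by rewrite -(h0 _ (leq_maxl _ _) d hd) -(h1 _ (leq_maxr _ _) d hd).
Qed.

(** Comparing the degree filtration with itself shifted by c = 1 shows that consecutive dimensions
    agree mod [p]. *)
Lemma is_euler_exists E1 E2 : commensurable E1 E2 -> exists c, is_euler E1 E2 c.
Proof.
move=> hE; have [s1 s2 h12 [k hk]] := hE.
have [|||m0 h0] := @fdim_compare a a a (fun=> 0%N) (fun=> 0%N) 1%:M 1%:M _ 1 _ _ E1 E2 k s1 s2 h12 hk.
- by move=> u; rewrite mulmx1.
- by move=> m u; apply: degle_leq; apply: leq_addr.
- by move=> m u; apply: degle_leq; apply: leq_addr.
have [d0 hd0] := commensurable_fdim (fun=> 0%N) m0 (tinv1 a) hE.
exists (d0%:R); exists m0 => m /subnK <-.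
elim: (m - m0)%N => [|i IH] d hd; first by congr _%:R; apply: reldim_uniq hd hd0; apply: ksubspaceI;
  [apply: submod_ksubspace|apply: ksubspace_dlmul].
have [d' hd'] := commensurable_fdim (fun=> 0%N) (i + m0) (tinv1 a) hE.
rewrite -(IH d' hd'); apply/esym/(h0 (i + m0)%N _ _ _ hd'); first exact: leq_addl.
by rewrite addn1.
Qed.

Lemma eulerP E1 E2 : commensurable E1 E2 -> is_euler E1 E2 (euler E1 E2).
Proof. by move=> /is_euler_exists; apply: epsilon_spec. Qed.

Lemma euler_eq E1 E2 c : commensurable E1 E2 -> is_euler E1 E2 c -> euler E1 E2 = c.
Proof. by move=> hE; apply: is_eulerW_uniq (tinv1 a) hE (eulerP hE). Qed.

(** The class mod [p] does not depend on weights or on the embedding, so weights may be adapted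
    later to the matrix under study. *)
Lemma eulerW E1 E2 b (v : 'I_b -> nat) (M : 'M[R]_(a, b)) : tinv M -> commensurable E1 E2 ->
  is_eulerW E1 E2 v M (euler E1 E2).
Proof.
move=> fM hE; have [s1 s2 h12 [k hk]] := hE; have [C [c1 c2]] := tinv_cmp v fM.
have [|m0 h0] := @fdim_compare a a b (fun=> 0%N) v 1%:M M _ C c1 c2 E1 E2 k s1 s2 h12 hk.
  by move=> u; rewrite mulmx1.
have [m1 h1] := eulerP hE; exists (maxn m0 m1 + C)%N => m le d hd.
have leC : (C <= m)%N by apply: leq_trans le; apply: leq_addl.
have leM : (maxn m0 m1 <= m - C)%N by rewrite -(leq_add2r C) subnK.
move: leM; rewrite geq_max => /andP[l0 l1].
have [d' hd'] := commensurable_fdim (fun=> 0%N) (m - C)%N (tinv1 a) hE.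
rewrite -(h1 _ l1 d' hd'); apply/esym/(h0 _ l0 _ _ hd').
by rewrite subnK.
Qed.

Lemma euler_add E1 E2 E3 : commensurable E1 E2 -> commensurable E2 E3 -> euler E1 E3 = euler E1 E2 + euler E2 E3.
Proof.
move=> h12 h23; have [s1 s2 i12 [k hk]] := h12; have [_ s3 i23 [l hl]] := h23.
have h13 : commensurable E1 E3.
  by split=> //; [move=> u /i23 /i12|exists (l + k)%N => u /hk /hl; rewrite scalerA -exprD].
apply: euler_eq => //; have [m1 H1] := eulerP h12; have [m2 H2] := eulerP h23.
exists (maxn m1 m2) => m; rewrite geq_max => /andP[l1 l2] d hd.
have [d1 hd1] := commensurable_fdim (fun=> 0%N) m (tinv1 a) h12.
have [d2 hd2] := commensurable_fdim (fun=> 0%N) m (tinv1 a) h23.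
have kE E (s : submod E) : ksubspace io (fun u : 'rV_a => E u /\ degle (fun=> 0%N) m (u *m 1%:M)).
  by apply: ksubspaceI; [apply: submod_ksubspace|apply: ksubspace_dlmul].
rewrite -(H1 m l1 d1 hd1) -(H2 m l2 d2 hd2) -natrD; congr _%:R.
apply: (reldim_uniq (kE _ s3) hd); apply: (reldim_add (kE _ s3) _ _ (kE _ s2) hd1 hd2).
  by move=> u [? ?]; split; auto.
by move=> u [? ?]; split; auto.
Qed.

Lemma euler_ext E1 E2 E1' E2' : commensurable E1 E2 -> (forall u, E1 u <-> E1' u) ->
  (forall u, E2 u <-> E2' u) -> euler E1 E2 = euler E1' E2'.
Proof.
move=> hE e1 e2; have [s1 s2 i12 [k hk]] := hE.
have ext E E' (e : forall u, E u <-> E' u) : submod E -> submod E'.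
  move=> [h0 h]; split; first by apply/e.
  by move=> r u v /e hu /e homv; apply/e/h.
have hE' : commensurable E1' E2'.
  split; [exact: ext e1 s1|exact: ext e2 s2|by move=> u /e2 /i12 /e1|].
  by exists k => u /e1 /hk /e2.
apply/esym/euler_eq => //; have [m0 H0] := eulerP hE; exists m0 => m le d hd.
apply: (H0 m le); apply: reldim_ext hd => u.
  by split=> -[h1 h2]; split=> //; apply/e1.
by split=> -[h1 h2]; split=> //; apply/e2.
Qed.

Lemma commensurable_refl E : submod E -> commensurable E E.
Proof. by move=> s; split=> //; exists 0%N => u; rewrite expr0 scale1r. Qed.

Lemma euler_refl E : submod E -> euler E E = 0.
Proof.
move=> s; apply: euler_eq; first exact: commensurable_refl.
exists 0%N => m _ d hd; rewrite (reldim_uniq _ hd (reldim_refl io _)) //.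
by apply: ksubspaceI; [apply: submod_ksubspace|apply: ksubspace_dlmul].
Qed.
End Chi.

Lemma submod_rowimg a b (E : 'rV[R]_a -> Prop) (M : 'M[R]_(a, b)) : submod E -> submod (rowimg E M).
Proof.
move=> [h0 h]; split; first by exists 0; rewrite mul0mx.
move=> r u v [x [ex ->]] [y [ey ->]]; exists (r *: x + y); split; first exact: h.
by rewrite mulmxDl scalemxAl.
Qed.

Lemma commensurable_rowimg a b (E1 E2 : 'rV[R]_a -> Prop) (M : 'M[R]_(a, b)) :
  commensurable E1 E2 -> commensurable (rowimg E1 M) (rowimg E2 M).
Proof.
move=> [s1 s2 h12 [k hk]]; split; [exact: submod_rowimg|exact: submod_rowimg| |].
  by move=> u [x [ex ->]]; exists x; split; auto.
by exists k => u [x [ex ->]]; exists (F ^+ k *: x); split; [apply: hk|rewrite scalemxAl].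
Qed.

Lemma euler_rowimg a b (E1 E2 : 'rV[R]_a -> Prop) (M : 'M[R]_(a, b)) : tinv M -> commensurable E1 E2 ->
  euler (rowimg E1 M) (rowimg E2 M) = euler E1 E2.
Proof.
move=> fM hE; apply: euler_eq; first exact: commensurable_rowimg.
have [m0 H0] := eulerW (fun=> 0%N) fM hE; exists m0 => m le d hd.
have [d' hd'] := commensurable_fdim (fun=> 0%N) m fM hE; rewrite -(H0 m le d' hd'); congr _%:R.
have [s1 s2 h12 _] := hE; have s2' := submod_rowimg M s2.
apply: (reldim_uniq _ hd).
  by apply: ksubspaceI; [apply: submod_ksubspace|apply: ksubspace_dlmul].
apply: (reldim_map (phi := fun u => u *m M)) hd'.
- by move=> c u v; rewrite mulmxDl scalemxAl.
- by apply: ksubspaceI; [apply: submod_ksubspace|apply: ksubspace_dlmul].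
- by move=> u [eu du]; rewrite mulmx1; split=> //; exists u.
- by move=> u [eu du]; rewrite mulmx1; split=> //; exists u.
- move=> e c B hB [[x [ex hx]]]; rewrite mulmx1 => hd2; split=> //.
  suff -> : lincomb io c B = x by [].
  apply/eqP; rewrite -subr_eq0; apply/eqP; apply: (tinv_inj fM).
  by rewrite mulmxBl hx subrr.
- move=> v [[x [ex ->]]]; rewrite mulmx1 => hd2; exists x; split=> //.
  rewrite subrr; split; first by case: s2'.
  by rewrite mul0mx; apply: ksubspace0 (ksubspace_degle _ _ _ _).
Qed.

End EulerCharacteristic.

(** * Exterior algebra matrices *)

Section ExteriorAlgebra.

(* The exterior algebra [E'] of [R^(N+1)] is [E + e_0 E], with [E] that of the last [N]
   basis vectors; [extwt] is the exterior degree. Matrices act on rows from the right. *)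
Fixpoint extdim N := if N is N'.+1 then (extdim N' + extdim N')%N else 1%N.

Fixpoint extwt N : 'I_(extdim N) -> nat :=
  match N return 'I_(extdim N) -> nat with
  | 0 => fun=> 0%N
  | N'.+1 => fun i => match split i with inl j => extwt j | inr j => (extwt j).+1 end
  end.

Lemma extwt_leq N (i : 'I_(extdim N)) : (extwt i <= N)%N.
Proof.
elim: N i => [//|N IH] i /=; case: split => j; last by rewrite ltnS.
exact: leqW.
Qed.

Lemma extwtl N (j : 'I_(extdim N)) : @extwt N.+1 (lshift (extdim N) j) = extwt j.
Proof. by rewrite /= -/(unsplit (inl j)) unsplitK. Qed.
Lemma extwtr N (j : 'I_(extdim N)) : @extwt N.+1 (rshift (extdim N) j) = (extwt j).+1.
Proof. by rewrite /= -/(unsplit (inr j)) unsplitK. Qed.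

Variable R : comNzRingType.

Fixpoint vac N : 'rV[R]_(extdim N) :=
  match N return 'rV[R]_(extdim N) with
  | 0 => 1%:M
  | N'.+1 => row_mx (vac N') 0
  end.

(** Exterior multiplication by [v] on the left; the sign in the last block comes from moving [v]
    past e_0. [contr] is contraction with the linear form [w]. *)
Fixpoint wedge N : 'rV[R]_N -> 'M[R]_(extdim N) :=
  match N return 'rV[R]_N -> 'M[R]_(extdim N) with
  | 0 => fun=> 0
  | N'.+1 => fun v : 'rV_(1 + N') =>
      block_mx (wedge (rsubmx v)) (v 0 0)%:M 0 (- wedge (rsubmx v))
  end.

Fixpoint contr N : 'cV[R]_N -> 'M[R]_(extdim N) :=
  match N return 'cV[R]_N -> 'M[R]_(extdim N) with
  | 0 => fun=> 0
  | N'.+1 => fun w : 'cV_(1 + N') =>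
      block_mx (contr (dsubmx w)) 0 (w 0 0)%:M (- contr (dsubmx w))
  end.

(** The algebra map induced by [B]. The recursion, which sends the product of e_0 and y to the
    product of B(e_0) and the image of y, avoids minors and determinants. *)
Fixpoint ext N M : 'M[R]_(N, M) -> 'M[R]_(extdim N, extdim M) :=
  match N return 'M[R]_(N, M) -> 'M[R]_(extdim N, extdim M) with
  | 0 => fun=> vac M
  | N'.+1 => fun B : 'M_(1 + N', M) =>
      col_mx (ext (dsubmx B)) (ext (dsubmx B) *m wedge (usubmx B))
  end.

Lemma wedgeD N c (u v : 'rV[R]_N) : wedge (c *: u + v) = c *: wedge u + wedge v.
Proof.
elim: N u v => [|N IH] u v /=; first by rewrite scaler0 addr0.
rewrite scale_block_mx add_block_mx scaler0 addr0 !linearD !linearZ /= IH.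
by rewrite !mxE raddfD /= scale_scalar_mx scalerN -opprD.
Qed.

Lemma contrD N c (u v : 'cV[R]_N) : contr (c *: u + v) = c *: contr u + contr v.
Proof.
elim: N u v => [|N IH] u v /=; first by rewrite scaler0 addr0.
rewrite scale_block_mx add_block_mx scaler0 addr0 !linearD !linearZ /= IH.
by rewrite !mxE raddfD /= scale_scalar_mx scalerN -opprD.
Qed.

Lemma wedgeZ N c (u : 'rV[R]_N) : wedge (c *: u) = c *: wedge u.
Proof.
have w0 : wedge (0 : 'rV[R]_N) = 0.
  by have := wedgeD (-1) (0 : 'rV[R]_N) 0; rewrite scaleN1r oppr0 addr0 scaleN1r addNr.
by have := wedgeD c u 0; rewrite w0 !addr0.
Qed.

Lemma wedge_sq N (v : 'rV[R]_N) : wedge v *m wedge v = 0.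
Proof.
elim: N v => [|N IH] v /=; first by rewrite mulmx0.
rewrite mulmx_block !(mulmxN, mulNmx) opprK !mulmx0 !mul0mx IH ?oppr0 !(addr0, add0r).
by rewrite mul_scalar_mx mul_mx_scalar (subrr, addNr) ?block_mx0.
Qed.

Lemma wedge_anti N (u v : 'rV[R]_N) : wedge u *m wedge v = - (wedge v *m wedge u).
Proof.
apply/eqP; rewrite -addr_eq0; apply/eqP.
have := wedge_sq (1 *: u + v); rewrite wedgeD scale1r mulmxDl !mulmxDr !wedge_sq.
by rewrite add0r addr0.
Qed.

Lemma contr_sq N (v : 'cV[R]_N) : contr v *m contr v = 0.
Proof.
elim: N v => [|N IH] v /=; first by rewrite mulmx0.
rewrite mulmx_block !(mulmxN, mulNmx) opprK !mulmx0 !mul0mx IH ?oppr0 !(addr0, add0r).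
by rewrite mul_scalar_mx mul_mx_scalar (subrr, addNr) ?block_mx0.
Qed.

(** The Clifford relation. Since both operators square to zero, their sum squares to the scalar v
    w. *)
Lemma wedge_contr N (v : 'rV[R]_N) (w : 'cV[R]_N) :
  wedge v *m contr w + contr w *m wedge v = ((v *m w) 0 0)%:M.
Proof.
elim: N v w => [|N IH] v w /=.
  by rewrite !mulmx0 ?mul0mx addr0 mxE big_ord0 raddf0.
have E : (v *m w) 0 0 = v 0 0 * w 0 0 + (rsubmx (v : 'rV_(1 + N)) *m dsubmx (w : 'cV_(1 + N))) 0 0.
  by rewrite !mxE big_ord_recl; congr (_ + _); apply: eq_bigr => i _; rewrite !mxE;
    congr (v _ _ * w _ _); apply: val_inj.
rewrite !mulmx_block !mulmx0 !mul0mx !(mulNmx, mulmxN) opprK !addr0 !add0r add_block_mx E.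
rewrite !mul_scalar_mx !mul_mx_scalar !scale_scalar_mx !addNr opprK addrAC addrCA !IH.
rewrite [w 0 0 * _]mulrC [_%:M + (_ * _)%:M]addrC -!raddfD /=.
exact/esym/scalar_mx_block.
Qed.

Lemma dsubmx_row_mx0 N M (B : 'M[R]_(1 + N, M)) :
  dsubmx (row_mx (0 : 'M_(1 + N, 1)) B) = row_mx 0 (dsubmx B).
Proof. by apply/matrixP => i j; rewrite !mxE; case: split => k; rewrite !mxE. Qed.
Lemma usubmx_row_mx0 N M (B : 'M[R]_(1 + N, M)) :
  usubmx (row_mx (0 : 'M_(1 + N, 1)) B) = row_mx 0 (usubmx B).
Proof. by apply/matrixP => i j; rewrite !mxE; case: split => k; rewrite !mxE. Qed.

Lemma ext_row0 N M (B : 'M[R]_(N, M)) : @ext N M.+1 (row_mx (0 : 'M_(N, 1)) B) = row_mx (ext B) 0.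
Proof.
elim: N B => [|N IH] B //=; change 'M[R]_(1 + N, M) in B.
rewrite dsubmx_row_mx0 usubmx_row_mx0 IH row_mxKr mxE.
case: splitP => [k _|k]; last by rewrite /=.
rewrite mxE raddf0 mul_row_block mulmx0 mul0mx !addr0 mulmx0.
by rewrite [RHS](_ : _ = block_mx (ext (dsubmx B)) 0 (ext (dsubmx B) *m wedge (usubmx B)) 0) //
  block_mxEh -col_mx0.
Qed.

Lemma ext_block N M c (B : 'M[R]_(N, M)) :
  @ext N.+1 M.+1 (block_mx (c%:M : 'M_1) 0 0 B) = block_mx (ext B) 0 0 (c *: ext B).
Proof.
rewrite /= /block_mx col_mxKd col_mxKu ext_row0 row_mxKr mxE.
case: splitP => [k _|k]; last by rewrite /=.
rewrite ord1 mxE eqxx.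
have -> : wedge (0 : 'rV[R]_M) = 0 by rewrite -(scale0r 0) wedgeZ scale0r.
by rewrite mul_row_block !mulmx0 mul0mx mul_mx_scalar !addr0.
Qed.

Lemma ext_block1 N M (B : 'M[R]_(N, M)) :
  @ext N.+1 M.+1 (block_mx (1%:M : 'M_1) 0 0 B) = block_mx (ext B) 0 0 (ext B).
Proof. by rewrite ext_block scale1r. Qed.

Lemma ext_scalar N c : ext (c%:M : 'M[R]_N) = \matrix_(i, j) (c ^+ extwt i *+ (i == j)).
Proof.
elim: N => [|N IH].
  by apply/matrixP => i j; rewrite mxE /= mxE expr0 !ord1.
rewrite [c%:M in LHS](_ : _ = block_mx (c%:M : 'M_1) 0 0 c%:M); last exact: scalar_mx_block.
rewrite ext_block IH; apply/matrixP => i j.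
case: (split_ordP i) => i' ->; case: (split_ordP j) => j' ->;
  rewrite ?block_mxEul ?block_mxEur ?block_mxEdl ?block_mxEdr !mxE ?extwtl ?extwtr
    ?eq_lshift ?eq_rshift ?eq_lrshift ?eq_rlshift //.
by rewrite mulrnAr -exprS.
Qed.

Lemma ext1 N : ext (1%:M : 'M[R]_N) = 1%:M.
Proof.
elim: N => [//|N IH].
by rewrite [1%:M in LHS](_ : _ = block_mx (1%:M : 'M_1) 0 0 1%:M) ?ext_block1 ?IH -?scalar_mx_block.
Qed.

Lemma vac_contr M (w : 'cV[R]_M) : vac M *m contr w = 0.
Proof.
elim: M w => [|M IH] w /=; first by rewrite mulmx0.
by rewrite mul_row_block IH !mulmx0 !mul0mx !addr0 row_mx0.
Qed.

Lemma mul_usub N M (v : 'rV[R]_(1 + N)) (B : 'M[R]_(1 + N, M)) :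
  v *m B = v 0 0 *: usubmx B + rsubmx v *m dsubmx B.
Proof.
rewrite -{1}[v]hsubmxK -{1}[B]vsubmxK mul_row_col [lsubmx v]mx11_scalar mul_scalar_mx.
by congr (_ *: _ + _); rewrite mxE; congr (v _ _); apply: val_inj.
Qed.

Lemma ext_wedge N M (v : 'rV[R]_N) (B : 'M[R]_(N, M)) :
  wedge v *m ext B = ext B *m wedge (v *m B).
Proof.
elim: N v B => [|N IH] v B /=; last change 'M[R]_(1 + N, M) in B.
  by rewrite mul0mx [B]flatmx0 mulmx0 (_ : wedge 0 = 0) ?mulmx0 // -(scale0r 0) wedgeZ scale0r.
rewrite mul_usub wedgeD mul_block_col mul_col_mx mul_scalar_mx mul0mx add0r mulmxA IH.
congr col_mx; first by rewrite mulmxDr -scalemxAr addrC.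
rewrite !mulNmx IH -!mulmxA mulmxDr -scalemxAr wedge_sq scaler0 add0r.
by rewrite [wedge (usubmx B) *m _]wedge_anti mulmxN.
Qed.

(** Contraction passes through an algebra map once the linear form is pulled back; on the e_0 half
    this is the Clifford relation. *)
Lemma ext_contr N M (w : 'cV[R]_M) (B : 'M[R]_(N, M)) :
  ext B *m contr w = contr (B *m w) *m ext B.
Proof.
elim: N B => [|N IH] B /=; first by rewrite mul0mx vac_contr.
change 'M[R]_(1 + N, M) in B.
have -> : dsubmx (B *m w : 'cV_(1 + N)) = dsubmx B *m w.
  by rewrite -{1}[B]vsubmxK mul_col_mx col_mxKd.
have -> : (B *m w) 0 0 = ((usubmx B : 'rV_M) *m w) 0 0.
  by rewrite !mxE; apply: eq_bigr => i _; rewrite !mxE; congr (B _ _ * _); apply: val_inj.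
rewrite mul_col_mx mul_block_col mul0mx addr0 IH mul_scalar_mx; congr col_mx.
rewrite mulNmx mulmxA -IH -!mulmxA -mulmxN -mul_mx_scalar -mulmxDr; congr (_ *m _).
by rewrite -wedge_contr addrK.
Qed.

Lemma extM N M P (B : 'M[R]_(N, M)) (C : 'M[R]_(M, P)) : ext B *m ext C = ext (B *m C).
Proof.
elim: N B => [|N IH] B /=.
  clear B; elim: M C => [|M IHM] C /=; first by rewrite mul1mx.
  by rewrite mul_row_col mul0mx addr0 IHM.
change 'M[R]_(1 + N, M) in B.
have [-> ->] : dsubmx (B *m C) = dsubmx B *m C /\ usubmx (B *m C) = usubmx B *m C.
  by rewrite -{1 3}[B]vsubmxK mul_col_mx col_mxKd col_mxKu.
by rewrite mul_col_mx IH -mulmxA ext_wedge mulmxA IH.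
Qed.

Definition wpres N M (A : 'M[R]_(extdim N, extdim M)) := forall i j, extwt i != extwt j -> A i j = 0.

Lemma wedge_entry N (v : 'rV[R]_N) i j :
  wedge v i j = 0 \/ (extwt j = (extwt i).+1 /\ exists s l, wedge v i j = (-1) ^+ s * v 0 l).
Proof.
elim: N v i j => [|N IH] v i j; first by left; rewrite mxE.
rewrite [wedge v]/=; change 'rV[R]_(1 + N) in v.
case: (split_ordP i) => i' ->; case: (split_ordP j) => j' ->;
  rewrite ?extwtl ?extwtr ?block_mxEul ?block_mxEur ?block_mxEdl ?block_mxEdr.
- have [->|[-> [s [l ->]]]] := IH (rsubmx v) i' j'; [by left|right; split=> //].
  by exists s, (rshift 1 l); rewrite mxE.
- rewrite mxE; have [->|_] := eqVneq i' j'; last by left.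
  by right; split=> //; exists 0%N, 0; rewrite expr0 mul1r.
- by left; rewrite mxE.
- rewrite mxE; have [->|[-> [s [l ->]]]] := IH (rsubmx v) i' j'; [by left; rewrite oppr0|right; split=> //].
  by exists s.+1, (rshift 1 l); rewrite mxE exprS mulN1r mulNr.
Qed.

Lemma contr_entry N (w : 'cV[R]_N) i j :
  contr w i j = 0 \/ (extwt i = (extwt j).+1 /\ exists s l, contr w i j = (-1) ^+ s * w l 0).
Proof.
elim: N w i j => [|N IH] w i j; first by left; rewrite mxE.
rewrite [contr w]/=; change 'cV[R]_(1 + N) in w.
case: (split_ordP i) => i' ->; case: (split_ordP j) => j' ->;
  rewrite ?extwtl ?extwtr ?block_mxEul ?block_mxEur ?block_mxEdl ?block_mxEdr.
- have [->|[-> [s [l ->]]]] := IH (dsubmx w) i' j'; [by left|right; split=> //].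
  by exists s, (rshift 1 l); rewrite mxE.
- by left; rewrite mxE.
- rewrite mxE; have [->|_] := eqVneq i' j'; last by left.
  by right; split=> //; exists 0%N, 0; rewrite expr0 mul1r.
- rewrite mxE; have [->|[-> [s [l ->]]]] := IH (dsubmx w) i' j'; [by left; rewrite oppr0|right; split=> //].
  by exists s.+1, (rshift 1 l); rewrite mxE exprS mulN1r mulNr.
Qed.

Lemma vac_entry M i j : extwt j != 0%N -> vac M i j = 0.
Proof.
elim: M j => [//|M IH] j.
case: (split_ordP j) => j' ->; rewrite ?extwtl ?extwtr => h; last by rewrite /= row_mxEr mxE.
by rewrite /= row_mxEl IH.
Qed.

Lemma ext_wpres N M (B : 'M[R]_(N, M)) : wpres (ext B).
Proof.
elim: N B => [|N IH] B i j; first by move=> h; apply: vac_entry; rewrite eq_sym.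
rewrite [ext B]/=.
change 'M[R]_(1 + N, M) in B.
case: (split_ordP i) => i' -> h; rewrite ?col_mxEu ?col_mxEd.
  by apply: IH; move: h; rewrite extwtl.
rewrite mxE big1 // => k _; have [e|ne] := eqVneq (extwt i') (extwt k); last by rewrite IH ?mul0r.
have [->|[e2 _]] := wedge_entry (usubmx B) k j; first by rewrite mulr0.
by move: h; rewrite extwtr e -e2 eqxx.
Qed.

End ExteriorAlgebra.

(** * Invariants of the exterior powers of a matrix *)

Section Delta.
Variables (K : fieldType) (T : K) (p : nat).
Hypotheses (p_pr : prime p) (p_odd : odd p).
Hypothesis T_pow : forall d (t : K), t ^+ p = T ^+ d -> (p %| d)%N.
Variable n : nat.
Local Notation R := (ipoly K n.+1).
Local Notation io := (ipolyC K n.+1).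
Local Notation F := (towerF T p n).
Local Notation q := (p ^ n)%N.
Local Notation euler := (euler p).
Local Notation commensurable := (commensurable T p).
Local Notation tinv := (tinv T p).

Section Mask.
Variables (a : nat) (c : 'I_a -> bool).
Definition cutoff (u : 'rV[R]_a) : 'rV[R]_a := \row_j (if c j then u 0 j else 0).

Lemma maskD (r : R) u v : cutoff (r *: u + v) = r *: cutoff u + cutoff v.
Proof. by apply/rowP => j; rewrite !mxE; case: ifP => //; rewrite mulr0 addr0. Qed.
Lemma maskK u : cutoff (cutoff u) = cutoff u.
Proof. by apply/rowP => j; rewrite !mxE; case: (c j). Qed.
Lemma mask0 : cutoff 0 = 0.
Proof. by apply/rowP => j; rewrite !mxE; case: (c j). Qed.
Lemma maskB u v : cutoff (u - v) = cutoff u - cutoff v.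
Proof. by rewrite -scaleN1r addrC maskD scaleN1r addrC. Qed.
Lemma maskC u : cutoff (u - cutoff u) = 0.
Proof. by rewrite maskB maskK subrr. Qed.
Lemma degle_cutoff w m u : degle w m u -> degle w m (cutoff u).
Proof. by move=> h j; rewrite mxE; case: ifP => // _; rewrite rmorph0 mulr0 size_poly0. Qed.

Lemma euler_cutoff (E1 E2 : 'rV[R]_a -> Prop) : commensurable E1 E2 ->
  (forall u, E1 u -> E1 (cutoff u)) -> (forall u, E2 u -> E2 (cutoff u)) ->
  euler E1 E2 = euler (fun u => E1 u /\ cutoff u = u) (fun u => E2 u /\ cutoff u = u) +
               euler (fun u => E1 u /\ cutoff u = 0) (fun u => E2 u /\ cutoff u = 0).
Proof.
move=> hE st1 st2; have [s1 s2 h12 [k hk]] := hE.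
(* [cutoff] identifies E1 / M with the quotient of the parts it fixes, and its complement identifies
   M / E2 with the quotient of the parts it kills. *)
pose M u := E1 u /\ E2 (cutoff u).
have sI E : submod E -> submod (fun u => E u /\ cutoff u = u).
  move=> [h0 h]; split; first by split=> //; apply: mask0.
  by move=> r u v [eu mu] [ev mv]; split; [apply: h|rewrite maskD mu mv].
have sC E : submod E -> submod (fun u => E u /\ cutoff u = 0).
  move=> [h0 h]; split; first by split=> //; apply: mask0.
  by move=> r u v [eu mu] [ev mv]; split; [apply: h|rewrite maskD mu mv scaler0 addr0].
have mZ (r : R) u : cutoff (r *: u) = r *: cutoff u by rewrite -[r *: u]addr0 maskD mask0 addr0.
have sM : submod M.
  split; first by rewrite /M mask0; split; [case: s1|case: s2].
  by move=> r u v [eu mu] [ev mv]; split; [apply: (proj2 s1)|rewrite maskD; apply: (proj2 s2)].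
have h1M : commensurable E1 M.
  split=> // [u []//|]; exists k => u eu; split; first exact: submodZ.
  by rewrite mZ; apply/hk/st1.
have hM2 : commensurable M E2.
  by split=> // [u eu|]; [split; auto|exists k => u [eu _]; apply: hk].
have hI : commensurable (fun u => E1 u /\ cutoff u = u) (fun u => E2 u /\ cutoff u = u).
  split; [exact: sI|exact: sI|by move=> u [? ?]; split; auto|].
  by exists k => u [eu mu]; split; [apply: hk|rewrite mZ mu].
have hC : commensurable (fun u => E1 u /\ cutoff u = 0) (fun u => E2 u /\ cutoff u = 0).
  split; [exact: sC|exact: sC|by move=> u [? ?]; split; auto|].
  by exists k => u [eu mu]; split; [apply: hk|rewrite mZ mu scaler0].
have kE E m (s : submod E) : ksubspace io (fun u : 'rV_a => E u /\ degle (fun=> 0%N) m (u *m 1%:M)).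
  by apply: ksubspaceI; [apply: submod_ksubspace|apply: ksubspace_dlmul].
rewrite (euler_add p_pr p_odd T_pow h1M hM2); congr (_ + _).
  apply/esym/(euler_eq p_pr p_odd T_pow hI).
  have [m0 H0] := eulerP p_pr p_odd T_pow h1M; exists m0 => m le d hd.
  have [d' hd'] := commensurable_fdim p_pr (fun=> 0%N) m (tinv1 T p n a) h1M; rewrite -(H0 m le d' hd').
  congr _%:R; apply: (reldim_uniq (kE _ m (sI _ s2)) hd).
  apply: (reldim_map (phi := cutoff)) hd'; rewrite ?mulmx1.
  - by move=> x u v; rewrite maskD.
  - exact: kE (sI _ s2).
  - move=> u; rewrite !mulmx1 => -[eu du]; split; last exact: degle_cutoff.
    by split; [apply: st1|apply: maskK].
  - move=> u; rewrite !mulmx1 => -[[eu eu'] du]; split; last exact: degle_cutoff.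
    by split; [|apply: maskK].
  - move=> e x b hb [[h1 h2]]; rewrite !mulmx1 => h3.
    have [e1 d1] := ksubspace_lincomb x (kE E1 m s1) hb; rewrite mulmx1 in d1.
    by split=> //; split.
  - move=> v [[ev mv] dv]; exists v; split=> //.
    by rewrite mv subrr; apply: ksubspace0 (kE _ m (sI _ s2)).
apply/esym/(euler_eq p_pr p_odd T_pow hC).
have [m0 H0] := eulerP p_pr p_odd T_pow hM2; exists m0 => m le d hd.
have [d' hd'] := commensurable_fdim p_pr (fun=> 0%N) m (tinv1 T p n a) hM2; rewrite -(H0 m le d' hd').
congr _%:R; apply: (reldim_uniq (kE _ m (sC _ s2)) hd).
have kdl : ksubspace io (@degle K n.+1 a (fun=> 0%N) m) by exact: ksubspace_degle.
apply: (reldim_map (phi := fun u => u - cutoff u)) hd'.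
- by move=> x u v; rewrite maskD opprD addrACA scalerBr.
- exact: kE (sC _ s2).
- move=> u; rewrite !mulmx1 => -[[eu eu'] du]; split; last by apply: ksubspaceB kdl _ _ => //; apply: degle_cutoff.
  by split; [apply: submodB => //; apply: st1|apply: maskC].
- move=> u; rewrite !mulmx1 => -[eu du]; split; last by apply: ksubspaceB kdl _ _ => //; apply: degle_cutoff.
  by split; [apply: submodB => //; apply: st2|apply: maskC].
- move=> e x b hb [[h1 h2] h3].
  have [[e1 e2] d1] := ksubspace_lincomb x (kE M m sM) hb.
  by split=> //; have := submodD s2 h1 e2; rewrite subrK.
- move=> v [[ev mv] dv]; exists v; split.
    by split=> //; split=> //; rewrite mv; case: s2.
  by rewrite mv subr0 subrr; apply: ksubspace0 (kE _ m (sC _ s2)).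
Qed.
End Mask.

Definition wsupp (A : pred nat) N (u : 'rV[R]_(extdim N)) := forall j, ~~ A (extwt j) -> u 0 j = 0.

Lemma submod_wsupp A N : submod (@wsupp A N).
Proof.
split=> [j _|r u v hu homv j h]; first by rewrite mxE.
by rewrite !mxE hu ?homv // mulr0 addr0.
Qed.

Lemma wsupp_mul A N M (C : 'M[R]_(extdim N, extdim M)) u : wpres C -> wsupp A u -> wsupp A (u *m C).
Proof.
move=> hC hu j hj; rewrite mxE big1 // => i _.
have [e|ne] := eqVneq (extwt i) (extwt j); last by rewrite hC ?mulr0.
by rewrite hu ?mul0r // e.
Qed.

Lemma tinv_comm a (B C : 'M[R]_a) k : B *m C = (F ^+ k)%:M -> C *m B = (F ^+ k)%:M.
Proof.
move=> h; have d0 : \det B != 0.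
  have : \det B * \det C != 0 by rewrite -det_mulmx h det_scalar expf_neq0 // FX_neq0.
  by rewrite mulf_eq0 negb_or => /andP[].
apply/eqP; rewrite -subr_eq0; have : B *m (C *m B - (F ^+ k)%:M) = 0.
  by rewrite mulmxBr mulmxA h mul_mx_scalar mul_scalar_mx subrr.
move/(congr1 (mulmx (\adj B))); rewrite mulmxA mul_adj_mx mulmx0 mul_scalar_mx.
by move/eqP; rewrite scalemx_eq0 (negbTE d0).
Qed.

Section Square.
Variable N : nat.
Implicit Type B : 'M[R]_N.

Lemma ext_cancel B C k : C *m B = (F ^+ k)%:M -> forall A u, wsupp A u ->
  exists v, wsupp A v /\ F ^+ (k * N) *: u = v *m ext B.
Proof.
(* On weight i the exterior power of C B is F^(k i); inserting the complementary F^(k (N - i)) first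
   lets a single power of F serve all weights. *)
move=> h A u hu; pose w : 'rV[R]_(extdim N) := \row_j (u 0 j * F ^+ (k * (N - extwt j))).
exists (w *m ext C); split.
  apply: wsupp_mul; first exact: ext_wpres.
  by move=> j hj; rewrite mxE hu // mul0r.
rewrite -mulmxA extM h ext_scalar; apply/rowP => j; rewrite !mxE (bigD1 j) //= !mxE eqxx.
rewrite big1 ?addr0; last by move=> i ne; rewrite !mxE (negbTE ne) mulr0.
by rewrite mulrC -mulrA -exprM -exprD -mulnDr subnK // extwt_leq.
Qed.

Lemma tinv_ext B : tinv B -> tinv (ext B).
Proof.
move=> [k [C h]].
have [D hD] : exists D, ext C *m ext B *m D = (F ^+ (k * N))%:M.
  exists (\matrix_(i, j) (F ^+ (k * (N - extwt i)) *+ (i == j))).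
  rewrite extM (tinv_comm h) ext_scalar; apply/matrixP => i j; rewrite !mxE (bigD1 i) //= !mxE eqxx.
  rewrite big1 ?addr0; last by move=> l ne; rewrite !mxE eq_sym (negbTE ne) mul0r.
  by rewrite mulrnAr -exprM -exprD -mulnDr subnKC // extwt_leq.
by exists (k * N)%N, (D *m ext C); rewrite mulmxA; apply: tinv_comm; rewrite mulmxA.
Qed.

(** The class of the cokernel of the exterior powers with weight in [A]. Whole sets of weights are
    allowed because the final argument treats a parity class at once. *)
Definition delta A B := euler (@wsupp A N) (rowimg (@wsupp A N) (ext B)).

Lemma commensurable_delta A B : tinv B -> commensurable (@wsupp A N) (rowimg (@wsupp A N) (ext B)).
Proof.
move=> [k [C h]]; have s := submod_wsupp A N; split=> //; first exact: submod_rowimg.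
  by move=> u [v [homv ->]]; apply: wsupp_mul => //; apply: ext_wpres.
exists (k * N)%N => u hu; have [v [homv ->]] := ext_cancel (tinv_comm h) hu.
by exists v.
Qed.

(** The image of B C lies in that of [C], and the quotient of the two is the cokernel for [B]
    transported by [ext C]. *)
Lemma deltaM A B C : tinv B -> tinv C -> delta A (B *m C) = delta A B + delta A C.
Proof.
move=> fB fC; have aB := commensurable_delta A fB; have aC := commensurable_delta A fC.
rewrite addrC -[delta A B](euler_rowimg p_pr p_odd T_pow (tinv_ext fC) aB).
rewrite -(euler_add p_pr p_odd T_pow aC (commensurable_rowimg _ aB)).
apply: (euler_ext p_pr p_odd T_pow) => //.
  exact: commensurable_delta (tinvM fB fC).
move=> u; split=> [[v [homv ->]]|[_ [[v [homv ->]] ->]]].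
  by exists (v *m ext B); split; [exists v|rewrite -mulmxA extM].
by exists v; split=> //; rewrite -mulmxA extM.
Qed.

Lemma delta_unit A B C : C *m B = 1%:M -> delta A B = 0.
Proof.
move=> h; have s := submod_wsupp A N; rewrite -(euler_refl p_pr p_odd T_pow s).
apply: (euler_ext p_pr p_odd T_pow) => //.
  apply: commensurable_delta; apply: (@tinv_unit _ _ _ _ _ _ _ C); apply/eqP.
  by rewrite -(expr0 F); apply/eqP/tinv_comm; rewrite expr0.
move=> u; split=> [[v [homv ->]]|hu]; first by apply: wsupp_mul => //; apply: ext_wpres.
exists (u *m ext C); split; first by apply: wsupp_mul => //; apply: ext_wpres.
by rewrite -mulmxA extM h ext1 mulmx1.
Qed.

Lemma deltaU (A A' : pred nat) B : tinv B -> (forall i, A i -> A' i -> false) ->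
  delta (predU A A') B = delta A B + delta A' B.
Proof.
move=> fB hd; pose c (j : 'I_(extdim N)) := A (extwt j).
have cext u : cutoff c (u *m ext B) = cutoff c u *m ext B.
  apply/rowP => j; rewrite !mxE; case: ifP => hc.
    apply: eq_bigr => i _; rewrite mxE; case: ifP => // hi.
    by rewrite (ext_wpres B) ?mulr0 //; apply: contraFneq hi; rewrite /c => ->.
  rewrite big1 // => i _; rewrite mxE; case: ifP => hi; last by rewrite mul0r.
  by rewrite (ext_wpres B) ?mulr0 //; apply: contraFneq hc; rewrite /c => <-.
have st D u : wsupp D u -> wsupp D (cutoff c u).
  by move=> h j hj; rewrite mxE h // if_same.
have msk u : cutoff c u = u <-> wsupp A u.
  split=> [/rowP h j hj|h]; first by have := h j; rewrite mxE /c (negbTE hj).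
  by apply/rowP => j; rewrite mxE; case: ifP => // /negbT hj; rewrite h.
have msk0 u : cutoff c u = 0 <-> forall j, A (extwt j) -> u 0 j = 0.
  split=> [/rowP h j hj|h]; first by have := h j; rewrite !mxE /c hj.
  by apply/rowP => j; rewrite !mxE; case: ifP => // hj; rewrite h.
have sA u : wsupp (predU A A') u /\ cutoff c u = u <-> wsupp A u.
  split=> [[_ /msk]//|h]; split; last by apply/msk.
  by move=> j; rewrite negb_or => /andP[hj _]; apply: h.
have sA' u : wsupp (predU A A') u /\ cutoff c u = 0 <-> wsupp A' u.
  split=> [[h /msk0 h0] j hj|h]; last split.
  - by case hA : (A (extwt j)); [apply: h0|apply: h; rewrite inE /= hA].
  - by move=> j; rewrite negb_or => /andP[_ hj]; apply: h.
  - by apply/msk0 => j hj; apply: h; apply/negP => /(hd _ hj).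
have aU := commensurable_delta (predU A A') fB.
rewrite [LHS](euler_cutoff (c := c) aU); first congr (_ + _).
- apply/esym/(euler_ext p_pr p_odd T_pow); first exact: commensurable_delta.
    by move=> u; split=> /sA.
  move=> u; split=> [[v [homv ->]]|[[v [homv ->]] hm]].
    have [h1 h2] := proj2 (sA v) homv.
    by split; [exists v|rewrite cext h2].
  exists (cutoff c v); split; last by rewrite -cext.
  by apply/sA; split; [apply: st|apply: maskK].
- apply/esym/(euler_ext p_pr p_odd T_pow); first exact: commensurable_delta.
    by move=> u; split=> /sA'.
  move=> u; split=> [[v [homv ->]]|[[v [homv ->]] hm]].
    have [h1 h2] := proj2 (sA' v) homv.
    by split; [exists v|rewrite cext h2 mul0mx].
  exists (v - cutoff c v); split; last by rewrite mulmxBl -cext hm subr0.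
  apply/sA'; split; last exact: maskC.
  by apply: submodB (submod_wsupp _ _) _ _ => //; apply: st.
- by move=> u; apply: st.
- by move=> u [v [homv ->]]; exists (cutoff c v); rewrite cext; split=> //; apply: st.
Qed.

Lemma eq_delta (A A' : pred nat) B : tinv B -> (forall i, (i <= N)%N -> A i = A' i) -> delta A B = delta A' B.
Proof.
move=> fB h; have E u : wsupp A u <-> @wsupp A' N u.
  by split=> hu j hj; apply: hu; rewrite ?h // -?h // extwt_leq.
apply: (euler_ext p_pr p_odd T_pow) => //; first exact: commensurable_delta.
by move=> u; split=> -[v [/E homv ->]]; exists v.
Qed.

Lemma delta_sum (A : pred nat) B : tinv B -> delta A B = \sum_(i < N.+1 | A i) delta (pred1 (i : nat)) B.
Proof.
move=> fB; have H m : delta (fun i => A i && (i < m)%N) B = \sum_(i < m | A i) delta (pred1 (i : nat)) B.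
  elim: m => [|m IH].
    rewrite big_ord0; have s := submod_wsupp (fun i => A i && (i < 0)%N) N.
    rewrite -(euler_refl p_pr p_odd T_pow s); apply: (euler_ext p_pr p_odd T_pow) => //.
      exact: commensurable_delta.
    have s0 (u : 'rV_(extdim N)) : wsupp (fun i => A i && (i < 0)%N) u -> u = 0.
      by move=> hu; apply/rowP => j; rewrite mxE hu // ltn0 andbF.
    move=> u; split=> [[v [/s0 -> ->]]|/s0 ->]; first by rewrite mul0mx; case: s.
    by exists 0; rewrite mul0mx; split=> //; case: s.
  rewrite big_mkcond big_ord_recr -big_mkcond -IH /=.
  case: ifP => hm.
    rewrite -deltaU //; last by move=> i /andP[_ h] /eqP e; rewrite e ltnn in h.
    apply: eq_delta => // i _; rewrite /= ltnS leq_eqVlt.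
    by case: eqP => [->|]; rewrite ?hm ?orbT ?orbF //= ltnn andbF.
  rewrite addr0; apply: eq_delta => // i _; rewrite ltnS leq_eqVlt.
  by case: eqP => [->|]; rewrite ?hm ?ltnn.
by rewrite -H; apply: eq_delta => // i le; rewrite ltnS le andbT.
Qed.
End Square.
End Delta.

(** * Additivity and stability of the polynomial invariant *)

Section StableInvariant.
Variables (K : fieldType) (T : K) (p : nat).
Hypotheses (p_pr : prime p) (p_odd : odd p).
Hypothesis T_pow : forall d (t : K), t ^+ p = T ^+ d -> (p %| d)%N.
Variable n : nat.
Local Notation R := (ipoly K n.+1).
Local Notation io := (ipolyC K n.+1).
Local Notation F := (towerF T p n).
Local Notation q := (p ^ n)%N.
Local Notation euler := (euler p).
Local Notation commensurable := (commensurable T p).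
Local Notation tinv := (tinv T p).
Local Notation delta := (delta p).

(* The powers of [X] and [1 - X] make it insensitive to [B |-> diag(1, B)], see
   [euler_poly_block1]. *)
Definition euler_poly N (B : 'M[R]_N) : {poly 'F_p} :=
  \sum_(i < N.+1) (delta (pred1 (i : nat)) B)%:P * ((1 - 'X) ^+ i * 'X^(N - i)).

Lemma euler_polyM N (B C : 'M[R]_N) : tinv B -> tinv C -> euler_poly (B *m C) = euler_poly B + euler_poly C.
Proof.
move=> fB fC; rewrite -big_split /=; apply: eq_bigr => i _.
by rewrite (deltaM p_pr p_odd T_pow) // polyCD mulrDl.
Qed.

Lemma euler_poly_unit N (B C : 'M[R]_N) : C *m B = 1%:M -> euler_poly B = 0.
Proof.
by move=> h; apply: big1 => i _; rewrite (delta_unit p_pr p_odd T_pow _ h) polyC0 mul0r.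
Qed.

Lemma tinv_block1 b a (D : 'M[R]_a) : tinv D -> tinv (block_mx (1%:M : 'M_b) 0 0 D).
Proof.
move=> [k [C hC]]; exists k, (block_mx (F ^+ k)%:M 0 0 C).
by rewrite mulmx_block !mulmx0 !mul0mx mul1mx hC !(addr0, add0r) -scalar_mx_block.
Qed.

(** The exterior algebra splits into the part without e_0 and the part with it, and the matrix acts
    as [ext B] on both; the second part has its weights raised by one. *)
Lemma delta_block1 (A : pred nat) N (B : 'M[R]_N) : tinv B ->
  delta A (block_mx (1%:M : 'M_1) 0 0 B : 'M_N.+1) = delta A B + delta (fun i => A i.+1) B.
Proof.
move=> fB.
have fB1 : tinv (block_mx (1%:M : 'M_1) 0 0 B : 'M_N.+1) by exact: (@tinv_block1 1 N).
pose c (j : 'I_(extdim N + extdim N)) := (j < extdim N)%N.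
have mE (u : 'rV[R]_(extdim N + extdim N)) : cutoff c u = row_mx (lsubmx u) 0.
  apply/rowP => j; rewrite [LHS]mxE /c; case: (split_ordP j) => j' ->.
    by rewrite ?ltn_ord row_mxEl mxE ?ltn_ord.
  by rewrite row_mxEr mxE ?ltnNge ?leq_addr.
have sE (u : 'rV[R]_(extdim N + extdim N)) : @wsupp K n A N.+1 u <->
    wsupp A (lsubmx u) /\ wsupp (fun i => A i.+1) (rsubmx u).
  split=> [h|[h1 h2] j].
    by split=> j hj; rewrite mxE h ?extwtl ?extwtr.
  case: (split_ordP j) => j' ->; rewrite ?extwtl ?extwtr => hj.
    by have := h1 j' hj; rewrite mxE.
  by have := h2 j' hj; rewrite mxE.
have eE (v : 'rV[R]_(extdim N + extdim N)) : v *m (ext (block_mx (1%:M : 'M_1) 0 0 B : 'M_N.+1)) =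
    row_mx (lsubmx v *m ext B) (rsubmx v *m ext B).
  by rewrite ext_block1 -{1}[v]hsubmxK mul_row_block !mulmx0 addr0 add0r.
have aU := commensurable_delta p_pr A fB1.
have aB A' : commensurable (@wsupp K n A' N) (rowimg (@wsupp K n A' N) (ext B)) := commensurable_delta p_pr A' fB.
have s0 A' : wsupp A' (0 : 'rV[R]_(extdim N)) by case: (submod_wsupp K n A' N).
rewrite [LHS](euler_cutoff p_pr p_odd T_pow (c := c) aU); first congr (_ + _).
- pose M : 'M[R]_(extdim N, extdim N + extdim N) := row_mx 1%:M 0.
  have fM : tinv M by apply: (@tinv_unit _ _ _ _ _ _ _ (col_mx 1%:M 0)); rewrite mul_row_col mul1mx mul0mx addr0.
  have vM (v : 'rV_(extdim N)) : v *m M = row_mx v 0 by rewrite mul_mx_row mulmx1 mulmx0.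
  rewrite -[RHS](euler_rowimg p_pr p_odd T_pow fM (aB A)).
  apply/esym/(euler_ext p_pr p_odd T_pow) => [|u|u]; first by apply: commensurable_rowimg; apply: aB.
    split=> [[v [homv ->]]|[/sE [h1 h2] hm]].
      rewrite vM; split; first by apply/sE; rewrite row_mxKl row_mxKr.
      by rewrite mE row_mxKl.
    by exists (lsubmx u); split=> //; rewrite vM -mE.
  split=> [[_ [[v [homv ->]] ->]]|[[v [/sE [h1 h2] ->]] hm]].
    rewrite vM; split; last by rewrite mE row_mxKl.
    exists (row_mx v 0); split; first by apply/sE; rewrite row_mxKl row_mxKr.
    by rewrite eE row_mxKl row_mxKr mul0mx.
  exists (lsubmx v *m ext B); split; first by exists (lsubmx v).
  by rewrite vM -hm mE eE row_mxKl.
- pose M : 'M[R]_(extdim N, extdim N + extdim N) := row_mx 0 1%:M.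
  have fM : tinv M by apply: (@tinv_unit _ _ _ _ _ _ _ (col_mx 0 1%:M)); rewrite mul_row_col mul1mx mul0mx add0r.
  have vM (v : 'rV_(extdim N)) : v *m M = row_mx 0 v by rewrite mul_mx_row mulmx1 mulmx0.
  have m0 (u : 'rV[R]_(extdim N + extdim N)) : cutoff c u = 0 -> u = row_mx 0 (rsubmx u).
    by rewrite mE => h; rewrite -{1}[u]hsubmxK; congr row_mx;
      have := congr1 (@lsubmx _ _ _ _) h; rewrite row_mxKl linear0.
  rewrite -[RHS](euler_rowimg p_pr p_odd T_pow fM (aB (fun i => A i.+1))).
  apply/esym/(euler_ext p_pr p_odd T_pow) => [|u|u]; first by apply: commensurable_rowimg; apply: aB.
    split=> [[v [homv ->]]|[/sE [h1 h2] hm]].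
      rewrite vM; split; first by apply/sE; rewrite row_mxKl row_mxKr.
      by rewrite mE row_mxKl row_mx0.
    by exists (rsubmx u); split=> //; rewrite vM -m0.
  split=> [[_ [[v [homv ->]] ->]]|[[v [/sE [h1 h2] ->]] hm]].
    rewrite vM; split; last by rewrite mE row_mxKl row_mx0.
    exists (row_mx 0 v); split; first by apply/sE; rewrite row_mxKl row_mxKr.
    by rewrite eE row_mxKl row_mxKr mul0mx.
  exists (rsubmx v *m ext B); split; first by exists (rsubmx v).
  by rewrite vM (m0 _ hm) eE row_mxKr.
- move=> u /sE [h1 h2]; apply/sE; rewrite mE row_mxKl row_mxKr; split=> //.
- move=> u [v [/sE [h1 h2] ->]]; exists (row_mx (lsubmx v) 0); split.
    by apply/sE; rewrite row_mxKl row_mxKr.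
  by rewrite mE !eE !row_mxKl row_mxKr mul0mx.
Qed.

Lemma delta_none (A : pred nat) N (B : 'M[R]_N) : tinv B ->
  (forall i, (i <= N)%N -> A i = false) -> delta A B = 0.
Proof.
move=> fB h; rewrite (delta_sum p_pr p_odd T_pow _ fB) big1 // => i hi.
by rewrite h ?leq_ord // in hi.
Qed.

Lemma euler_poly_block1 N (B : 'M[R]_N) : tinv B ->
  euler_poly (block_mx (1%:M : 'M_1) 0 0 B : 'M_N.+1) = euler_poly B.
Proof.
move=> fB; rewrite /euler_poly.
under eq_bigr => i _ do rewrite (delta_block1 _ fB) polyCD mulrDl.
rewrite big_split /= big_ord_recr /= delta_none //; last first.
  by move=> i le; apply/eqP => e; rewrite e ltnn in le.
have C0 : (0 : 'F_p)%:P = 0 :> {poly 'F_p} by exact: polyC0.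
rewrite C0 mul0r addr0 [X in _ + X]big_ord_recl /= (@delta_none (fun i => i.+1 == 0%N)) //.
rewrite C0 mul0r add0r.
rewrite -big_split /=; apply: eq_bigr => i _.
rewrite (@eq_delta _ _ _ p_pr p_odd T_pow _ _ (fun j => j.+1 == lift ord0 i) (pred1 (i : nat))) //.
(* Each [delta] occurs once with an extra factor ['X] and once with an extra factor 1 - ['X], which
   add up to 1. *)
rewrite -mulrDr; congr (_ * _).
have -> : (N.+1 - lift ord0 i = N - i)%N by [].
have -> : (1 - 'X) ^+ lift ord0 i = (1 - 'X) * (1 - 'X) ^+ i :> {poly 'F_p} by rewrite -exprS.
rewrite subSn ?leq_ord // ['X^(_.+1)]exprS mulrCA -mulrA -mulrDl.
by rewrite addrC subrK mul1r.
Qed.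

Lemma euler_poly_prefix b a (D : 'M[R]_a) : tinv D ->
  euler_poly (block_mx (1%:M : 'M_b) 0 0 D : 'M_(b + a)) = euler_poly D.
Proof.
move=> fD; elim: b => [|b IH].
  congr euler_poly; apply/matrixP => i j.
  case: (split_ordP i) => [[]//|i' ->]; case: (split_ordP j) => [[]//|j' ->].
  by rewrite block_mxEdr; congr (D _ _); apply: val_inj.
rewrite -[RHS]IH -[RHS]euler_poly_block1; last exact: tinv_block1.
congr euler_poly; have := @block_mxA _ 1 b a 1 b a (1%:M : 'M[R]_1) 0 0 0 1%:M 0 0 0 D.
by rewrite /= castmx_id row_mx0 !col_mx0 row_mx0 -scalar_mx_block => ->.
Qed.

(** The sizes are related by an equation because a + b and b + a are not convertible. *)
Lemma euler_poly_conj N N' (P : 'M[R]_(N, N')) P' (B : 'M_N') : N = N' -> P *m P' = 1%:M ->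
  P' *m P = 1%:M -> tinv B -> euler_poly (P *m B *m P') = euler_poly B.
Proof.
move=> e; subst N' => h1 h2 fB; have f1 := tinv_unit T p h1; have f2 := tinv_unit T p h2.
rewrite !euler_polyM //; last exact: tinvM.
by rewrite (euler_poly_unit h2) (euler_poly_unit h1) addr0 add0r.
Qed.

(** After adding identity blocks, 1 + X Y and 1 + Y X differ by permutation and unipotent block
    matrices, whose contributions vanish or cancel. *)
Lemma euler_poly_1pXY b a (X : 'M[R]_(b, a)) (Y : 'M[R]_(a, b)) :
  tinv (1%:M + X *m Y) -> tinv (1%:M + Y *m X) ->
  euler_poly (1%:M + X *m Y) = euler_poly (1%:M + Y *m X).
Proof.
move=> fA fD; set A := 1%:M + X *m Y in fA *; set D := 1%:M + Y *m X in fD *.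
pose L : 'M[R]_(b + a) := block_mx 1%:M 0 Y 1%:M.
pose L' : 'M[R]_(b + a) := block_mx 1%:M 0 (- Y) 1%:M.
pose U : 'M[R]_(b + a) := block_mx 1%:M (- X) 0 1%:M.
pose U' : 'M[R]_(b + a) := block_mx 1%:M X 0 1%:M.
pose P : 'M[R]_(b + a, a + b) := block_mx 0 1%:M 1%:M 0.
pose P' : 'M[R]_(a + b, b + a) := block_mx 0 1%:M 1%:M 0.
pose AA : 'M[R]_(a + b) := block_mx 1%:M 0 0 A.
pose DD : 'M[R]_(b + a) := block_mx 1%:M 0 0 D.
have simp := (mulmx_block, mulmx0, mul0mx, mulmx1, mul1mx, addr0, add0r).
have LL' : L *m L' = 1%:M by rewrite !simp subrr [RHS]scalar_mx_block.
have L'L : L' *m L = 1%:M by rewrite !simp addNr [RHS]scalar_mx_block.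
have UU' : U *m U' = 1%:M by rewrite !simp subrr [RHS]scalar_mx_block.
have U'U : U' *m U = 1%:M by rewrite !simp addNr [RHS]scalar_mx_block.
have PP' : P *m P' = 1%:M by rewrite !simp [RHS]scalar_mx_block.
have P'P : P' *m P = 1%:M by rewrite !simp [RHS]scalar_mx_block.
have E : P *m AA *m P' = U' *m (L *m (DD *m U) *m L').
  have E1 : P *m AA *m P' = block_mx A 0 0 1%:M by rewrite !simp.
  have E2 : U *m block_mx A 0 0 1%:M = block_mx A (- X) 0 1%:M by rewrite !simp.
  have E3 : DD *m U = block_mx 1%:M (- X) 0 D by rewrite !simp.
  have E4 : L *m block_mx 1%:M (- X) 0 D = block_mx 1%:M (- X) Y 1%:M.
    by rewrite !simp mulmxN /D addrC addrK.
  have E5 : block_mx 1%:M (- X) Y 1%:M *m L' = block_mx A (- X) 0 1%:M.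
    by rewrite !simp mulNmx mulmxN opprK subrr.
  by rewrite E3 E4 E5 -E2 mulmxA U'U mul1mx E1.
have fDD : tinv DD by apply: tinv_block1.
have fAA : tinv AA by apply: tinv_block1.
rewrite -(euler_poly_prefix a fA) -(euler_poly_prefix b fD) -/AA -/DD.
have fu := tinv_unit T p.
rewrite -(euler_poly_conj (addnC b a) PP' P'P fAA) E !euler_polyM; try by repeat first [apply: tinvM | exact: fu LL' | exact: fu L'L | exact: fu UU' | exact: fu U'U | done].
by rewrite (euler_poly_unit L'L) (euler_poly_unit LL') (euler_poly_unit U'U) (euler_poly_unit UU') !(addr0, add0r).
Qed.
End StableInvariant.

(** * Hilbert series and Newton's identities modulo p *)

Section Congruence.
Variable p : nat.
Hypotheses (p_pr : prime p) (p_odd : odd p).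
Local Notation Fp := 'F_p.

(* Sends the numerator [P] of a Hilbert series [P / (1 - X)^(k+1)] to its coefficient in
   degree [m], for [m >= size P] (below that [m - j] is truncated). *)
Definition hilb k m (P : {poly Fp}) : Fp := \sum_(j < size P) P`_j * ('C(m - j + k, k))%:R.

Lemma hilb_wide k m D (P : {poly Fp}) : (size P <= D)%N ->
  hilb k m P = \sum_(j < D) P`_j * ('C(m - j + k, k))%:R.
Proof.
move=> le; rewrite /hilb (big_ord_widen D (fun j => P`_j * ('C(m - j + k, k))%:R) le).
rewrite big_mkcond; apply: eq_bigr => j _; case: ltnP => // ge.
by rewrite nth_default ?mul0r.
Qed.

Lemma hilbD k m P Q : hilb k m (P + Q) = hilb k m P + hilb k m Q.
Proof.
have l1 := leq_maxl (size P) (size Q); have l2 := leq_maxr (size P) (size Q).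
rewrite (hilb_wide _ _ (size_polyD P Q)) (hilb_wide _ _ l1) (hilb_wide _ _ l2) -big_split.
by apply: eq_bigr => j _; rewrite coefD mulrDl.
Qed.

Lemma hilbN k m P : hilb k m (- P) = - hilb k m P.
Proof.
rewrite /hilb size_polyN -sumrN; apply: eq_bigr => j _; by rewrite coefN mulNr.
Qed.

Lemma hilb0 k m : hilb k m 0 = 0.
Proof. by rewrite /hilb size_poly0 big_ord0. Qed.

Lemma hilbXn k m d : hilb k m 'X^d = ('C(m - d + k, k))%:R.
Proof.
rewrite /hilb size_polyXn big_ord_recr /= coefXn eqxx mul1r big1 ?add0r // => i _.
by rewrite coefXn ltn_eqF ?mul0r.
Qed.

(** Pascal's rule: the factor 1 - X cancels one factor of the denominator. The bound on the size
    keeps m - j from being truncated. *)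
Lemma hilb_step k m (P : {poly Fp}) : (size P < m)%N -> hilb k.+1 m ((1 - 'X) * P) = hilb k m P.
Proof.
move=> lt; have le : (size ((1 - 'X) * P)%R <= (size P).+1)%N.
  apply: leq_trans (size_polyMleq _ _) _; rewrite -opprB size_polyN size_XsubC.
  by rewrite -subn1 leq_subLR.
rewrite (hilb_wide _ _ le) (hilb_wide _ _ (leqnSn _)).
under eq_bigr do rewrite mulrBl mul1r coefB coefXM mulrBl.
rewrite sumrB [X in _ - X]big_ord_recl /= mul0r add0r big_ord_recr /= [RHS]big_ord_recr /=.
rewrite nth_default // !mul0r !addr0 -sumrB; apply: eq_bigr => j _.
rewrite -mulrBr; congr (_ * _); have ltj : (j < m)%N by apply: ltn_trans lt.
have -> : (m - j = (m - bump 0 j).+1)%N by rewrite /bump /= add1n subnSK.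
by rewrite [in RHS]addSnnS addSn binS natrD addrAC subrr add0r.
Qed.

Lemma hilb_pow j k (P : {poly Fp}) : exists m0, forall m, (m0 <= m)%N ->
  hilb (j + k) m ((1 - 'X) ^+ j * P) = hilb k m P.
Proof.
elim: j => [|j [m0 H]]; first by exists 0%N => m _; rewrite expr0 mul1r.
exists (maxn m0 (size ((1 - 'X) ^+ j * P)%R).+1) => m; rewrite geq_max => /andP[h1 h2].
by rewrite addSn exprS -mulrA hilb_step // H.
Qed.

Lemma hilb_diff k m (P : {poly Fp}) : (size P <= m.+1)%N ->
  hilb k.+1 m.+1 P - hilb k.+1 m P = hilb k m.+1 P.
Proof.
move=> le; rewrite -sumrB; apply: eq_bigr => j _; rewrite -mulrBr; congr (_ * _).
have lej : (j <= m)%N by rewrite -ltnS; apply: leq_trans le.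
by rewrite subSn // [in RHS]addSnnS addSn binS natrD addrAC subrr add0r.
Qed.

(** Differencing in [m] lowers [k] and turns the constant into 0, so by induction the cofactor of (1
    - X)^k vanishes at 1 and yields one more factor. *)
Lemma hilb_const k (P : {poly Fp}) c m0 : (forall m, (m0 <= m)%N -> hilb k m P = c) ->
  exists Q, P = (1 - 'X) ^+ k * Q /\ Q.[1] = c.
Proof.
elim: k c m0 => [|k IH] c m0 H.
  exists P; rewrite expr0 mul1r; split=> //; rewrite -(H m0 (leqnn _)) horner_coef.
  by apply: eq_bigr => j _; rewrite expr1n bin0.
have [|Q' [E h0]] := IH 0 (maxn m0 (size P)).+1.
  case=> [//|m]; rewrite ltnS geq_max => /andP[h1 h2].
  by rewrite -hilb_diff ?H ?subrr // leqW.
have /factor_theorem [Q hQ] : root Q' 1 by rewrite rootE h0.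
have E' : P = (1 - 'X) ^+ k.+1 * (- Q).
  by rewrite E hQ exprSr -mulrA mulrN -mulNr opprB mulrC [Q * _]mulrC polyC1 mulrC.
exists (- Q); split=> //; have [m1 H1] := hilb_pow k.+1 0 (- Q).
rewrite -(H (maxn m0 m1)) ?leq_maxl // {1}E'.
have := H1 (maxn m0 m1) (leq_maxr _ _); rewrite addn0 => ->.
by rewrite /hilb horner_coef; apply: eq_bigr => j _; rewrite expr1n bin0.
Qed.

(* As [d^p = d], the logarithmic derivative [d / (1 + d X)] has denominator [1 - X^(p-1)]. *)
Lemma deriv_prod_fermat (I : Type) (r : seq I) (d : I -> Fp) :
  exists W : {poly Fp}, (size W < p)%N /\
    (1 - 'X^(p.-1)) * (\prod_(a <- r) (1 + (d a) *: 'X))^`() = (\prod_(a <- r) (1 + d a *: 'X)) * W.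
Proof.
have p1 := prime_gt1 p_pr.
elim: r => [|a r [W [sW hW]]].
  exists 0; rewrite size_poly0 big_nil derivC !mulr0; split=> //; exact: ltnW.
have [V [sV hV]] : exists V : {poly Fp}, (size V < p)%N /\
    (1 - 'X^(p.-1)) * (1 + d a *: 'X)^`() = (1 + d a *: 'X) * V.
  have dE : (1 + d a *: 'X)^`() = (d a)%:P by rewrite derivD derivC add0r derivZ derivX alg_polyC.
  have [d0|dn] := eqVneq (d a) 0.
    by exists 0; rewrite size_poly0 dE d0 polyC0 !mulr0; split=> //; exact: ltnW.
  pose V := d a *: \sum_(j < p.-1) (- (d a *: 'X)) ^+ j.
  exists V; split.
    apply: leq_ltn_trans (size_scale_leq _ _) _; apply: (@leq_ltn_trans p.-1); last by rewrite prednK // ltnW.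
    apply: (leq_trans (size_sum _ _ _)); apply/bigmax_leqP => j _.
    by rewrite exprNn exprZn -signr_odd mulr_sign; case: odd; rewrite ?size_polyN;
      apply: leq_trans (size_scale_leq _ _) _; rewrite size_polyXn.
  rewrite dE mulrC -scalerAr mul_polyC; congr (_ *: _).
  have := subrX1 (- (d a *: 'X) : {poly Fp}) p.-1.
  have -> : (- (d a *: 'X)) ^+ p.-1 = 'X^(p.-1) :> {poly Fp}.
    rewrite exprNn -signr_odd exprZn; have -> : odd p.-1 = false.
      by move: p_odd; rewrite -{1}(prednK (ltnW p1)) /= => /negbTE.
    rewrite expr0 mul1r (_ : d a ^+ p.-1 = 1) ?scale1r //.
    apply: (mulfI dn); rewrite mulr1 -exprS prednK ?(ltnW p1) //.
    by have := expf_card (d a); rewrite card_Fp.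
  by move=> h; rewrite -[LHS]opprB h -mulNr opprD opprK addrC opprK.
exists (V + W); split.
  by apply: leq_ltn_trans (size_polyD _ _) _; rewrite gtn_max sV.
by rewrite !big_cons derivM mulrDr mulrA hV mulrCA hW -!mulrA [V * _]mulrC !mulrDr.
Qed.

(** Degree [p] must be part of the hypothesis, since Newton's identity has the factor p = 0 there.
    In degree p + 1 the factor is 1, and the periodicity of the power sums lets nothing new
    enter. *)
Lemma newton_fermat (I : Type) (r s : seq I) (d e : I -> Fp) :
  (forall j, (j <= p)%N -> (\prod_(a <- r) (1 + d a *: 'X))`_j = (\prod_(a <- s) (1 + e a *: 'X))`_j) ->
  (\prod_(a <- r) (1 + d a *: 'X))`_p.+1 = (\prod_(a <- s) (1 + e a *: 'X))`_p.+1.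
Proof.
have p1 := prime_gt1 p_pr.
have c0 (r' : seq I) (f : I -> Fp) : (\prod_(a <- r') (1 + f a *: 'X))`_0 = 1.
  elim/big_rec: _ => [|a P _ IH]; first by rewrite coefC.
  by rewrite mulrDl mul1r coefD -scalerAl coefZ coefXM mulr0 addr0.
set P := \prod_(a <- r) _; set Q := \prod_(a <- s) _ => h.
have [W [sW hW]] := deriv_prod_fermat r d; have [V [sV hV]] := deriv_prod_fermat s e.
rewrite -/P -/Q in hW hV.
have cXM (A B : {poly Fp}) m : (forall j, (j <= m)%N -> B`_j = 0) -> forall j, (j <= m)%N -> (A * B)`_j = 0.
  move=> hB j lej; rewrite coefM big1 // => i _; rewrite hB ?mulr0 //.
  by apply: leq_trans lej; apply: leq_subr.
(* Both have size below [p], and their coefficients are found recursively from those of [P] and [Q],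
   since [P] has constant term 1. *)
have WV : W = V.
  apply/eqP; rewrite -subr_eq0; apply/eqP/polyP => j; rewrite coef0.
  have [lt|ge] := ltnP j p; last first.
    rewrite nth_default // (leq_trans (size_polyD _ _)) // size_polyN geq_max.
    by rewrite !(leq_trans (ltnW _) ge).
  have key j' : (j' < p)%N -> (P * (W - V))`_j' = 0.
    move=> ltj'; have -> : P * (W - V) = (1 - 'X^(p.-1)) * (P - Q)^`() + V * (Q - P).
      by rewrite derivB !mulrBr hW hV [Q * V]mulrC [V * P]mulrC addrA subrK.
    have z1 : ((1 - 'X^(p.-1)) * (P - Q)^`())`_j' = 0.
      apply: (cXM _ _ p.-1); last by rewrite -ltnS prednK // ltnW.
      move=> i; rewrite -ltnS prednK ?(ltnW p1) // => lti.
      by rewrite coef_deriv coefB h ?subrr ?mul0rn.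
    have z2 : (V * (Q - P))`_j' = 0.
      by apply: (cXM _ _ p); rewrite ?(ltnW ltj') // => i lei; rewrite coefB h ?subrr.
    by rewrite coefD z1 z2 addr0.
  elim/ltn_ind: j lt => j IH lt; have := key j lt.
  rewrite coefM big_ord_recl /= c0 mul1r subn0 big1 ?addr0 // => i _.
  have ltj : (j - bump 0 i < j)%N.
    by rewrite /bump /= add1n ltn_subrL (leq_ltn_trans (leq0n i) (ltn_ord i)).
  by rewrite IH ?mulr0 // (ltn_trans ltj).
have dPQ : (1 - 'X^(p.-1)) * (P - Q)^`() = W * (P - Q).
  by rewrite derivB mulrBr hW hV WV -mulrBl mulrC.
have key : ((P - Q)^`())`_p = 0.
  have : ((1 - 'X^(p.-1)) * (P - Q)^`())`_p = 0.
    by rewrite dPQ (cXM _ _ p) // => i lei; rewrite coefB h ?subrr.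
  rewrite mulrBl mul1r coefB coefXnM; case: ltnP => [_|le]; first by rewrite subr0.
  rewrite [X in _ - X](_ : _ = 0) ?subr0 // coef_deriv coefB h ?subrr ?mul0rn //.
  by rewrite ltn_subrL; apply/andP; split; [rewrite -subn1 subn_gt0|apply: ltnW].
(* The derivative brings out the factor p + 1, which is 1 in F_p. *)
move: key; rewrite coef_deriv coefB -mulr_natr -natr1 pchar_Fp_0 // add0r mulr1.
by move/eqP; rewrite subr_eq0 => /eqP.
Qed.

Fixpoint extdeg N : ('I_N -> nat) -> 'I_(extdim N) -> nat :=
  match N return ('I_N -> nat) -> 'I_(extdim N) -> nat with
  | 0 => fun _ _ => 0%N
  | N'.+1 => fun d i => match split i with
      | inl j => extdeg (fun k => d (lift ord0 k)) j
      | inr j => (d ord0 + extdeg (fun k => d (lift ord0 k)) j)%N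
      end
  end.

Lemma extdegl N (d : 'I_N.+1 -> nat) (j : 'I_(extdim N)) :
  @extdeg N.+1 d (lshift (extdim N) j) = extdeg (fun k => d (lift ord0 k)) j.
Proof. by rewrite /= -/(unsplit (inl j)) unsplitK. Qed.
Lemma extdegr N (d : 'I_N.+1 -> nat) (j : 'I_(extdim N)) :
  @extdeg N.+1 d (rshift (extdim N) j) = (d ord0 + extdeg (fun k => d (lift ord0 k)) j)%N.
Proof. by rewrite /= -/(unsplit (inr j)) unsplitK. Qed.

Lemma extdeg_addc N (d : 'I_N -> nat) c I : extdeg (fun j => d j + c)%N I = (extdeg d I + c * extwt I)%N.
Proof.
elim: N d I => [|N IH] d I; first by rewrite /= muln0.
case: (split_ordP I) => J ->; rewrite ?extdegl ?extdegr ?extwtl ?extwtr IH //.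
by rewrite mulnS addnACA.
Qed.

Lemma sum_ext_weights N (d : 'I_N -> nat) :
  \sum_(I : 'I_(extdim N)) ('X^(extdeg d I) : {poly Fp})%:P * ((1 - 'X) ^+ extwt I * 'X^(N - extwt I)) =
  \prod_(a < N) (('X^(d a) : {poly Fp})%:P + 'X * (1 - 'X^(d a))%:P).
Proof.
elim: N d => [|N IH] d.
  by rewrite [RHS]big_ord0 [LHS]big_ord_recl [X in _ + X]big_ord0 addr0 /= expr0 polyC1 !mul1r.
rewrite big_ord_recl -IH [LHS]big_split_ord /= mulr_sumr -big_split.
apply: eq_bigr => I _ /=; rewrite -!/(unsplit (inl I)) -!/(unsplit (inr I)) !unsplitK.
rewrite subSS subSn ?extwt_leq // exprD polyCM !exprS polyCB polyC1.
ring.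
Qed.

(** The q-integer of [d], with value [d] at X = 1. *)
Definition qint d : {poly Fp} := \sum_(i < d) 'X^i.

Lemma qintE d : 1 - 'X^d = (1 - 'X) * qint d.
Proof. by rewrite -[LHS]opprB subrX1 -mulNr opprB. Qed.

(* The coefficient of [t^j] in [prod_a (X^d_a + t (1 - X^d_a))] is divisible by [(1 - X)^j];
   [qprod] is what remains after the substitution [t |-> (1 - X) t]. *)
Definition qprod N (d : 'I_N -> nat) : {poly {poly Fp}} :=
  \prod_(a < N) (('X^(d a) : {poly Fp})%:P + 'X * (qint (d a))%:P).

Lemma qprod_coef N (d : 'I_N -> nat) j :
  (\prod_(a < N) (('X^(d a) : {poly Fp})%:P + 'X * (1 - 'X^(d a))%:P))`_j =
  (1 - 'X) ^+ j * (qprod d)`_j.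
Proof.
have -> : \prod_(a < N) (('X^(d a) : {poly Fp})%:P + 'X * (1 - 'X^(d a))%:P) =
    qprod d \Po ((1 - 'X : {poly Fp})%:P * 'X).
  rewrite /qprod [RHS](rmorph_prod (comp_poly _)); apply: eq_bigr => a _.
  by rewrite /= comp_polyD comp_polyM !comp_polyC comp_polyX qintE polyCM; ring.
rewrite comp_polyE coef_sum.
under eq_bigr => i _ do rewrite exprMn -rmorphXn coefZ coefCM coefXn.
have [lt|ge] := ltnP j (size (qprod d)); last first.
  rewrite big1 ?[(qprod d)`_j]nth_default ?mulr0 // => i _.
  by rewrite gtn_eqF ?mulr0 // (leq_trans (ltn_ord i)).
rewrite (bigD1 (Ordinal lt)) //= eqxx mulr1 big1 ?addr0 1?mulrC // => i ne.
by rewrite eq_sym (_ : (_ == _) = false) ?mulr0 //; apply/negbTE.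
Qed.

Lemma qprod1 N (d : 'I_N -> nat) j :
  ((qprod d)`_j).[1] = (\prod_(a < N) (1 + (d a)%:R *: 'X : {poly Fp}))`_j.
Proof.
have -> : \prod_(a < N) (1 + (d a)%:R *: 'X : {poly Fp}) = map_poly (horner_eval 1) (qprod d).
  rewrite rmorph_prod; apply: eq_bigr => a _.
  rewrite rmorphD rmorphM /= !map_polyC map_polyX /= /horner_eval hornerXn expr1n polyC1.
  rewrite mulrC mul_polyC; congr (1 + _ *: _); rewrite horner_sum.
  by under eq_bigr do rewrite hornerXn expr1n; rewrite sumr_const card_ord.
by rewrite coef_map.
Qed.

(** Constancy of the Hilbert functions puts a factor (1 - X)^(p+1) into each difference of
    numerators. The coefficient of t^j in [qprod d] minus that in [qprod e] therefore vanishes at X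
    = 1 for j <= p, where it is a difference of elementary symmetric functions. [newton_fermat] then
    gives j = p + 1, where the difference is the wanted coefficient. *)
Lemma weight_congruence N (d e : 'I_N -> nat) (g : nat -> Fp) m0 :
  (forall i, (i <= N)%N -> forall m, (m0 <= m)%N ->
    hilb p.+1 m (\sum_(I | extwt I == i) ('X^(extdeg d I) - 'X^(extdeg e I))) = g i) ->
  (\sum_(i < N.+1) (g i)%:P * ((1 - 'X) ^+ i * 'X^(N - i)) : {poly Fp})`_p.+1 = 0.
Proof.
move=> h.
pose D i : {poly Fp} := \sum_(I | extwt I == i) ('X^(extdeg d I) - 'X^(extdeg e I)).
have hQ i : exists Q, (i <= N)%N -> D i = (1 - 'X) ^+ p.+1 * Q /\ Q.[1] = g i.
  case: (leqP i N) => [le|]; last by exists 0.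
  by have [Q hQ] := hilb_const (h i le); exists Q.
have [Q {}hQ] := choice _ hQ.
pose H : {poly {poly Fp}} := \sum_(i < N.+1) (Q i)%:P * ((1 - 'X) ^+ i * 'X^(N - i)).
have HE j : (1 - 'X) ^+ p.+1 * H`_j = (1 - 'X) ^+ j * ((qprod d)`_j - (qprod e)`_j).
  rewrite mulrBr -!qprod_coef -coefB -!sum_ext_weights -sumrB -coefCM mulr_sumr.
  congr (nth 0 (polyseq _) _); rewrite [RHS](partition_big (fun I => inord (extwt I) : 'I_N.+1) xpredT) //=.
  apply: eq_bigr => i _; have [E _] := hQ i (leq_ord i).
  rewrite mulrA -polyCM -E /D rmorph_sum mulr_suml; apply: eq_big => [I|I /eqP hI].
    by rewrite -(inj_eq val_inj) /= inordK // ltnS extwt_leq.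
  by rewrite hI rmorphB mulrBl.
have nz : (1 - 'X : {poly Fp}) != 0 by rewrite -opprB oppr_eq0 polyXsubC_eq0.
have GE j : (\sum_(i < N.+1) (g i)%:P * ((1 - 'X) ^+ i * 'X^(N - i)) : {poly Fp})`_j = (H`_j).[1].
  have -> : \sum_(i < N.+1) (g i)%:P * ((1 - 'X) ^+ i * 'X^(N - i)) = map_poly (horner_eval 1) H.
    rewrite rmorph_sum; apply: eq_bigr => i _; have [_ <-] := hQ i (leq_ord i).
    by rewrite !rmorphM /= map_polyC /= !rmorphXn /= rmorphB /= rmorph1 map_polyX.
  by rewrite coef_map.
rewrite GE; have /(mulfI (expf_neq0 _ nz)) -> := HE p.+1.
rewrite hornerD hornerN !qprod1; apply/eqP; rewrite subr_eq0; apply/eqP.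
apply: newton_fermat => j lej; rewrite -!qprod1; apply/eqP; rewrite -subr_eq0 -hornerN -hornerD.
have -> : (qprod d)`_j - (qprod e)`_j = (1 - 'X) ^+ (p.+1 - j) * H`_j.
  apply: (mulfI (expf_neq0 j nz)); rewrite -HE mulrA -exprD subnKC //; exact: leqW.
by rewrite hornerM horner_exp hornerD hornerN hornerX hornerC subrr subSn // expr0n mul0r.
Qed.

End Congruence.

(** * Matrices with controlled degrees *)

Section HomogeneousCase.
Variables (K : fieldType) (T : K) (p : nat).
Hypotheses (p_pr : prime p) (p_odd : odd p).
Hypothesis T_pow : forall d (t : K), t ^+ p = T ^+ d -> (p %| d)%N.

Section Bounds.
Variable n : nat.
Local Notation R := (ipoly K n.+1).
Local Notation io := (ipolyC K n.+1).

Lemma degleM_mul a b c (v : 'I_c -> nat) (w : 'I_b -> nat) (e : 'I_a -> nat) m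
    (A : 'M[R]_(a, b)) (B : 'M[R]_(b, c)) :
  degleM w e A -> degleM v (fun j => w j + m)%N B -> degleM v (fun i => e i + m)%N (A *m B).
Proof. by move=> hA hB i; rewrite row_mul; apply: (degle_mul hB); apply/degle_shift. Qed.

Lemma degle_entry a (w : 'I_a -> nat) m (u : 'rV[R]_a) :
  degle w m u <-> forall j, u 0 j = 0 \/ (w j + size (homogenize K n.+1 (u 0 j))%R <= m.+1)%N.
Proof.
have E j : u 0 j != 0 -> size ('X^(w j) * homogenize K n.+1 (u 0 j)) = (w j + size (homogenize K n.+1 (u 0 j))%R)%N.
  move=> u0; have h0 : homogenize K n.+1 (u 0 j) != 0 by rewrite -(rmorph0 (homogenize K n.+1)) (inj_eq (@homogenize_inj K n.+1)).
  by rewrite mulrC size_Mmonic ?monicXn // size_polyXn addnS addnC.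
split=> h j; have := h j.
  by have [->|u0] := eqVneq (u 0 j) 0; [left|rewrite E //; right].
by have [->|u0] := eqVneq (u 0 j) 0; [rewrite rmorph0 mulr0 size_poly0|case=> [/eqP|]; rewrite ?(negbTE u0) ?E].
Qed.

Lemma wedge_degleM N (d : 'I_N -> nat) m (v : 'rV[R]_N) : degle d m v ->
  degleM (extdeg d) (fun I => extdeg d I + m)%N (wedge v).
Proof.
elim: N d v => [|N IH] d v /= homv; first by move=> i; apply/degle_entry => j; left; rewrite !mxE.
have hv' : degle (fun k => d (lift ord0 k)) m (rsubmx (v : 'rV_(1 + N))).
  move/degle_entry: homv => homv; apply/degle_entry => j; have := homv (lift ord0 j).
  by rewrite mxE; have -> : rshift 1 j = lift ord0 j by apply: val_inj.
have hI := IH _ _ hv'; change 'rV[R]_(1 + N) in v.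
have hI' I := proj1 (degle_entry _ _ _) (hI I).
move=> i; apply/degle_entry => j; rewrite mxE.
case: (split_ordP i) => I ->; case: (split_ordP j) => J ->;
  rewrite ?extdegl ?extdegr ?block_mxEul ?block_mxEur ?block_mxEdl ?block_mxEdr.
- by have := hI' I J; rewrite mxE.
- rewrite mxE; have [->|_] := eqVneq I J; last by left.
  move/degle_entry: homv => /(_ 0) [->|h]; first by left; rewrite mul0rn.
  right; rewrite mulr1n [(d _ + _)%N]addnC -addnA -addnS leq_add2l.
  by rewrite (_ : ord0 = 0).
- by left; rewrite mxE.
- rewrite mxE rmorphN size_polyN; have := hI' I J; rewrite mxE => -[->|h]; first by left; rewrite oppr0.
  by right; rewrite -!addnA -addnS leq_add2l.
Qed.

Lemma ext_degleM N M (d : 'I_M -> nat) (e : 'I_N -> nat) (U : 'M[R]_(N, M)) :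
  degleM d e U -> degleM (extdeg d) (extdeg e) (ext U).
Proof.
elim: N e U => [|N IH] e U hU /=.
  move=> i; apply/degle_entry => j; rewrite ord1 row_id.
  elim: M d {hU U} j => [|M IHM] d j; first by rewrite ord1 mxE /=; right; rewrite rmorph1 size_poly1.
  case: (split_ordP j) => J ->; rewrite ?extdegl ?extdegr /= ?row_mxEl ?row_mxEr; last by left; rewrite mxE.
  exact: IHM.
change 'M[R]_(1 + N, M) in U.
have hI : degleM (extdeg d) (extdeg (fun k => e (lift ord0 k))) (ext (dsubmx U)).
  apply: IH => i; have := hU (lift ord0 i); congr degle; apply/rowP => j; rewrite !mxE; congr (U _ _).
  exact: val_inj.
have h0 : degle d (e ord0) (usubmx U).
  have := hU ord0; congr degle; apply/rowP => j; rewrite !mxE; congr (U _ _); exact: val_inj.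
move=> i; case: (split_ordP i) => I ->; rewrite ?extdegl ?extdegr ?rowKu ?rowKd; first exact: hI.
have := degleM_mul hI (wedge_degleM h0) I; by rewrite addnC.
Qed.

Lemma reldim_wsupp_degle N (w : 'I_(extdim N) -> nat) (A : pred nat) m :
  reldim io (fun u : 'rV_(extdim N) => wsupp A u /\ degle w m u) (@zerov _ _)
    (\sum_(I | A (extwt I)) hdim n.+1 m (w I)).
Proof.
(* A generator of degree m + 1 cannot occur in degree at most [m], so a support condition becomes a
   choice of weights. *)
pose w' I := if A (extwt I) then w I else m.+1.
have -> : (\sum_(I | A (extwt I)) hdim n.+1 m (w I) = \sum_I hdim n.+1 m (w' I))%N.
  rewrite big_mkcond; apply: eq_bigr => I _; rewrite /w'; case: ifP => // _.
  by rewrite /hdim ltnn.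
apply: reldim_ext (reldim_degle K n.+1 w' m) => // u; split.
  move/degle_entry=> h; split=> [I hI|].
    have [//|] := h I; rewrite /w' /= in hI *; rewrite (negbTE hI).
    rewrite -[X in (_ <= X)%N]addn0 leq_add2l leqn0 size_poly_eq0.
    by rewrite -(rmorph0 (homogenize K n.+1)) (inj_eq (@homogenize_inj K n.+1)) => /eqP.
  apply/degle_entry => I; have := h I; rewrite /w'; case: ifP => // ne [->|]; first by left.
  rewrite -[X in (_ <= X)%N]addn0 leq_add2l leqn0 size_poly_eq0.
  by rewrite -(rmorph0 (homogenize K n.+1)) (inj_eq (@homogenize_inj K n.+1)) => /eqP ->; left.
case=> hs /degle_entry h; apply/degle_entry => I; rewrite /w'; case: ifP => hI //.
by left; rewrite hs //= hI.
Qed.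
End Bounds.

Section Degree.
Variable n : nat.
Local Notation R := (ipoly K n.+1).
Local Notation io := (ipolyC K n.+1).
Local Notation F := (towerF T p n).
Local Notation q := (p ^ n)%N.
Local Notation tinv := (tinv T p).

(** [S] inverts [U] up to F^k and loses just the degree k q of F^k, so [ext U] is strict: in weight
    i the degree of an image bounds that of its preimage. Hence [delta] is an exact difference of
    Hilbert functions. *)
Lemma delta_weights N (U S : 'M[R]_N) k (d e : 'I_N -> nat) i :
  degleM d e U -> degleM e (fun j => d j + k * q)%N S -> S *m U = (F ^+ k)%:M ->
  exists m0, forall m, (m0 <= m)%N ->
  delta p (pred1 i) U + (\sum_(I : 'I_(extdim N) | extwt I == i) hdim n.+1 m (extdeg e I))%:R
    = (\sum_(I : 'I_(extdim N) | extwt I == i) hdim n.+1 m (extdeg d I))%:R.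
Proof.
move=> hU hS SU; have fU : tinv U by exists k, S; apply: tinv_comm.
have aU := commensurable_delta p_pr (pred1 i) fU.
have [m0 H0] := eulerW p_pr p_odd T_pow (extdeg d) (tinv1 T p n (extdim N)) aU.
exists m0 => m le; have [r hr] := commensurable_fdim p_pr (extdeg d) m (tinv1 T p n (extdim N)) aU.
rewrite -[delta _ _ _](H0 m le r hr) -natrD; congr _%:R.
have k0 := ksubspace_zerov io (extdim N).
have sI := submod_rowimg (ext U) (submod_wsupp K n (pred1 i) N).
apply: (reldim_uniq k0 _ (reldim_wsupp_degle n (extdeg d) (pred1 i) m)).
apply: (reldim_add (Q := fun u => rowimg (@wsupp K n (pred1 i) N) (ext U) u /\ degle (extdeg d) m u) k0).
- by move=> u [hu hd]; split=> //; case: aU => _ _ h12 _; apply: h12.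
- by move=> u ->; split; [case: sI|apply: ksubspace0 (ksubspace_degle _ _ _ _)].
- by apply: ksubspaceI; [apply: submod_ksubspace|apply: ksubspace_degle].
- by apply: reldim_ext hr => u; rewrite mulmx1.
apply: (reldim_map (phi := fun u => u *m ext U)) (reldim_wsupp_degle n (extdeg e) (pred1 i) m).
- by move=> c u v; rewrite mulmxDl scalemxAl.
- exact: k0.
- move=> u [hs hd]; split; first by exists u.
  exact: degle_mul (ext_degleM hU) hd.
- by move=> u ->; rewrite /zerov mul0mx.
- by move=> d' c b _; apply: tinv_inj (tinv_ext p_pr fU).
- move=> _ [[u [hs ->]] hd]; exists u; split; last by rewrite /zerov subrr.
  (* In weight i, shifting the weights by k q costs k q i, which is the degree of the scalar F^(k i)
     by which [ext U] followed by [ext S] acts. *)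
  split=> //; have h1 : degle (extdeg (fun j => d j + k * q)%N) (m + k * q * i) (u *m ext U).
    move/degle_entry: hd => hd; apply/degle_entry => I; have [|h] := hd I; first by left.
    have [e1|ne] := eqVneq (extwt I) i; last first.
      by left; apply: (wsupp_mul _ hs) => //; apply: ext_wpres.
    by right; rewrite extdeg_addc e1 addnAC -addSn leq_add2r.
  have := degle_mul (ext_degleM hS) h1; rewrite -mulmxA extM (tinv_comm p_pr SU) ext_scalar.
  have -> : u *m (\matrix_(I, J) (F ^+ k ^+ extwt I *+ (I == J))) = F ^+ (k * i) *: u.
    apply/rowP => J; rewrite !mxE (bigD1 J) //= !mxE eqxx big1 ?addr0; last first.
      by move=> I ne; rewrite !mxE (negbTE ne) mulr0.
    have [<-|ne] := eqVneq (extwt J) i; first by rewrite mulrC exprM.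
    by rewrite hs //= mul0r mulr0.
  move/(degle_hom _ _ _ (FX_neq0 T p_pr n _) (towerFX_hom T p n _)).
  by rewrite mulnAC => /degle_shift.
Qed.
End Degree.

Lemma euler_poly_weights N (U S : 'M[ipoly K p.+1]_N) k (d e : 'I_N -> nat) :
  degleM d e U -> degleM e (fun j => d j + k * p ^ p)%N S -> S *m U = (towerF T p p ^+ k)%:M ->
  (euler_poly p U)`_p.+1 = 0.
Proof.
move=> hU hS SU.
have [m0 H] := choice _ (fun i => delta_weights i hU hS SU).
pose W := (\max_I maxn (extdeg d I) (extdeg e I) : nat)%N.
apply: (weight_congruence p_pr p_odd (g := fun i => delta p (pred1 i) U) (d := d) (e := e) (m0 := maxn W (\max_(i < N.+1) (m0 : nat -> nat) i))).
move=> i le m; rewrite geq_max => /andP[leW lem].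
have hm : (m0 i <= m)%N.
  by apply: leq_trans lem; apply: (@leq_bigmax _ (fun i : 'I_N.+1 => m0 i) (Ordinal (le : (i < N.+1)%N))).
have E (f : 'I_(extdim N) -> nat) : (forall I, f I <= W)%N ->
    hilb p.+1 m (\sum_(I | extwt I == i) 'X^(f I)) = (\sum_(I | extwt I == i) hdim p.+1 m (f I))%:R.
  move=> hf; rewrite (big_morph _ (hilbD p.+1 m) (hilb0 _ _ _)) natr_sum; apply: eq_bigr => I _.
  by rewrite hilbXn /hdim (leq_trans (hf I) leW).
rewrite sumrB hilbD hilbN !E => [|I|I].
- by rewrite -(H i m hm) addrK.
- by apply: leq_trans (leq_bigmax I); apply: leq_maxr.
- by apply: leq_trans (leq_bigmax I); apply: leq_maxl.
Qed.
End HomogeneousCase.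

(** * Filtered free resolutions *)

Section Resolutions.
Variable K : fieldType.

Section Def.
Variable n : nat.
Local Notation R := (ipoly K n).

(* A free resolution of length less than [l], strict for the filtrations by [degle]. *)
Fixpoint filtres l a (d : 'I_a -> nat) (N : 'rV[R]_a -> Prop) : Prop :=
  if l is l'.+1 then exists b (e : 'I_b -> nat) (U : 'M[R]_(b, a)),
    [/\ forall i, N (row i U), degleM d e U,
        forall m u, N u -> degle d m u -> exists r, u = r *m U /\ degle e m r
      & filtres l' e (fun r => r *m U = 0)]
  else forall u, N u -> u = 0.

Fixpoint gradres l a (d : 'I_a -> nat) (N : 'rV[R]_a -> Prop) : Prop :=
  if l is l'.+1 then exists b (e : 'I_b -> nat) (U : 'M[R]_(b, a)),
    [/\ forall i, N (row i U), homogM d e U, forall u, N u -> exists r, u = r *m U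
      & gradres l' e (fun r => r *m U = 0)]
  else forall u, N u -> u = 0.

Lemma filtres_ext l a (d : 'I_a -> nat) N N' : (forall u, N u <-> N' u) -> filtres l d N -> filtres l d N'.
Proof.
case: l => [|l] h /=; first by move=> H u /h /H.
move=> [b [e [U [h1 h2 h3 h4]]]]; exists b, e, U; split=> // [i|m u /h].
  exact/h.
exact: h3.
Qed.

Lemma gradres_ext l a (d : 'I_a -> nat) N N' : (forall u, N u <-> N' u) -> gradres l d N -> gradres l d N'.
Proof.
case: l => [|l] h /=; first by move=> H u /h /H.
move=> [b [e [U [h1 h2 h3 h4]]]]; exists b, e, U; split=> // [i|u /h].
  exact/h.
exact: h3.
Qed.

Lemma gsubmod_ker a b (d : 'I_a -> nat) (e : 'I_b -> nat) (U : 'M[R]_(b, a)) : homogM d e U ->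
  gsubmod e (fun r => r *m U = 0).
Proof.
move=> hU; split; first split=> [|r u v hu homv]; first by rewrite mul0mx.
  by rewrite mulmxDl -scalemxAl hu homv scaler0 addr0.
by move=> m u hu; rewrite -(hpart_mul _ _ hU) hu hpart0.
Qed.

Lemma submod_ker a b (U : 'M[R]_(b, a)) : submod (fun r => r *m U = 0).
Proof.
split=> [|r u v hu homv]; first by rewrite mul0mx.
by rewrite mulmxDl -scalemxAl hu homv scaler0 addr0.
Qed.

Lemma homogM_strict a b (d : 'I_a -> nat) (e : 'I_b -> nat) (U : 'M[R]_(b, a)) m r : homogM d e U ->
  degle d m (r *m U) -> exists r', r *m U = r' *m U /\ degle e m r'.
Proof.
move=> hU h; exists (\sum_(i < m.+1) hpart e i r); split.
  by rewrite mulmx_suml {1}(degle_sum_hpart h); apply: eq_bigr => i _; rewrite (hpart_mul _ _ hU).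
apply: ksubspace_sum (ksubspace_degle _ _ e m) _ => i; apply: degle_leq (ishomog_degle (ishomog_hpart e i r)).
by rewrite -ltnS.
Qed.

Lemma degle_addn1_0 a (d : 'I_a -> nat) (u : 'rV[R]_a) : degle (fun j => d j + 1)%N 0 u -> u = 0.
Proof.
move=> h; apply/rowP => j; rewrite mxE; apply/eqP; apply: contraT => u0; have := h j.
have h0 : homogenize K n (u 0 j) != 0 by rewrite -(rmorph0 (homogenize K n)) (inj_eq (@homogenize_inj K n)).
rewrite mulrC size_Mmonic ?monicXn // size_polyXn addnS /= addn1 addnS ltnS leqn0 addn_eq0.
by rewrite size_poly_eq0 (negbTE h0).
Qed.
End Def.

Section Saturated.
Variable n : nat.
Local Notation R := (ipoly K n).
Local Notation R' := (ipoly K n.+1).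

(** The last variable is regular on the quotient by [N]; [xspec N] is then [N] modulo its multiples
    by that variable. *)
Definition xsat a (N : 'rV[R']_a -> Prop) := forall u, N (('X : R') *: u) -> N u.
Definition xspec a (N : 'rV[R']_a -> Prop) (v : 'rV[R]_a) := exists u, N u /\ v = ev0 u.

Lemma ev0_mul a b (r : 'rV[R']_b) (U : 'M[R']_(b, a)) (V : 'M[R]_(b, a)) :
  (forall i, ev0 (row i U) = row i V) -> ev0 (r *m U) = ev0 r *m V.
Proof.
move=> h; apply/rowP => j; rewrite !mxE horner_sum; apply: eq_bigr => i _.
by rewrite hornerM mxE; congr (_ * _); have /rowP/(_ j) := h i; rewrite !mxE.
Qed.

Lemma xsat_ker a b (U : 'M[R']_(b, a)) : xsat (fun r => r *m U = 0).
Proof.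
move=> u; rewrite -scalemxAl => /eqP; rewrite scalemx_eq0 => /orP[/eqP h|/eqP //].
by have := polyX_eq0 R; rewrite h eqxx.
Qed.

(** Graded Nakayama: u - v is divisible by the last variable, and by saturation the quotient lies in
    [N], in smaller degree. *)
Lemma xsat_descent a (d : 'I_a -> nat) (N N' : 'rV[R']_a -> Prop) : submod N -> xsat N -> submod N' ->
  (forall m u, N u -> degle d m u -> exists v, [/\ N v, N' v, degle d m v & ev0 v = ev0 u]) ->
  forall u, N u -> N' u.
Proof.
move=> sN satN sN' h u hu; have [m hm] := degle_exists d u.
elim: m u hu hm => [|m IH] u hu hm.
  have [v [v1 v2 v3 v4]] := h _ u hu hm.
  suff -> : u = v by [].
  apply/eqP; rewrite -subr_eq0; apply/eqP.
  have [|w E] := @ev0_eq0 _ _ _ (u - v); first by rewrite ev0B v4 subrr.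
  have : degle d 0 (u - v) by apply: ksubspaceB (ksubspace_degle _ _ d 0) _ _.
  rewrite E => /(@degle_hom K n.+1 _ d 0 1 'X) h0; rewrite (degle_addn1_0 (h0 _ _)) ?scaler0 ?polyX_eq0 //.
  by rewrite homogenizeSX expr1.
have [v [v1 v2 v3 v4]] := h _ u hu hm.
rewrite -(subrK v u); apply: submodD => //.
have [|w E] := @ev0_eq0 _ _ _ (u - v); first by rewrite ev0B v4 subrr.
have : degle d m.+1 (u - v) by apply: ksubspaceB (ksubspace_degle _ _ d m.+1) _ _.
rewrite E => /(@degle_hom K n.+1 _ d m.+1 1 'X) h0; apply: submodZ => //; apply: IH.
  by apply: satN; rewrite -E; apply: submodB.
by apply/(degle_shift d m 1); rewrite addn1; apply: h0; rewrite ?polyX_eq0 // homogenizeSX expr1.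
Qed.

(* A module on which the last variable is regular is resolved by lifting a resolution of
   its reduction. *)
Lemma gradres_xsat l a (d : 'I_a -> nat) (N : 'rV[R']_a -> Prop) : gsubmod d N -> xsat N ->
  gradres l d (xspec N) -> gradres l d N.
Proof.
elim: l a d N => [|l IH] a d N [sN cN] satN.
  move=> /= H u hu; apply: (@xsat_descent a d N (fun u => u = 0)) hu => //.
    by split=> // r x y -> ->; rewrite scaler0 addr0.
  move=> m v homv _; exists 0; split=> //; first by case: sN.
    exact: ksubspace0 (ksubspace_degle _ _ d m).
  by rewrite ev0_0 [RHS]H //; exists v.
move=> /= [b [e [V [V1 V2 V3 V4]]]].
have [U hU] := @rows_exist R' b a (fun i u => [/\ N u, ishomog d (e i) u & ev0 u = row i V])
  (fun i => let: ex_intro u (conj hu homv) := V1 i in ex_intro _ (hpart d (e i) u)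
    (And3 (cN _ _ hu) (ishomog_hpart _ _ _) (etrans (esym (hpart_ev0 d (e i) u))
       (etrans (congr1 (hpart d (e i)) (esym homv)) (hpart_ishomog (V2 i)))))).
have UV i : ev0 (row i U) = row i V by case: (hU i).
have hMU : homogM d e U by move=> i; case: (hU i).
have NU i : N (row i U) by case: (hU i).
have gU : forall u, N u -> exists r, u = r *m U.
  apply: (xsat_descent sN satN (N' := fun u => exists r, u = r *m U)).
    split; first by exists 0; rewrite mul0mx.
    by move=> r _ _ [x ->] [y ->]; exists (r *: x + y); rewrite mulmxDl scalemxAl.
  move=> m u hu hm; have [r hr] := V3 (ev0 u) (ex_intro _ u (conj hu erefl)).
  have [|r' [E hr']] := homogM_strict (m := m) (r := r) V2; first by rewrite -hr; apply: degle_ev0.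
  exists (inC r' *m U); split.
  - by apply: submod_lin sN _ => i; case: (hU i).
  - by exists (inC r').
  - by apply: degle_mul (homogM_degleM hMU) _; apply: degle_inC.
  - by rewrite (ev0_mul _ UV) inCK hr E.
exists b, e, U; split=> //.
apply: IH; [exact: gsubmod_ker hMU|exact: xsat_ker|].
apply: gradres_ext V4 => s; split=> [h|[r [h ->]]]; last by rewrite -(ev0_mul _ UV) h ev0_0.
have [|w E] := @ev0_eq0 _ _ _ (inC s *m U); first by rewrite (ev0_mul _ UV) inCK.
have [r hr] : exists r, w = r *m U.
  by apply/gU/satN; rewrite -E; apply: submod_lin.
exists (inC s - ('X : R') *: r); split.
  by rewrite mulmxBl -scalemxAl -hr E subrr.
by rewrite ev0B ev0Z inCK hornerX scale0r subr0.
Qed.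

Lemma gsubmod_xspec a (d : 'I_a -> nat) (N : 'rV[R']_a -> Prop) : gsubmod d N -> gsubmod d (xspec N).
Proof.
move=> [[N0 Nl] Nc]; split; first split.
- by exists 0; rewrite ev0_0.
- move=> r _ _ [u [hu ->]] [v [homv ->]]; exists ((r%:P : R') *: u + v); split; first exact: Nl.
  by rewrite ev0D ev0Z hornerC.
- by move=> m _ [u [hu ->]]; exists (hpart d m u); rewrite hpart_ev0; split=> //; apply: Nc.
Qed.
End Saturated.

(** A minimal number of generators admits no relation: over a field a nonzero coefficient of a
    relation is invertible and makes its generator redundant. *)
Lemma gradres_field a (d : 'I_a -> nat) (N : 'rV[ipoly K 0]_a -> Prop) : gsubmod d N -> gradres 1 d N.
Proof.
move=> hN.
pose P b := exists (e : 'I_b -> nat) (U : 'M[ipoly K 0]_(b, a)), [/\ forall i, N (row i U), homogM d e U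
  & forall u, N u -> exists r, u = r *m U].
have [b [[e [U [h1 h2 h3]]] hmin]] : exists b, P b /\ forall b', (b' < b)%N -> ~ P b'.
  have [b0 [e0 [U0 [h1 h2 h3]]]] := graded_gens hN.
  have : P b0 by exists e0, U0; split.
  elim/ltn_ind: b0 {e0 U0 h1 h2 h3} => b IH Pb.
  have [[b' [lt Pb']]|no] := classic (exists b', (b' < b)%N /\ P b'); first exact: IH lt Pb'.
  by exists b; split=> // b' lt Pb'; apply: no; exists b'.
exists b, e, U; split=> // r hr; apply: NNPP => r0.
have [i ri] : exists i, r 0 i != 0.
  apply: NNPP => no; apply: r0; apply/rowP => i; rewrite mxE; apply/eqP/negP => /negP h.
  by apply: no; exists i.
case: b e U h1 h2 h3 hmin r hr r0 i ri => [|b] e U h1 h2 h3 hmin r hr _ i ri; first by case: i ri.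
apply: (hmin b (ltnSn b)); exists (fun j => e (lift i j)), (row' i U); split.
- by move=> j; have := h1 (lift i j); congr N; apply/rowP => k; rewrite !mxE.
- by move=> j; have := h2 (lift i j); congr ishomog; apply/rowP => k; rewrite !mxE.
move=> u /h3 [s ->]; pose s' := s - (s 0 i / r 0 i) *: r.
have -> : s *m U = s' *m U by rewrite mulmxBl -scalemxAl hr scaler0 subr0.
exists (col' i s'); apply/rowP => k; rewrite !mxE (bigD1_ord i) //= !mxE mulfVK // subrr mul0r add0r.
by apply: eq_bigr => j _; rewrite !mxE.
Qed.

(** Hilbert's syzygy theorem. The module of relations is saturated in the last variable, being a
    kernel of a map of free modules, so it can be resolved after setting that variable to 0. *)
Lemma gradres_exists n : forall a (d : 'I_a -> nat) (N : 'rV[ipoly K n]_a -> Prop), gsubmod d N -> gradres n.+1 d N.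
Proof.
elim: n => [|n IH] a d N hN; first exact: gradres_field.
have [b [e [U [h1 h2 h3]]]] := graded_gens hN.
exists b, e, U; split=> //; have hk := gsubmod_ker h1.
by apply: gradres_xsat => //; [exact: xsat_ker|apply/IH/gsubmod_xspec].
Qed.

Section Filtered.
Variable n : nat.
Local Notation R := (ipoly K n.+1).

Definition leading a (d : 'I_a -> nat) (N : 'rV[R]_a -> Prop) y := forall M, exists u,
  [/\ N u, degle d M u & hpart d M u = hpart d M y].

Lemma gsubmod_leading a (d : 'I_a -> nat) N : submod N -> gsubmod d (leading d N).
Proof.
move=> sN.
(* A matrix without columns makes the second condition of [leadmod] empty. *)
have E y : leadmod d (fun=> 0%N) 1%:M (0 : 'M_(a, 0)) 0 0 N y <-> leading d N y.
  split=> h M; have [u] := h M.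
    by rewrite mulmx1 => -[h1 h2 h3 h4]; exists u.
  by move=> [h1 h2 h3]; exists u; rewrite mulmx1; split=> // -[].
have [[l0 ll] lincomb] := gsubmod_leadmod d (fun=> 0%N) 1%:M (0 : 'M_(a, 0)) 0 0 sN.
split; first split=> [|r u v /E hu /E homv]; try exact/E.
  by apply/E; apply: ll.
by move=> m u /E hu; apply/E; apply: lincomb.
Qed.

Lemma hpart_mul_top a b (d : 'I_a -> nat) (e : 'I_b -> nat) (U V : 'M[R]_(b, a)) m r :
  homogM d e V -> degleM d e U -> (forall i, hpart d (e i) (row i U) = row i V) -> degle e m r ->
  hpart d m (r *m U) = hpart e m r *m V.
Proof.
move=> hV hU UV hr.
rewrite -(hpart_mul _ _ hV) -[U](subrK V) mulmxDr hpartD -[RHS]add0r; congr (_ + _).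
have hD i : forall e', (e i <= e')%N -> hpart d e' (row i (U - V)) = 0.
  move=> e'; rewrite linearB /= hpartD hpartN leq_eqVlt => /orP[/eqP<-|lt].
    by rewrite UV (hpart_ishomog (hV i)) subrr.
  have /degleP -> // := hU i; by rewrite (hpart_homog0 (hV i)) ?subrr // gtn_eqF.
rewrite mulmx_sum_row hpart_sum big1 // => i _; rewrite hpartM big1 // => j _.
have [le|lt] := leqP (e i) (m - j)%N; first by rewrite hD // scaler0.
have -> : (homogenize K n.+1 (r 0 i))`_j = 0; last by rewrite scale0r.
apply/eqP; have := hr i; have [->|r0] := eqVneq (r 0 i) 0; first by rewrite rmorph0 coef0.
have h0 : homogenize K n.+1 (r 0 i) != 0 by rewrite -(rmorph0 (homogenize K n.+1)) (inj_eq (@homogenize_inj K n.+1)).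
rewrite mulrC size_Mmonic ?monicXn // size_polyXn addnS /= => h; rewrite nth_default //.
have lej : (j <= m)%N by rewrite -ltnS.
by rewrite -(leq_add2r (e i)) (leq_trans h) // -[X in (X < _)%N](subnKC lej) ltn_add2l.
Qed.

(** Generators of the leading forms lift to [N], and the lifts generate strictly by lowering
    degrees. The relations among leading forms are exactly the leading forms of relations among the
    lifts, so the induction goes on. *)
Lemma filtres_leading l a (d : 'I_a -> nat) (N : 'rV[R]_a -> Prop) : submod N ->
  gradres l d (leading d N) -> filtres l d N.
Proof.
elim: l a d N => [|l IH] a d N sN.
  move=> H u hu; have [m hm] := degle_exists d u.
  have z M : degle d M u -> hpart d M u = 0.
    move=> homogM; rewrite -[RHS](@hpart0 K n.+1 a d M) -(H (hpart d M u)) ?(hpart_ishomog (ishomog_hpart d M u)) //.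
    move=> M'; have [->|ne] := eqVneq M' M; first by exists u; rewrite (hpart_ishomog (ishomog_hpart d M u)).
    exists 0; rewrite hpart0 (hpart_homog0 (ishomog_hpart d M u) ne); split=> //; first by case: sN.
    exact: ksubspace0 (ksubspace_degle _ _ d M').
  have zz M : degle d M u -> forall e, hpart d e u = 0.
    elim: M => [|M IHM] h e.
      case: e => [|e]; first exact: z.
      by move/degleP: h; apply.
    apply: IHM; apply/degleP => e'; rewrite leq_eqVlt => /orP[/eqP<-|lt]; first exact: z.
    by move/degleP: h; apply.
  by rewrite (degle_sum_hpart hm) big1 // => i _; apply: zz hm _.
move=> [b [e [V [V1 V2 V3 V4]]]].
have [U hU] := @rows_exist R b a (fun i u => [/\ N u, degle d (e i) u & hpart d (e i) u = row i V])
  (fun i => let: ex_intro u (And3 h1 h2 h3) := V1 i (e i) in ex_intro _ u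
    (And3 h1 h2 (etrans h3 (hpart_ishomog (V2 i))))).
have NU i : N (row i U) by case: (hU i).
have UV i : hpart d (e i) (row i U) = row i V by case: (hU i).
have bU : degleM d e U by move=> i; case: (hU i).
have gU m u : N u -> degle d m u -> exists r, u = r *m U /\ degle e m r.
  move=> hu hm.
  have step M w : N w -> degle d M w -> exists r, [/\ degle e M r & hpart d M (w - r *m U) = 0].
    move=> ishomog homogM; have [|r hr] := V3 (hpart d M w).
      move=> M'; have [->|ne] := eqVneq M' M; first by exists w; rewrite (hpart_ishomog (ishomog_hpart d M w)).
      exists 0; rewrite hpart0 (hpart_homog0 (ishomog_hpart d M w) ne); split=> //; first by case: sN.
      exact: ksubspace0 (ksubspace_degle _ _ d M').
    exists (hpart e M r); split; first exact/ishomog_degle/ishomog_hpart.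
    rewrite hpartD hpartN (hpart_mul_top V2 bU UV) ?(hpart_ishomog (ishomog_hpart e M r)); last exact/ishomog_degle/ishomog_hpart.
    by rewrite -(hpart_mul _ _ V2) -hr (hpart_ishomog (ishomog_hpart d M w)) subrr.
  elim: m u hu hm => [|m IHm] u hu hm; have [r [r1 r2]] := step _ _ hu hm.
    exists r; split=> //; apply/eqP; rewrite -subr_eq0; apply/eqP.
    have h : degle d 0 (u - r *m U) by apply: ksubspaceB (ksubspace_degle _ _ d 0) hm _; apply: degle_mul bU r1.
    by rewrite (degle_sum_hpart h) big_ord1.
  have [||s [s1 s2]] := IHm (u - r *m U).
  - by apply: submodB => //; apply: submod_lin.
  - have h : degle d m.+1 (u - r *m U) by apply: ksubspaceB (ksubspace_degle _ _ d _) hm _; apply: degle_mul bU r1.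
    apply/degleP => e'; rewrite leq_eqVlt => /orP[/eqP<-|lt] //.
    by move/degleP: h; apply.
  exists (s + r); rewrite mulmxDl -s1 subrK; split=> //.
  by apply: ksubspaceD (ksubspace_degle _ _ e _) _ r1; apply: degle_leq s2.
exists b, e, U; split=> //; apply: IH; first exact: submod_ker.
apply: gradres_ext V4 => s; split=> [h M|h]; last first.
  have [m hm] := degle_exists (fun=> 0%N) (s *m V).
  have H M : hpart e M s *m V = 0.
    have [r [r1 r2 <-]] := h M; rewrite -(hpart_mul_top V2 bU UV) // r1.
    by apply/rowP => j; rewrite hpartE !mxE rmorph0 mulr0 coef0.
  by have [m' hm'] := degle_exists e s; rewrite (degle_sum_hpart hm') mulmx_suml big1.
(* The part of [s] in degree [M] maps to degree below [M]. Strictness rewrites this image with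
   coefficients of lower degree; subtracting them gives a true relation with the same leading
   part. *)
have hs : degle e M (hpart e M s) by apply/ishomog_degle/ishomog_hpart.
have c0 : hpart d M (hpart e M s *m U) = 0.
  rewrite (hpart_mul_top V2 bU UV) // (hpart_ishomog (ishomog_hpart e M s)) -(hpart_mul _ _ V2) h.
  exact: hpart0.
have hN : N (hpart e M s *m U) by apply: submod_lin.
have hd : degle d M (hpart e M s *m U) by apply: degle_mul bU hs.
case: M hs c0 hN hd => [|M] hs c0 hN hd.
  exists (hpart e 0 s); rewrite (hpart_ishomog (ishomog_hpart e 0 s)); split=> //.
  by rewrite (degle_sum_hpart hd) big_ord1.
have [|r [r1 r2]] := gU M _ hN.
  apply/degleP => e'; rewrite leq_eqVlt => /orP[/eqP<-|lt] //.
  by move/degleP: hd; apply.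
exists (hpart e M.+1 s - r); rewrite mulmxBl -r1 subrr hpartD hpartN (hpart_ishomog (ishomog_hpart e M.+1 s)).
split=> //; first by apply: ksubspaceB (ksubspace_degle _ _ e _) hs _; apply: degle_leq r2.
by move/degleP: r2 => -> //; rewrite subr0.
Qed.

Lemma filtres_exists a (d : 'I_a -> nat) (N : 'rV[R]_a -> Prop) : submod N -> filtres n.+2 d N.
Proof. by move=> sN; apply: filtres_leading => //; apply/gradres_exists/gsubmod_leading. Qed.
End Filtered.
End Resolutions.

(** * Vanishing of the coefficient of t^(p+1) *)

Section Vanishing.
Variables (K : fieldType) (T : K) (p : nat).
Hypotheses (p_pr : prime p) (p_odd : odd p).
Hypothesis T_pow : forall d (t : K), t ^+ p = T ^+ d -> (p %| d)%N.
Local Notation R := (ipoly K p.+1).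
Local Notation io := (ipolyC K p.+1).
Local Notation F := (towerF T p p).
Local Notation q := (p ^ p)%N.
Local Notation tinv := (tinv T p).

Definition rowspan a b (B : 'M[R]_(a, b)) (u : 'rV_b) := exists r, u = r *m B.

Definition wjoin a b (d : 'I_a -> nat) (e : 'I_b -> nat) (i : 'I_(a + b)) :=
  match split i with inl j => d j | inr j => e j end.

Lemma degle_join a b (d : 'I_a -> nat) (e : 'I_b -> nat) m (u : 'rV[R]_(a + b)) :
  degle (wjoin d e) m u <-> degle d m (lsubmx u) /\ degle e m (rsubmx u).
Proof.
split=> [h|[h1 h2] j].
  split=> j; rewrite mxE; first by have := h (lshift b j); rewrite /wjoin -/(unsplit (inl j)) unsplitK.
  by have := h (rshift a j); rewrite /wjoin -/(unsplit (inr j)) unsplitK.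
case: (split_ordP j) => i ->; rewrite /wjoin.
  by rewrite -/(unsplit (inl i)) unsplitK; have := h1 i; rewrite mxE.
by rewrite -/(unsplit (inr i)) unsplitK; have := h2 i; rewrite mxE.
Qed.

Lemma filtres_pad l a b (d : 'I_a -> nat) (e : 'I_b -> nat) N : filtres l d N ->
  filtres l (wjoin d e) (fun u : 'rV[R]_(a + b) => N (lsubmx u) /\ rsubmx u = 0).
Proof.
case: l => [|l]; first by move=> h u [/h h1 h2]; rewrite -[u]hsubmxK h1 h2 row_mx0.
move=> [c [f [U [h1 h2 h3 h4]]]]; exists c, f, (row_mx U 0).
have rE i : row i (row_mx U (0 : 'M[R]_(c, b))) = row_mx (row i U) 0 by rewrite row_row_mx row0.
split=> [i|i|m u [hu hr] /degle_join [hd _]|].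
- by rewrite rE row_mxKl row_mxKr.
- rewrite rE; apply/degle_join; rewrite row_mxKl row_mxKr; split=> //.
  exact: ksubspace0 (ksubspace_degle _ _ _ _).
- have [r [r1 r2]] := h3 m _ hu hd; exists r; split=> //.
  by rewrite mul_mx_row mulmx0 -r1 -hr hsubmxK.
- apply: filtres_ext h4 => r; rewrite mul_mx_row mulmx0; split=> [->|]; first by rewrite row_mx0.
  by move/(congr1 (@lsubmx _ _ _ _)); rewrite row_mxKl linear0.
Qed.

Lemma euler_poly_tower_scale a k : (euler_poly p ((F ^+ k)%:M : 'M_a))`_p.+1 = 0.
Proof.
apply: (euler_poly_weights p_pr p_odd T_pow (S := 1%:M) (k := k) (d := fun=> 0%N) (e := fun=> (k * q)%N)).
- move=> i; apply/degle_entry => j; rewrite !mxE; case: eqP => _; last by left.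
  right; rewrite mulr1n towerFX_hom size_Cmul ?FX_neq0 // size_polyXn; exact: leqnn.
- move=> i; apply/degle_entry => j; rewrite !mxE; case: eqP => _; last by left.
  by right; rewrite rmorph1 size_poly1 addn1 add0n.
- by rewrite mul1mx.
Qed.

(** [S] writes F^k times the standard basis in terms of the generators [U]; strictness of the
    resolution gives it the degrees d_i + k q without loss. *)
Lemma rowspan_generators l a (d : 'I_a -> nat) (B B' : 'M[R]_a) k : B' *m B = (F ^+ k)%:M ->
  filtres l.+1 d (rowspan B) -> exists c (e : 'I_c -> nat) (U V : 'M[R]_(c, a)) (t S : 'M[R]_(a, c)),
    [/\ degleM d e U, degleM e (fun i => d i + k * q)%N S, U = V *m B, B = t *m U & S *m U = (F ^+ k)%:M] /\
    (forall m u, rowspan B u -> degle d m u -> exists r, u = r *m U /\ degle e m r) /\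
    filtres l e (fun r => r *m U = 0).
Proof.
move=> hB [c [e [U [U1 U2 U3 U4]]]]; exists c, e, U.
have [V hV] := rows_exist U1; exists V.
have [t ht] : exists t : 'M[R]_(a, c), forall i, row i B = row i t *m U.
  apply: (@rows_exist _ a c (fun i r => row i B = r *m U)) => i.
  have [m hm] := degle_exists d (row i B).
  by have [|r [hr _]] := U3 m (row i B) _ hm; [exists (delta_mx 0 i); rewrite -rowE|exists r].
have [S hS] : exists S : 'M[R]_(a, c), forall i,
    row i S *m U = F ^+ k *: delta_mx 0 i /\ degle e (d i + k * q)%N (row i S).
  apply: (@rows_exist _ a c (fun i r => r *m U = F ^+ k *: delta_mx 0 i /\ degle e (d i + k * q)%N r)) => i.
  have [||r [hr1 hr2]] := U3 (d i + k * q)%N (F ^+ k *: delta_mx 0 i); last by exists r.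
    exists (row i B'); rewrite -row_mul hB; apply/rowP => j; rewrite !mxE eqxx /=.
    by rewrite mulr_natr eq_sym.
  apply/degle_entry => j; rewrite !mxE eqxx /=; case: eqP => [->|_]; last by left; rewrite mulr0.
  right; rewrite mulr1 towerFX_hom size_Cmul ?FX_neq0 // size_polyXn addnS; exact: leqnn.
exists t, S; split; last by split.
split=> //.
- by move=> i; case: (hS i).
- by apply/row_matrixP => i; rewrite row_mul.
- by apply/row_matrixP => i; rewrite row_mul.
- apply/row_matrixP => i; rewrite row_mul; case: (hS i) => -> _.
  by apply/rowP => j; rewrite !mxE eqxx /= eq_sym mulr_natr.
Qed.

(** Induction on the length. If only one term is left, [U] is injective, agrees with [B] up to an
    invertible factor and has controlled degrees. Otherwise B B' = F^k makes the coefficients of [B]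
    and B' opposite, and [euler_poly_1pXY] replaces B' by [Bs], which has a shorter resolution. *)
Lemma euler_poly_resolution l a (d : 'I_a -> nat) (B : 'M[R]_a) : tinv B -> filtres l.+1 d (rowspan B) ->
  (euler_poly p B)`_p.+1 = 0.
Proof.
elim: l a d B => [|l IH] a d B fB hN; have [k [B' BB']] := fB; have B'B := tinv_comm p_pr BB';
have [c [e [U [V [t [S [[U2 S2 UV tU SU] [U3 U4]]]]]]]] := rowspan_generators B'B hN.
all: have tV : t *m V = 1%:M
  by apply/eqP; rewrite -subr_eq0; apply/eqP/row_matrixP => i; rewrite row0;
     apply: (tinv_inj p_pr fB); rewrite -row_mul mulmxBl mul1mx -mulmxA -UV -tU subrr row0.
all: have SV : S *m V = B'
  by apply/eqP; rewrite -subr_eq0; apply/eqP/row_matrixP => i; rewrite row0;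
     apply: (tinv_inj p_pr fB); rewrite -row_mul mulmxBl -mulmxA -UV SU B'B subrr row0.
  have Vt : V *m t = 1%:M.
    apply/eqP; rewrite eq_sym -subr_eq0; apply/eqP/row_matrixP => i; rewrite row0; apply: U4.
    by rewrite -row_mul mulmxBl mul1mx -mulmxA -tU UV subrr row0.
  have ac : a = c.
    by apply/eqP; rewrite eqn_leq (mulmx1_min tV) (mulmx1_min Vt).
  subst c; have fU : tinv U by exists k, S; apply: tinv_comm.
  rewrite tU (euler_polyM p_pr p_odd T_pow (tinv_unit T p tV) fU) (euler_poly_unit p_pr p_odd T_pow Vt) add0r.
  exact: (euler_poly_weights p_pr p_odd T_pow U2 S2 SU).
have fB' : tinv B' by exists k, B.
(* The row space of [Bs] is [ker U + R^a S], and its resolution starts one step later in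
   that of [B]; moreover [1 + (S - t) V = B']. *)
pose Bs : 'M_c := 1%:M + V *m (S - t).
have B'E : 1%:M + (S - t) *m V = B' by rewrite mulmxBl SV tV addrC subrK.
have StVB : (S - t) *m V *m B = (F ^+ k)%:M - B by rewrite mulmxBl SV tV mulmxBl B'B mul1mx.
have fBs : tinv Bs.
  exists k, ((F ^+ k)%:M - V *m B *m (S - t)).
  rewrite /Bs; move: (S - t) StVB => Y hY.
  have -> : (1%:M + V *m Y) *m ((F ^+ k)%:M - V *m B *m Y) =
      (F ^+ k)%:M - V *m B *m Y + (F ^+ k *: (V *m Y) - V *m (Y *m V *m B) *m Y).
    by rewrite mulmxDl mul1mx mulmxBr mul_mx_scalar !mulmxA.
  by rewrite hY mulmxBr mul_mx_scalar mulmxBl -scalemxAl opprB [X in _ + X]addrCA subrr addr0 subrK.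
have GBs : euler_poly p Bs = euler_poly p B'.
  by rewrite -B'E; apply: (euler_poly_1pXY p_pr p_odd T_pow) => //; rewrite B'E.
have : (euler_poly p (B *m B'))`_p.+1 = 0 by rewrite BB' euler_poly_tower_scale.
rewrite (euler_polyM p_pr p_odd T_pow fB fB') coefD -GBs (IH c e Bs fBs) ?addr0 //.
have [b [f [U' [W1 W2 W3 W4]]]] := U4.
exists (b + a)%N, (wjoin f (fun i => d i + k * q)%N), (col_mx U' S).
have kerV (s : 'rV_c) : s *m U = 0 -> s *m V = 0.
  by rewrite UV mulmxA; apply: (tinv_inj p_pr fB).
have spanE (s : 'rV_c) (w : 'rV_a) : s *m U = 0 -> rowspan Bs (s + w *m S).
  move=> /kerV hs; exists (s + w *m t); rewrite mulmxDr mulmx1 mulmxA mulmxDl hs -mulmxA tV mulmx1 add0r.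
  by rewrite mulmxBr addrA addrAC addrK.
split=> [i|i|m u [r hr] hd|].
- case: (split_ordP i) => j ->; rewrite ?rowKu ?rowKd.
    by rewrite -[row j U']addr0 -(mul0mx _ S); apply: spanE.
  by rewrite -[row j S]add0r rowE; apply: spanE; rewrite mul0mx.
- case: (split_ordP i) => j ->; rewrite /wjoin ?rowKu ?rowKd.
    by rewrite -/(unsplit (inl j)) unsplitK.
  by rewrite -/(unsplit (inr j)) unsplitK.
- pose w := r *m V; pose s := r - w *m t.
  have hs : s *m U = 0 by rewrite mulmxBl -!mulmxA -tU -UV subrr.
  have uE : u = s + w *m S.
    by rewrite hr mulmxDr mulmx1 mulmxA mulmxBr addrA [RHS]addrAC.
  have hw' : degle (fun i => d i + k * q)%N m w.
    apply/(degle_hom _ _ _ (FX_neq0 T p_pr p k) (towerFX_hom T p p k)).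
    by have := degle_mul U2 hd; rewrite uE mulmxDl hs add0r -mulmxA SU mul_mx_scalar.
  have hs' : degle e m s.
    have -> : s = u - w *m S by rewrite uE addrK.
    by apply: ksubspaceB (ksubspace_degle _ _ e m) hd _; apply: degle_mul S2 hw'.
  have [r' [r1 r2]] := W3 m s hs hs'.
  exists (row_mx r' w); split; first by rewrite mul_row_col -r1.
  by apply/degle_join; rewrite row_mxKl row_mxKr.
- apply: filtres_ext (filtres_pad (fun i => d i + k * q)%N W4) => u; rewrite -{3}[u]hsubmxK mul_row_col.
  split=> [[-> ->]|h]; first by rewrite mul0mx addr0.
  (* Applying [U] kills the rows of U' and turns those of [S] into F^k times the standard basis, so
     no relation involves [S]: the resolution has lost a term. *)
  have u0 : rsubmx u = 0.
    have h2 : rsubmx u *m (F ^+ k)%:M = 0.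
      have U'U : U' *m U = 0 by apply/row_matrixP => i; rewrite row_mul row0.
      by have := congr1 (mulmx^~ U) h; rewrite mulmxDl -!mulmxA U'U mulmx0 add0r mul0mx SU.
    by move: h2; rewrite mul_mx_scalar => /eqP; rewrite scalemx_eq0 (negbTE (FX_neq0 T p_pr p k)) => /eqP.
  by move: h; rewrite u0 mul0mx addr0.
Qed.

Lemma euler_poly_vanish a (B : 'M[R]_a) : tinv B -> (euler_poly p B)`_p.+1 = 0.
Proof.
move=> fB; apply: (@euler_poly_resolution p.+1 a (fun=> 0%N)) => //; apply: filtres_exists.
split; first by exists 0; rewrite mul0mx.
by move=> r _ _ [x ->] [y ->]; exists (r *: x + y); rewrite mulmxDl scalemxAl.
Qed.
End Vanishing.

(** Expanding one factor F_(j-1) of F_(j-1)^p in the variables exhibits F_j in the ideal of x_0,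
    ..., x_j. The cofactors are homogeneous of degree p^j - 1, which the weights [kw] rely on. *)
Fixpoint tower_cofactor p (S : comNzRingType) (t : S) (x : nat -> S) j i : S :=
  if j is j'.+1 then tower p t x j' ^+ p.-1 * tower_cofactor p t x j' i +
    (i == j)%:R * (t * x i ^+ (p ^ j).-1)
  else (i == 0%N)%:R.

Lemma tower_cofactorE p (S : comNzRingType) (t : S) (x : nat -> S) m j : (0 < p)%N -> (j <= m)%N ->
  \sum_(i < m.+1) x i * tower_cofactor p t x j i = tower p t x j.
Proof.
move=> p0; elim: j => [|j IH] le.
  by rewrite big_ord_recl /= mulr1n mulr1 big1 ?addr0 // => i _; rewrite mulr0n mulr0.
have -> : tower p t x j.+1 = tower p t x j ^+ p.-1 * (\sum_(i < m.+1) x i * tower_cofactor p t x j i) +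
    t * x j.+1 ^+ (p ^ j.+1) by rewrite (IH (ltnW le)) -exprSr prednK.
rewrite mulr_sumr [LHS](eq_bigr (fun i : 'I_m.+1 => tower p t x j ^+ p.-1 * (x i * tower_cofactor p t x j i) +
   (i == j.+1 :> nat)%:R * (t * x i ^+ (p ^ j.+1)))); last first.
  move=> i _; rewrite mulrDr mulrCA; congr (_ + _); case: eqP => _; last by rewrite mulr0n !mul0r mulr0.
  by rewrite mulr1n !mul1r mulrCA -exprS prednK // expn_gt0 p0.
rewrite big_split /=; congr (_ + _).
rewrite (bigD1 (Ordinal (le : (j.+1 < m.+1)%N))) //= eqxx mulr1n mul1r big1 ?addr0 // => i ne.
by rewrite (_ : (_ == _) = false) ?mulr0n ?mul0r //; apply/negbTE.
Qed.

(** * Clifford multiplication and completion of the row x *)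

Section Completion.
Variables (K : fieldType) (T : K) (p : nat).
Hypotheses (p_pr : prime p) (p_odd : odd p).
Hypothesis T_pow : forall d (t : K), t ^+ p = T ^+ d -> (p %| d)%N.
Local Notation R := (ipoly K p.+1).
Local Notation io := (ipolyC K p.+1).
Local Notation F := (towerF T p p).
Local Notation q := (p ^ p)%N.
Local Notation tinv := (tinv T p).
Local Notation commensurable := (commensurable T p).

Lemma tower_cofactor_hom j i : (j <= p)%N -> let w := tower_cofactor p (io T) (ipolyX K p.+1) j i in
  homogenize K p.+1 w = w%:P * 'X^((p ^ j).-1).
Proof.
have p0 := prime_gt0 p_pr.
elim: j => [|j IH] le.
  by rewrite /=; case: eqP => _; rewrite ?rmorph1 ?rmorph0 ?expn0 ?expr0 ?mulr1 // mul0r.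
have e1 : (p ^ j * p.-1 + (p ^ j).-1 = (p ^ j.+1).-1)%N.
  apply/eqP; rewrite -eqSS -addnS !prednK ?expn_gt0 ?p0 //.
  by rewrite expnSr addnC -mulnS prednK.
have {}IH := IH (ltnW le); cbv zeta in IH |- *.
have -> : tower_cofactor p (io T) (ipolyX K p.+1) j.+1 i =
    tower p (io T) (ipolyX K p.+1) j ^+ p.-1 * tower_cofactor p (io T) (ipolyX K p.+1) j i +
    (i == j.+1)%:R * (io T * ipolyX K p.+1 i ^+ (p ^ j.+1).-1) by [].
move: (tower_cofactor _ _ _ j i) IH => w ishomog.
rewrite [homogenize _ _ _]rmorphD [homogenize _ _ (_ * w)]rmorphM [homogenize _ _ (_ ^+ p.-1)]rmorphXn (tower_hom T _ (ltnW le)) ishomog polyCD mulrDl; congr (_ + _).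
  by rewrite exprMn -exprM -rmorphXn mulrACA -exprD e1 -polyCM.
case: eqP => [->|_]; last by rewrite mulr0n !mul0r rmorph0.
rewrite mulr1n !mul1r [homogenize _ _ _]rmorphM [homogenize _ _ (_ ^+ _)]rmorphXn homogenizeX // homogenizeC.
by rewrite exprMn mulrA -rmorphXn -polyCM.
Qed.

(** [L] raises degrees by b q, half the degree of its square F^(2 b), so it is strict and the
    invariant is a difference of Hilbert functions. *)
Lemma euler_involution N (A A' : pred nat) (L : 'M[R]_(extdim N)) b (w : 'I_(extdim N) -> nat) :
  (forall u, wsupp A u -> wsupp A' (u *m L)) -> (forall u, wsupp A' u -> wsupp A (u *m L)) ->
  degleM w (fun I => w I + b * q)%N L -> L *m L = (F ^+ (2 * b))%:M ->
  commensurable (@wsupp K p A N) (rowimg (@wsupp K p A' N) L) /\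
  exists m0, forall m, (m0 <= m)%N ->
  euler p (@wsupp K p A N) (rowimg (@wsupp K p A' N) L) + (\sum_(I | A' (extwt I)) hdim p.+1 m (w I + b * q)%N)%:R
    = (\sum_(I : 'I_(extdim N) | A (extwt I)) hdim p.+1 m (w I))%:R.
Proof.
move=> hA hA' hL LL; have fL : tinv L by exists (2 * b)%N, L.
have aU : commensurable (@wsupp K p A N) (rowimg (@wsupp K p A' N) L).
  split; [exact: submod_wsupp|apply/submod_rowimg/submod_wsupp|by move=> u [v [/hA' homv ->]]|].
  by exists (2 * b)%N => u hu; exists (u *m L); rewrite -mulmxA LL mul_mx_scalar; split=> //; apply: hA.
split=> //.
have [m0 H0] := eulerW p_pr p_odd T_pow w (tinv1 T p p (extdim N)) aU.
exists m0 => m le; have [r hr] := commensurable_fdim p_pr w m (tinv1 T p p (extdim N)) aU.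
rewrite -(H0 m le r hr) -natrD; congr _%:R.
have k0 := ksubspace_zerov io (extdim N).
have sI := submod_rowimg L (submod_wsupp K p A' N).
apply: (reldim_uniq k0 _ (reldim_wsupp_degle K p w A m)).
apply: (reldim_add (Q := fun u => rowimg (@wsupp K p A' N) L u /\ degle w m u) k0).
- by move=> u [hu hd]; split=> //; case: aU => _ _ h12 _; apply: h12.
- by move=> u ->; split; [case: sI|apply: ksubspace0 (ksubspace_degle _ _ _ _)].
- by apply: ksubspaceI; [apply: submod_ksubspace|apply: ksubspace_degle].
- by apply: reldim_ext hr => u; rewrite mulmx1.
apply: (reldim_map (phi := fun u => u *m L)) (reldim_wsupp_degle K p (fun I => w I + b * q)%N A' m).
- by move=> c u v; rewrite mulmxDl scalemxAl.
- exact: k0.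
- by move=> u [hs hd]; split; [exists u|apply: degle_mul hL hd].
- by move=> u ->; rewrite /zerov mul0mx.
- by move=> d' c B _; apply: (tinv_inj p_pr fL).
- move=> _ [[u [hs ->]] hd]; exists u; split; last by rewrite /zerov subrr.
  split=> //; have := degle_mul hL (proj2 (degle_shift w m (b * q) _) hd).
  rewrite -mulmxA LL mul_mx_scalar.
  move/(degle_hom _ _ _ (FX_neq0 T p_pr p _) (towerFX_hom T p p _)) => h.
  apply/(degle_shift _ m (b * q)); apply: degle_lew h => I.
  by rewrite -addnA leq_add2l -mulnDl mul2n addnn.
Qed.

Lemma alternating_subsets (S : comNzRingType) N (y z : S) :
  \sum_(I : 'I_(extdim N)) (y ^+ (N - extwt I) * z ^+ extwt I) = (y + z) ^+ N.
Proof.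
elim: N => [|N IH]; first by rewrite [LHS]big_ord_recl [X in _ + X]big_ord0 /= !expr0 mulr1 addr0.
rewrite [LHS]big_split_ord /= exprS -IH mulr_sumr -big_split; apply: eq_bigr => I _ /=.
rewrite -!/(unsplit (inl I)) -!/(unsplit (inr I)) !unsplitK subSS subSn ?extwt_leq // !exprS.
ring.
Qed.

Section Kappa.
Variables (e x : 'rV[R]_p.+1) (w0 : 'cV[R]_p.+1) (B : 'M[R]_p.+1).
Hypotheses (fB : tinv B) (eB : e *m B = F *: x) (Bw : B *m w0 = F ^+ 2 *: e^T).
Hypotheses (ee : (e *m e^T) 0 0 = 1) (xw : (x *m w0) 0 0 = F).
Hypothesis hx : forall i, homogenize K p.+1 (x 0 i) = (x 0 i)%:P * 'X.
Hypothesis homog0 : forall i, homogenize K p.+1 (w0 i 0) = (w0 i 0)%:P * 'X^(q.-1).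
Local Notation N := p.+1.

(* The Clifford multiplications [x + w0] and [e + e^T], which exchange parities. *)
Definition kappa : 'M[R]_(extdim N) := wedge (F ^+ 3 *: x) + contr w0.
Definition kappa0 : 'M[R]_(extdim N) := wedge e + contr e^T.

Lemma kappa_sq : kappa *m kappa = (F ^+ (2 * 2))%:M.
Proof.
rewrite /kappa mulmxDl !mulmxDr wedge_sq contr_sq add0r addr0 wedge_contr.
by rewrite -scalemxAl mxE xw -exprSr.
Qed.

Lemma kappa0_sq : kappa0 *m kappa0 = 1%:M.
Proof. by rewrite /kappa0 mulmxDl !mulmxDr wedge_sq contr_sq add0r addr0 wedge_contr ee. Qed.

(** The factor F^3 in [kappa] is chosen so that both summands acquire the same scalar F^2. *)
Lemma ext_kappa : ext B *m kappa = F ^+ 2 *: (kappa0 *m ext B).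
Proof.
have contrZ c (u : 'cV[R]_N) : contr (c *: u) = c *: contr u.
  have c0 : contr (0 : 'cV[R]_N) = 0.
    by have := contrD (-1) (0 : 'cV[R]_N) 0; rewrite scaleN1r oppr0 addr0 scaleN1r addNr.
  by have := contrD c u 0; rewrite c0 !addr0.
rewrite mulmxDr mulmxDl scalerDr ext_wedge eB ext_contr Bw contrZ -!scalemxAl; congr (_ + _).
by rewrite !wedgeZ -!scalemxAr scalerA -exprSr.
Qed.

Lemma parity_swap (L : 'M[R]_(extdim N)) :
  (forall I J, L I J = 0 \/ odd (extwt J) = ~~ odd (extwt I)) ->
  (forall u, wsupp odd u -> wsupp (fun i => ~~ odd i) (u *m L)) /\
  (forall u, wsupp (fun i => ~~ odd i) u -> wsupp odd (u *m L)).
Proof.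
move=> h; split=> u hu J hJ; rewrite mxE big1 // => I _.
  have [->|e1] := h I J; first by rewrite mulr0.
  by rewrite hu ?mul0r //; move: hJ; rewrite negbK e1.
have [->|e1] := h I J; first by rewrite mulr0.
by rewrite hu ?mul0r //; move: hJ; rewrite e1.
Qed.

Lemma wedge_contr_parity (u : 'rV[R]_N) (v : 'cV[R]_N) I J :
  (wedge u + contr v) I J = 0 \/ odd (extwt J) = ~~ odd (extwt I).
Proof.
rewrite mxE; have [->|[-> _]] := wedge_entry u I J; last by right.
have [->|[-> _]] := contr_entry v I J; last by right; rewrite /= negbK.
by left; rewrite addr0.
Qed.

(** The slope 1 + q balances the two summands of [kappa]: wedging has entries of degree 3 q + 1 and
    contracting q - 1, and after the change of weight both raise degrees by 2 q. *)
Definition kw (I : 'I_(extdim N)) := ((1 + q) * (N - extwt I))%N.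

Lemma kappa_degleM : degleM kw (fun I => kw I + 2 * q)%N kappa.
Proof.
have q0 : (0 < q)%N by rewrite expn_gt0 prime_gt0.
have sgnE s (f : R) d : homogenize K N f = f%:P * 'X^d -> (size (homogenize K N ((-1) ^+ s * f))%R <= d.+1)%N.
  move=> hf; rewrite rmorphM rmorphXn rmorphN rmorph1 hf mulrA -(rmorphN1 polyC) -rmorphXn -polyCM.
  by apply: leq_trans (size_polyMleq _ _) _; rewrite size_polyXn addnS /= size_polyC; case: eqP.
move=> I; rewrite /kappa linearD /=; apply: ksubspaceD (ksubspace_degle _ _ kw _) _ _; apply/degle_entry => J; rewrite mxE.
  have [|[e1 [s [l ->]]]] := wedge_entry (F ^+ 3 *: x) I J; first by left.
  right; rewrite mxE; apply: leq_trans (leq_add (leqnn _) (sgnE s _ (3 * q + 1)%N _)) _.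
    by rewrite rmorphM towerFX_hom hx mulrACA -exprSr addn1 -polyCM.
  have le := extwt_leq J; rewrite /kw e1 in le *.
  by rewrite addnS ltnS -(subnSK le) mulnS; lia.
have [|[e1 [s [l ->]]]] := contr_entry w0 I J; first by left.
right; apply: leq_trans (leq_add (leqnn _) (sgnE s _ _ (homog0 l))) _.
have le := extwt_leq I; rewrite /kw e1 in le *.
by rewrite prednK // -(subnSK le) mulnS; lia.
Qed.

(** Two chains descend from the odd part to the same submodule, one through [kappa] and [ext B] on
    the even part, the other through F^2 and [ext B] on the odd part. Comparing them shows that the
    even [delta] exceeds the odd one by 1, but this difference is the coefficient that vanishes. *)
Lemma kappa_absurd : False.
Proof.
have hB : (euler_poly p B)`_N = 0 by exact: (euler_poly_vanish p_pr p_odd T_pow fB).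
have [kE kO] := parity_swap (wedge_contr_parity (F ^+ 3 *: x) w0).
have [k0E k0O] := parity_swap (wedge_contr_parity e e^T).
pose od : pred nat := odd; pose ev : pred nat := fun i => ~~ odd i.
have [a1 [m1 H1]] := euler_involution (A := od) (A' := ev) kE kO kappa_degleM kappa_sq.
pose L := (F ^+ 2)%:M : 'M[R]_(extdim N).
have Ls A u : @wsupp K p A N u -> wsupp A (u *m L).
  by move=> hu; rewrite mul_mx_scalar; apply: (submodZ (S := @wsupp K p A N)) => //; apply: submod_wsupp.
have LL : L *m L = (F ^+ (2 * 2))%:M by rewrite /L -scalar_mxM -exprD.
have bL : degleM kw (fun I => kw I + 2 * q)%N L.
  move=> I; apply/degle_entry => J; rewrite !mxE; case: eqP => [->|_]; last by left.
  by right; rewrite mulr1n towerFX_hom size_Cmul ?FX_neq0 // size_polyXn addnS.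
have [a2 [m2 H2]] := euler_involution (A := od) (A' := od) (Ls od) (Ls od) bL LL.
have fX := tinv_ext p_pr fB.
have fL : tinv L by exists 2%N, 1%:M; rewrite mulmx1.
have fk : tinv kappa by exists (2 * 2)%N, kappa; exact: kappa_sq.
have dE : euler p (@wsupp K p od N) (rowimg (@wsupp K p ev N) kappa) + delta p ev B =
    euler p (@wsupp K p od N) (rowimg (@wsupp K p od N) L) + delta p od B.
  have aev := commensurable_delta p_pr ev fB; have aod := commensurable_delta p_pr od fB.
  rewrite -[delta p ev B](euler_rowimg p_pr p_odd T_pow fk aev).
  rewrite -[delta p od B](euler_rowimg p_pr p_odd T_pow fL aod).
  rewrite -(euler_add p_pr p_odd T_pow a1 (commensurable_rowimg _ aev)).
  rewrite -(euler_add p_pr p_odd T_pow a2 (commensurable_rowimg _ aod)).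
  have ad : commensurable (@wsupp K p od N) (rowimg (rowimg (@wsupp K p ev N) (ext B)) kappa).
    have [s1 s2 i12 [k hk]] := a1; have [s3 s4 i34 [l hl]] := commensurable_rowimg kappa aev.
    split=> //; first by move=> u /i34 /i12.
    by exists (l + k)%N => u /hk /hl; rewrite scalerA -exprD.
  apply: (euler_ext p_pr p_odd T_pow ad) => // u.
  split=> [[_ [[v [homv ->]] ->]]|[_ [[v [homv ->]] ->]]].
    exists (v *m kappa0 *m ext B); split; first by exists (v *m kappa0); split=> //; apply: k0O.
    by rewrite /L mul_mx_scalar -[v *m ext B *m kappa]mulmxA ext_kappa -scalemxAr mulmxA.
  exists (v *m kappa0 *m ext B); split; first by exists (v *m kappa0); split=> //; apply: k0E.
  rewrite -[v *m kappa0 *m ext B *m kappa]mulmxA ext_kappa -scalemxAr mulmxA -[v *m kappa0 *m kappa0]mulmxA kappa0_sq mulmx1.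
  by rewrite /L mul_mx_scalar.

(* The numerator of the Hilbert series of the even part minus that of the odd part. The binomial
   theorem factors it as (1 - X)^N times a polynomial whose value at 1 is (1 + q)^N. *)
pose P : {poly 'F_p} := \sum_(I : 'I_(extdim N)) (-1) ^+ extwt I * 'X^(kw I + 2 * q).
have PE : P = (1 - 'X) ^+ N * ('X^(2 * q) * qint p (1 + q) ^+ N).
  rewrite mulrCA -exprMn -qintE -[in RHS]opprB exprNn -signr_odd /= p_odd expr0 mul1r.
  rewrite -alternating_subsets mulr_sumr; apply: eq_bigr => I _.
  by rewrite /kw addnC exprD [in LHS]exprM -[in LHS]exprM [X in _ * (_ * X)]exprM; ring.
have [m3 H3] := hilb_pow N 0 ('X^(2 * q) * qint p (1 + q) ^+ N).
have PV m : (m3 <= m)%N -> hilb N m P = 1.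
  move=> le; have := H3 m le; rewrite addn0 -PE => ->.
  rewrite /hilb; have := horner_coef ('X^(2 * q) * qint p (1 + q) ^+ N) 1.
  rewrite hornerM hornerXn expr1n mul1r horner_exp /qint horner_sum.
  rewrite (eq_bigr (fun=> 1)); last by move=> i _; rewrite hornerXn expr1n.
  (* As q is a power of p, 1 + q is 1 in F_p. *)
  rewrite sumr_const card_ord natrD natrX pchar_Fp_0 // expr0n gtn_eqF ?prime_gt0 //.
  rewrite addr0 expr1n => E; rewrite [RHS]E; by apply: eq_bigr => i _; rewrite expr1n bin0.
pose W := (\max_I (kw I + 2 * q))%N.
pose m := maxn (maxn m1 m2) (maxn m3 W).
have [le1 le2] : (m1 <= m)%N /\ (m2 <= m)%N.
  by split; rewrite /m !leq_max leqnn ?orbT.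
have [le3 leW] : (m3 <= m)%N /\ (W <= m)%N.
  by split; rewrite /m !leq_max leqnn ?orbT.
have {}PV := PV m le3.
have {}PE : hilb N m P = (\sum_(I : 'I_(extdim N) | ev (extwt I)) hdim N m (kw I + 2 * q))%:R -
    (\sum_(I : 'I_(extdim N) | od (extwt I)) hdim N m (kw I + 2 * q))%:R.
  rewrite /P (big_morph _ (hilbD N m) (hilb0 _ _ _)) (bigID (fun I => od (extwt I))) [LHS]addrC.
  rewrite !natr_sum -sumrN; congr (_ + _); apply: eq_big => // I /andP[_ hI].
    rewrite -signr_odd (negbTE (hI : ~~ odd (extwt I))) expr0 mul1r hilbXn /hdim (leq_trans _ leW) //.
    exact: (@leq_bigmax _ (fun I => kw I + 2 * q)%N).
  rewrite -signr_odd (hI : odd (extwt I)) expr1 mulN1r hilbN hilbXn /hdim (leq_trans _ leW) //.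
  exact: (@leq_bigmax _ (fun I => kw I + 2 * q)%N).
have dd : delta p ev B - delta p od B = 1.
  have h1 := H1 m le1; have h2 := H2 m le2; rewrite -h1 in h2.
  rewrite -PV PE; apply/eqP; rewrite subr_eq addrAC eq_sym subr_eq; apply/eqP.
  apply: (addrI (euler p (@wsupp K p od N) (rowimg (@wsupp K p ev N) kappa))).
  rewrite addrA -h2 addrA dE; ring.
(* [B] has size [N], so each (1 - X)^i X^(N-i) has degree [N] and leading coefficient (-1)^i. *)
have : (euler_poly p B)`_N = delta p ev B - delta p od B.
  rewrite (delta_sum p_pr p_odd T_pow ev fB) (delta_sum p_pr p_odd T_pow od fB).
  rewrite [X in _ = X - _]big_mkcond [X in _ = _ - X]big_mkcond -sumrB coef_sum.
  apply: eq_bigr => i _; rewrite coefCM /od /ev.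
  have -> : ((1 - 'X) ^+ i * 'X^(N - i) : {poly 'F_p})`_N = (-1) ^+ i.
    rewrite coefMXn ltnNge leq_subr /= subKn ?leq_ord //.
    have sz : size (1 - 'X : {poly 'F_p}) = 2 by rewrite -opprB size_polyN size_XsubC.
    have e1 : (size ((1 - 'X : {poly 'F_p}) ^+ i)).-1 = i by rewrite size_exp sz mul1n.
    by rewrite -[X in _`_X]e1 -lead_coefE lead_coef_exp lead_coefE sz coefB coefC coefX sub0r.
  case: (boolP (odd i)) => hi; rewrite -signr_odd ?hi ?(negbTE hi) /= ?expr1 ?expr0 ?mulr1 ?subr0 //.
  by rewrite sub0r mulrN1.
by rewrite hB dd => /eqP; rewrite eq_sym oner_eq0.
Qed.
End Kappa.

Theorem tower_row_not_completable (B B' : 'M[R]_p.+1) k i0 : B *m B' = (F ^+ k)%:M ->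
  (forall i, B i0 i = ipolyX K p.+1 i) -> False.
Proof.
move=> BB' hB; pose w := tower_cofactor p (io T) (ipolyX K p.+1) p.
have ishomog i : homogenize K p.+1 (w i) = (w i)%:P * 'X^(q.-1) by apply: tower_cofactor_hom.
have wE : F = \sum_(i < p.+1) ipolyX K p.+1 i * w i by rewrite tower_cofactorE // prime_gt0.
pose x : 'rV[R]_p.+1 := \row_i ipolyX K p.+1 i.
pose e : 'rV[R]_p.+1 := delta_mx 0 i0.
pose w0 : 'cV[R]_p.+1 := \col_i w i.
have eB : e *m B = x by rewrite -rowE; apply/rowP => i; rewrite !mxE.
have ee : (e *m e^T) 0 0 = 1.
  rewrite mxE (bigD1 i0) //= !mxE !eqxx mulr1 big1 ?addr0 // => i ne.
  by rewrite !mxE (negbTE ne) andbF mul0r.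
have eeM : e *m e^T = 1%:M by rewrite [LHS]mx11_scalar ee.
have xw : (x *m w0) 0 0 = F.
  by rewrite wE mxE; apply: eq_bigr => i _; rewrite !mxE.
have xwM : x *m w0 = F%:M by rewrite [LHS]mx11_scalar xw.
(* Since e z = 0, z e has square zero and [L] is invertible up to F^2. Passing to [L *m B] keeps the
   row [x] up to F and makes w0 map to F^2 e^T, as [kappa_absurd] requires. *)
pose z := B *m w0 - F *: e^T.
have ez : e *m z = 0 by rewrite mulmxBr mulmxA eB xwM -scalemxAr eeM scalemx1 subrr.
pose L := F%:M - z *m e.
have fL : tinv L.
  have zz : z *m e *m (z *m e) = 0 by rewrite mulmxA -(mulmxA z) ez mulmx0 mul0mx.
  exists 2%N, (F%:M + z *m e); rewrite mulmxBl !mulmxDr zz -scalar_mxM.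
  by rewrite mul_scalar_mx mul_mx_scalar addr0 addrK.
have fB : tinv B by exists k, B'.
apply: (@kappa_absurd e x w0 (L *m B)) => //.
- exact: tinvM.
- by rewrite mulmxA mulmxBr mul_mx_scalar [e *m (z *m e)]mulmxA ez mul0mx subr0 -scalemxAl eB.
- rewrite -mulmxA mulmxBl mul_scalar_mx -mulmxA [e *m (B *m w0)]mulmxA eB xwM mul_mx_scalar.
  by rewrite -scalerBr opprB addrC subrK scalerA.
- by move=> i; rewrite mxE homogenizeX ?ltn_ord.
- by move=> i; rewrite mxE ishomog.
Qed.
End Completion.

(** * Localizations of polynomial rings *)

Section Localization.
Variables (K : fieldType) (n : nat) (g : ipoly K n).
Local Notation R := (ipoly K n).
Local Notation Q := {fraction R}.
Local Notation fr := (@tofrac R).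

(** Subrings are boolean predicates, so membership is decided by excluded middle. *)
Definition locp (a : Q) : bool :=
  if excluded_middle_informative (exists k f, a * fr g ^+ k = fr f) then true else false.

Lemma locP a : reflect (exists k f, a * fr g ^+ k = fr f) (locp a).
Proof. by rewrite /locp; case: excluded_middle_informative => h; constructor. Qed.

Lemma locp_subring : subring_closed locp.
Proof.
split=> [|a b /locP [k [f hf]] /locP [l [h hh]]|a b /locP [k [f hf]] /locP [l [h hh]]].
- by apply/locP; exists 0%N, 1; rewrite expr0 mulr1 rmorph1.
- apply/locP; exists (k + l)%N, (f * g ^+ l - h * g ^+ k).
  by rewrite rmorphB !rmorphM !rmorphXn /= -hf -hh exprD mulrBl mulrA -!mulrA [fr g ^+ l * _]mulrC.
- by apply/locP; exists (k + l)%N, (f * h); rewrite rmorphM /= -hf -hh exprD mulrACA.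
Qed.
HB.instance Definition _ := GRing.isSubringClosed.Build Q locp locp_subring.

Record loc := Loc { locval : Q; locvalP : locval \in locp }.
HB.instance Definition _ := [isSub for locval].
HB.instance Definition _ := [Choice of loc by <:].
HB.instance Definition _ := [SubChoice_isSubComNzRing of loc by <:].

Lemma loc_in f : fr f \in locp.
Proof. by apply/locP; exists 0%N, f; rewrite expr0 mulr1. Qed.
Definition toloc f : loc := Loc (loc_in f).

Lemma toloc_zmod : zmod_morphism toloc.
Proof. by move=> x y; apply: val_inj; rewrite /= rmorphB. Qed.
Lemma toloc_monoid : monoid_morphism toloc.
Proof. by split=> [|x y]; apply: val_inj; rewrite /= ?rmorph1 ?rmorphM. Qed.
HB.instance Definition _ := GRing.isZmodMorphism.Build R loc toloc toloc_zmod.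
HB.instance Definition _ := GRing.isMonoidMorphism.Build R loc toloc toloc_monoid.

Definition loc_scale (c : K) (a : loc) : loc := toloc (ipolyC K n c) * a.
Lemma loc_scaleA a b v : loc_scale a (loc_scale b v) = loc_scale (a * b) v.
Proof. by rewrite /loc_scale !rmorphM mulrA. Qed.
Lemma loc_scale1 : left_id 1 loc_scale.
Proof. by move=> v; rewrite /loc_scale !rmorph1 mul1r. Qed.
Lemma loc_scaleDr : right_distributive loc_scale +%R.
Proof. by move=> a u v; rewrite /loc_scale mulrDr. Qed.
Lemma loc_scaleDl v : {morph loc_scale^~ v : a b / a + b}.
Proof. by move=> a b; rewrite /loc_scale !rmorphD mulrDl. Qed.
HB.instance Definition _ := GRing.Zmodule_isLmodule.Build K loc loc_scaleA loc_scale1 loc_scaleDr loc_scaleDl.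
Lemma loc_scaleAl (a : K) (u v : loc) : a *: (u * v) = (a *: u) * v.
Proof. exact: mulrA. Qed.
HB.instance Definition _ := GRing.Lmodule_isLalgebra.Build K loc loc_scaleAl.
HB.instance Definition _ := GRing.Lalgebra_isComAlgebra.Build K loc.
End Localization.

Definition is_loc (K : fieldType) n (g : ipoly K n) (A : comAlgType K) (iota : {rmorphism ipoly K n -> A}) :=
  [/\ forall c, iota (ipolyC K n c) = c%:A, injective iota, exists v, iota g * v = 1
    & forall a, exists k f, a * iota g ^+ k = iota f].

Lemma loc_exists (K : fieldType) n (g : ipoly K n) : g != 0 ->
  exists (A : comAlgType K) (iota : {rmorphism ipoly K n -> A}), is_loc g iota.
Proof.
move=> g0; exists (loc g), (toloc g); split.
- by move=> c; apply: val_inj; rewrite /= mulr1.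
- by move=> x y /(congr1 val) /= /eqP; rewrite tofrac_eq => /eqP.
- have homv : (tofrac g)^-1 \in locp g.
    by apply/locP; exists 1%N, 1; rewrite expr1 mulVf ?tofrac_eq0 // rmorph1.
  by exists (Loc homv); apply: val_inj; rewrite /= mulfV ?tofrac_eq0.
- move=> a; have /locP [k [f hf]] := valP a; exists k, f; apply: val_inj => /=.
  by rewrite -hf; congr (_ * _); elim: k {hf} => [//|k IH]; rewrite !exprS -IH.
Qed.

Lemma ipoly_hom_ext (K : fieldType) n (B : comNzRingType) (h1 h2 : {rmorphism ipoly K n -> B}) :
  (forall c, h1 (ipolyC K n c) = h2 (ipolyC K n c)) ->
  (forall i, (i < n)%N -> h1 (ipolyX K n i) = h2 (ipolyX K n i)) -> forall f, h1 f = h2 f.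
Proof.
move=> hC hX; elim/ipoly_ind => [//|//|f g IHf IHg|f g IHf IHg]; first by rewrite !rmorphD IHf IHg.
by rewrite !rmorphM IHf IHg.
Qed.

Section LocalizationTheory.
Variables (K : fieldType) (n : nat) (g : ipoly K n) (A : comAlgType K) (iota : {rmorphism ipoly K n -> A}).
Hypothesis hloc : is_loc g iota.
Local Notation R := (ipoly K n).

Let iC c : iota (ipolyC K n c) = c%:A. Proof. by case: hloc. Qed.
Let iI : injective iota. Proof. by case: hloc. Qed.
Let iG : exists v, iota g * v = 1. Proof. by case: hloc. Qed.
Let iF a : exists k f, a * iota g ^+ k = iota f. Proof. by case: hloc. Qed.

Lemma gX_inj k (a : A) : a * iota g ^+ k = 0 -> a = 0.
Proof.
have [v homv] := iG; move/(congr1 (fun x => x * v ^+ k)).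
by rewrite mul0r -mulrA -exprMn homv expr1n mulr1.
Qed.

Lemma loc_integral : integral_ring A.
Proof.
move=> a b; have [k [f hf]] := iF a; have [l [h hh]] := iF b.
move/(congr1 (fun x => x * (iota g ^+ k * iota g ^+ l))); rewrite mul0r mulrACA hf hh -rmorphM.
rewrite -[X in _ = X -> _](rmorph0 iota) => /iI /eqP; rewrite mulf_eq0 => /orP[/eqP e|/eqP e]; [left|right].
  by apply: (@gX_inj k); rewrite hf e rmorph0.
by apply: (@gX_inj l); rewrite hh e rmorph0.
Qed.

Lemma loc_fg : finitely_generated_algebra A.
Proof.
have [v homv] := iG.
pose x (i : 'I_n.+1) := if (i < n)%N then iota (ipolyX K n i) else v.
exists n.+1, x; pose P a := exists f : {mpoly K[n.+1]}, a = mmap (in_alg A) x f.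
have PD a b : P a -> P b -> P (a + b) by move=> [f ->] [h ->]; exists (f + h); rewrite rmorphD.
have PM a b : P a -> P b -> P (a * b) by move=> [f ->] [h ->]; exists (f * h); rewrite rmorphM.
have PC c : P c%:A by exists c%:MP; rewrite mmapC.
have PX i : P (x i) by exists 'X_i; rewrite mmapX mmap1U.
have Pi f : P (iota f).
  elim/ipoly_ind: f => [c|i lt|f h Pf Ph|f h Pf Ph].
  - by rewrite iC.
  - by have := PX (inord i); rewrite /x inordK ?ltnS ?lt // ltnW.
  - by rewrite rmorphD; apply: PD.
  - by rewrite rmorphM; apply: PM.
have Pv k : P (v ^+ k).
  have Pv : P v by have := PX ord_max; rewrite /x ltnn.
  by elim: k => [|k IH]; [have := PC 1; rewrite scale1r|rewrite exprS; apply: PM].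
move=> a; have [k [f hf]] := iF a; have -> : a = iota f * v ^+ k; last exact: PM.
by rewrite -hf -mulrA -exprMn homv expr1n mulr1.
Qed.

(** Images of the variables lift freely. The resulting lift of [g] remains a unit because the kernel
    has square zero, and fractions are lifted through numerators. *)
Lemma loc_smooth : formally_smooth A.
Proof.
move=> B C q qs q0 f.
have hy i : exists b, q b = f (iota (ipolyX K n i)) by apply: qs.
have [y {}hy] := choice _ hy; pose phi := ipoly_eval (in_alg B) y n.
have qphi h : q (phi h) = f (iota h).
  apply: (ipoly_hom_ext (h1 := q \o phi) (h2 := f \o iota)) => [c|i lt] /=.
    by rewrite /phi ipevC iC /= !linearZ /= !rmorph1.
  by rewrite /phi ipevX.
have qM u v : q (u * v) = q u * q v by exact: rmorphM.
have qB u v : q (u - v) = q u - q v by exact: rmorphB.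
have q1 : q 1 = 1 by exact: rmorph1.
have f1 : f 1 = 1 by exact: rmorph1.
have fM u v : f (u * v) = f u * f v by exact: rmorphM.
have [beta hb] : exists beta, phi g * beta = 1.
  have [v homv] := iG; have [b hb] := qs (f v).
  pose eps := phi g * b - 1.
  have e0 : eps * eps = 0.
    by apply: q0; rewrite qB qM qphi hb -fM homv q1 f1 subrr.
  exists (b * (1 - eps)); rewrite mulrA -[phi g * b](subrK 1) -/eps mulrBr mulr1 mulrDl e0 add0r mul1r.
  by rewrite addrC addKr.
have hk a : exists kf : nat * R, a * iota g ^+ kf.1 = iota kf.2.
  by have [k [h e]] := iF a; exists (k, h).
have [F hF] := choice _ hk.
pose G a := phi (F a).2 * beta ^+ (F a).1.
(* Independence of the chosen fraction; all properties of [G] follow by choosing convenient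
   fractions. *)
have GE a k h : a * iota g ^+ k = iota h -> G a = phi h * beta ^+ k.
  move=> e; have e2 : (F a).2 * g ^+ k = h * g ^+ (F a).1.
    by apply: iI; rewrite !rmorphM !rmorphXn /= -hF -e mulrAC.
  have bk j : phi g ^+ j * beta ^+ j = 1 by rewrite -exprMn hb expr1n.
  have := congr1 phi e2; rewrite !rmorphM !rmorphXn /= => e3.
  rewrite /G -[LHS]mulr1 -(bk k) -[RHS]mulr1 -(bk (F a).1) [LHS]mulrACA [RHS]mulrACA e3.
  by congr (_ * _); rewrite mulrC.
have Gz : zmod_morphism G.
  move=> a b; have [ka ha] := (F a, hF a); rewrite (GE (a - b) ((F a).1 + (F b).1)%N
      ((F a).2 * g ^+ (F b).1 - (F b).2 * g ^+ (F a).1)); last first.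
    rewrite rmorphB !rmorphM !rmorphXn /= -!hF exprD mulrBl !mulrA; congr (_ - _).
    by rewrite mulrAC.
  have bk j : phi g ^+ j * beta ^+ j = 1 by rewrite -exprMn hb expr1n.
  rewrite /G rmorphB !rmorphM !rmorphXn /= exprD mulrBl; congr (_ - _).
    by rewrite mulrACA bk mulr1.
  by rewrite [beta ^+ _ * _]mulrC mulrACA bk mulr1.
have Gm : monoid_morphism G.
  split; first by rewrite (GE 1 0%N 1) ?expr0 ?mulr1 ?rmorph1.
  move=> a b; rewrite (GE (a * b) ((F a).1 + (F b).1)%N ((F a).2 * (F b).2)).
    by rewrite rmorphM exprD mulrACA.
  by rewrite rmorphM -!hF exprD mulrACA.
have Gs : scalable G.
  move=> c a; rewrite (GE (c *: a) (F a).1 (ipolyC K n c * (F a).2)).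
    by rewrite rmorphM /= /phi ipevC /= -mulrA -scalerAl mul1r.
  by rewrite rmorphM iC -hF -!scalerAl mul1r.
pose gm : {lrmorphism A -> B} := HB.pack G (GRing.isZmodMorphism.Build A B G Gz)
  (GRing.isMonoidMorphism.Build A B G Gm) (GRing.isScalable.Build K A B _ G Gs).
exists gm => a; rewrite /= /G qM qphi -hF fM !rmorphXn.
have qb : f (iota g) * q beta = 1 by rewrite -qphi -qM hb q1.
by rewrite -mulrA -exprMn qb expr1n mulr1.
Qed.
End LocalizationTheory.

Lemma ffact_leq_exp m k : (m ^_ k <= m ^ k)%N.
Proof.
elim: k m => [//|k IH] m; rewrite ffactnS expnS leq_mul2l; apply/orP; right.
by apply: leq_trans (IH _) _; case: k {IH} => // k; rewrite leq_exp2r // leq_pred.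
Qed.

Lemma exp_leq_ffact m k : (m.+1 ^ k <= (m + k) ^_ k)%N.
Proof.
elim: k => [//|k IH]; rewrite addnS ffactSS expnS leq_mul // ltnS leq_addr //.
Qed.

(** As functions of [m] the sides have degrees n and n + 1; the explicit [m] comes from bounding
    falling factorials by powers. *)
Lemma binomial_growth D n : exists m, ('C(D * m + n, n) < 'C(m + n.+1, n.+1))%N.
Proof.
exists (n.+1 * (D + n) ^ n)%N; set m := (n.+1 * _)%N.
rewrite -(ltn_pmul2r (fact_gt0 n.+1)) bin_ffact factS mulnC -mulnA [(n`! * _)%N]mulnC bin_ffact.
apply: leq_trans (exp_leq_ffact _ _).
apply: (@leq_ltn_trans (n.+1 * ((D + n) * m.+1) ^ n)).
  rewrite leq_mul2l /=; apply: leq_trans (ffact_leq_exp _ _) _.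
  by case: (n) => // n'; rewrite leq_exp2r //; nia.
by rewrite expnMn mulnA -/m expnS ltn_mul2r expn_gt0 /= ltnSn.
Qed.

(** * Krull dimension of a localized polynomial ring *)

Section KrullDimension.
Variables (K : fieldType) (n : nat) (g : ipoly K n) (A : comAlgType K) (iota : {rmorphism ipoly K n -> A}).
Hypothesis hloc : is_loc g iota.
Local Notation R := (ipoly K n).

Let iC c : iota (ipolyC K n c) = c%:A. Proof. by case: hloc. Qed.
Let iI : injective iota. Proof. by case: hloc. Qed.
Let iG : exists v, iota g * v = 1. Proof. by case: hloc. Qed.
Let iF a : exists k f, a * iota g ^+ k = iota f. Proof. by case: hloc. Qed.

Section Cleared.
Variables (a : nat -> A) (k D : nat) (f : nat -> R).
Hypothesis hf : forall i, a i * iota g ^+ k = iota (f i).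
Hypothesis fD : forall i, (size (homogenize K n (f i)) <= D.+1)%N.
Hypothesis gD : (size (homogenize K n (g ^+ k)) <= D.+1)%N.

(** Each degree of [Q] costs one factor g^k and raises degrees by at most [D]. A polynomial is
    carried as a row of length 1 so that [degle] applies. *)
Lemma cleared_value r m (Q : 'rV[ipoly K r]_1) : degle (fun=> 0%N) m Q ->
  exists h : 'rV[R]_1, degle (fun=> 0%N) (D * m) h /\
    iota (h 0 0) = iota g ^+ (k * m) * ipoly_eval (in_alg A) a r (Q 0 0).
Proof.
elim: r m Q => [|r IHr] m Q.
  move=> _; exists (const_mx (g ^+ (k * m) * ipolyC K n (Q 0 0))); split; last first.
    by rewrite mxE rmorphM rmorphXn iC.
  move=> j; rewrite mxE expr0 mul1r rmorphM homogenizeC exprM rmorphXn.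
  have h1 : (size ((homogenize K n (g ^+ k)) ^+ m)%R <= (D * m).+1)%N.
    elim: m => [|m IH]; first by rewrite expr0 size_poly1.
    rewrite exprS mulnS; apply: leq_trans (size_polyMleq _ _) _.
    by move: IH gD; lia.
  apply: leq_trans (size_polyMleq _ _) _.
  by have := size_polyC_leq1 (ipolyC K n (Q 0 0)); move: h1; lia.
elim/ltn_ind: m Q => m IHm Q hQ; have [h0 [d0 e0]] := IHr _ _ (degle_ev0 hQ).
have [|u E] := @ev0_eq0 _ _ _ (Q - inC (ev0 Q)); first by rewrite ev0B inCK subrr.
have hu : degle (fun=> 0 + 1)%N m u.
  apply/(@degle_hom K r.+1 _ (fun=> 0%N) _ 1 'X); rewrite ?polyX_eq0 ?homogenizeSX ?expr1 // -E.
  by apply: ksubspaceB (ksubspace_degle K r.+1 _ _) hQ (degle_inC (degle_ev0 hQ)).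
have QE : ipoly_eval (in_alg A) a r.+1 (Q 0 0) =
    ipoly_eval (in_alg A) a r (ev0 Q 0 0) + a r * ipoly_eval (in_alg A) a r.+1 (u 0 0).
  have -> : Q = inC (ev0 Q) + ('X : ipoly K r.+1) *: u by rewrite -E addrC subrK.
  rewrite [X in ipoly_eval _ _ _ X]mxE rmorphD ev0D ev0Z hornerX scale0r addr0 inCK; congr (_ + _).
    by rewrite mxE ipoly_eval_polyC.
  by rewrite mxE rmorphM; congr (_ * _); have := ipevX (in_alg A) a (ltnSn r); rewrite /= eqxx.
case: m IHm Q hQ h0 d0 e0 u E hu QE => [|m] IHm Q hQ h0 d0 e0 u E hu QE.
  exists h0; split=> //; rewrite e0 QE (_ : u = 0) ?mxE ?rmorph0 ?mulr0 ?addr0 //.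
  exact: degle_addn1_0 hu.
have [h1 [d1 e1]] : exists h : 'rV[R]_1, degle (fun=> 0%N) (D * m) h /\
    iota (h 0 0) = iota g ^+ (k * m) * ipoly_eval (in_alg A) a r.+1 (u 0 0).
  by apply: IHm => //; apply/(degle_shift (fun=> 0%N) m 1); rewrite -[m.+1]addn1 in hu; exact: hu.
exists (h0 + f r *: h1); split.
  apply: ksubspaceD (ksubspace_degle K n _ _) d0 _; rewrite mulnSr; exact: degleZ.
by rewrite !mxE rmorphD rmorphM e0 e1 -hf QE mulrDr mulnSr exprD -!mulrA; congr (_ + _); ring.
Qed.

(** Cleared values of polynomials of degree at most m in n + 1 letters lie among the polynomials of
    degree at most D m in n variables, a smaller space for suitable [m]. *)
Lemma dependent : exists Q : ipoly K n.+1, Q != 0 /\ ipoly_eval (in_alg A) a n.+1 Q = 0.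
Proof.
have [m lt] := binomial_growth D n.
have [b [b1 b2 b3]] := reldim_degle K n.+1 (fun _ : 'I_1 => 0%N) m.
have [b' [c1 c2 c3]] := reldim_degle K n (fun _ : 'I_1 => 0%N) (D * m).
move: b b1 b2 b3 b' c1 c2 c3; rewrite !big_ord1 /hdim !leq0n !subn0.
set d := 'C(_, _); set e := 'C(_, _) => b b1 b2 b3 b' c1 c2 c3.
have [h hh] := @rows_exist R d 1 (fun i h => degle (fun=> 0%N) (D * m) h /\
    iota (h 0 0) = iota g ^+ (k * m) * ipoly_eval (in_alg A) a n.+1 (row i b 0 0))
  (fun i => cleared_value (b1 i)).
have [c [hc c0]] : exists c : 'rV[K]_d, lincomb (ipolyC K n) c h = 0 /\ c <> 0.
  apply: NNPP => no; have : (d <= e)%N.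
    apply: (@span_le _ _ (ipolyC K n) 1 (@zerov _ 1) d e h b' (ksubspace_zerov _ _)) => [i|c hc].
      by apply: c2; case: (hh i).
    by apply: NNPP => c0; apply: no; exists c.
  by rewrite leqNgt lt.
exists (lincomb (ipolyC K n.+1) c b 0 0); split.
  apply/eqP => q0; apply: c0; apply: b3; apply/matrixP => i j; rewrite !ord1 q0 mxE //.
have E : iota (lincomb (ipolyC K n) c h 0 0) = iota g ^+ (k * m) * ipoly_eval (in_alg A) a n.+1 (lincomb (ipolyC K n.+1) c b 0 0).
  rewrite !lcE !summxE !rmorph_sum mulr_sumr; apply: eq_bigr => i _.
  rewrite [in LHS]mxE [X in ipoly_eval _ _ _ X]mxE !rmorphM ipevC iC mulrCA; congr (_ * _).
  by have [_] := hh i.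
by apply: (@gX_inj _ _ _ _ _ hloc (k * m)); rewrite mulrC -E hc mxE rmorph0.
Qed.
End Cleared.

Lemma loc_dependent (a : nat -> A) : exists Q : ipoly K n.+1, Q != 0 /\ ipoly_eval (in_alg A) a n.+1 Q = 0.
Proof.
have hk i : exists kf : nat * R, a i * iota g ^+ kf.1 = iota kf.2.
  by have [k [h e]] := iF (a i); exists (k, h).
have [F hF] := choice _ hk.
pose k := \max_(i < n.+1) (F i).1.
pose f i := if (i <= n)%N then (F i).2 * g ^+ (k - (F i).1) else 0.
pose a' i := if (i <= n)%N then a i else 0.
have sz (h : R) : exists D, (size (homogenize K n h) <= D.+1)%N by exists (size (homogenize K n h)); apply: leqnSn.
have [S hS] := choice _ sz.
pose D := maxn (S (g ^+ k)) (\max_(i < n.+1) S (f i)).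
have [|||Q [Q0 hQ]] := @dependent a' k D f.
- move=> i; rewrite /a' /f; case: leqP => le; last by rewrite mul0r rmorph0.
  have lek : ((F i).1 <= k)%N.
    exact: (@leq_bigmax _ (fun i : 'I_n.+1 => (F i).1) (Ordinal (le : (i < n.+1)%N))).
  by rewrite -[in LHS](subnKC lek) exprD mulrA hF rmorphM rmorphXn.
- move=> i; have [le|gt] := leqP i n.
    apply: leq_trans (hS (f i)) _; rewrite ltnS /D leq_max; apply/orP; right.
    exact: (@leq_bigmax _ (fun i : 'I_n.+1 => S (f i)) (Ordinal (le : (i < n.+1)%N))).
  by rewrite /f (leqNgt i) gt /= rmorph0 size_poly0.
- by apply: leq_trans (hS _) _; rewrite ltnS /D leq_maxl.
- exists Q; split=> //; rewrite -[RHS]hQ; apply: ipoly_hom_ext => [c|i lti]; first by rewrite !ipevC.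
  by rewrite !ipevX // /a' -ltnS lti.
Qed.

(* If [Q(x)] lies in [J 0], then modulo [J 1], which contains the value of the outermost
   variable, so does its constant coefficient, which thus vanishes by induction. *)
Lemma chain_independent r (J : nat -> prime_idealr A) (x : nat -> A) :
  (forall i, (i < r)%N -> {subset J i <= J i.+1}) ->
  (forall i, (i < r)%N -> x (r - i.+1)%N \in J i.+1 /\ x (r - i.+1)%N \notin J i) ->
  forall Q, ipoly_eval (in_alg A) x r Q \in J 0%N -> Q = 0.
Proof.
elim: r J x => [|r IH] J x hJ hx Q.
  move=> hQ; apply/eqP; apply: contraTT hQ => Q0; apply/negP => /(idealMr (Q^-1)%:A).
  by rewrite /= -scalerAl mul1r scalerA mulVf // scale1r idealr1.
have sub := hJ 0%N (ltn0Sn r); have [x1 x0] := hx 0%N (ltn0Sn r); rewrite subSS subn0 in x1 x0.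
have ev (f : {poly ipoly K r}) c : ipoly_eval (in_alg A) x r.+1 (f * 'X + c%:P) =
    ipoly_eval (in_alg A) x r.+1 f * x r + ipoly_eval (in_alg A) x r c.
  rewrite rmorphD rmorphM ipoly_eval_polyC; congr (_ * _ + _).
  by have := ipevX (in_alg A) x (ltnSn r); rewrite /= eqxx.
elim/poly_ind: Q => [//|f c IHf]; rewrite ev => h.
have c0 : c = 0.
  apply: (IH (fun i => J i.+1) x) => [i lt|i lt|].
  - by apply: hJ.
  - by have := hx i.+1 (lt : (i.+1 < r.+1)%N); rewrite subSS.
  - have h2 : ipoly_eval (in_alg A) x r.+1 f * x r \in J 1%N by apply: idealMr.
    by have := rpredB (sub _ h) h2; rewrite addrC addKr.
move: h; rewrite c0 rmorph0 addr0 prime_idealrM (negbTE x0) orbF => /IHf ->.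
by rewrite mul0r add0r polyC0.
Qed.

(** Elements that climb the chain one step each are algebraically independent, while n + 1 elements
    of [A] never are. *)
Lemma krull_upper (m : nat) (I : 'I_m.+1 -> prime_idealr A) : prime_chain I -> (m <= n)%N.
Proof.
move=> hI; rewrite leqNgt; apply/negP => lt.
pose J i : prime_idealr A := I (inord i).
have inJ i : (i <= n.+1)%N -> (inord i : 'I_m.+1) = i :> nat.
  by move=> le; rewrite inordK // ltnS (leq_trans le).
have hJ i : (i < n.+1)%N -> {subset J i <= J i.+1} /\ exists a, a \in J i.+1 /\ a \notin J i.
  move=> le; apply: hI; rewrite !inJ //; exact: ltnW.
have hx i : exists a, (i < n.+1)%N -> a \in J i.+1 /\ a \notin J i.
  have [le|ge] := ltnP i n.+1; last by exists 0.
  by have [_ [a ha]] := hJ i le; exists a.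
have [y hy] := choice _ hx.
have [Q [Q0 hQ]] := loc_dependent (fun i => y (n - i)%N).
case/eqP: Q0; apply: (@chain_independent n.+1 J (fun i => y (n - i)%N)) => [i lti|i lti|].
- by case: (hJ i lti).
- by rewrite subSS subKn //; apply: hy.
- by rewrite hQ idealr0.
Qed.

Section Lower.
Variable c : nat -> K.
Hypothesis gc : ipoly_eval idfun c n g != 0.

Definition substc j : {rmorphism R -> R} :=
  ipoly_eval (ipolyC K n) (fun i => if (i < j)%N then ipolyC K n (c i) else ipolyX K n i) n.

Lemma substc_eval j f : ipoly_eval idfun c n (substc j f) = ipoly_eval idfun c n f.
Proof.
apply: (ipoly_hom_ext (h1 := ipoly_eval idfun c n \o substc j)) => [d|i lt] /=.
  by rewrite /substc !ipevC.
by rewrite /substc !ipevX //; case: ifP => _; rewrite ?ipevC ?ipevX.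
Qed.

Lemma substc_comp j l f : (j <= l)%N -> substc l (substc j f) = substc l f.
Proof.
move=> le; apply: (ipoly_hom_ext (h1 := substc l \o substc j)) => [d|i lt] /=.
  by rewrite /substc !ipevC.
rewrite {2}/substc ipevX //; case: ifP => // ltj.
by rewrite /substc ipevC ipevX // (leq_trans ltj le).
Qed.

(** The ideal generated by x_i - c_i for i < j, read off from numerators; it stays proper in the
    localization because [g] does not vanish at [c]. *)
Definition substP j (a : A) : bool := if excluded_middle_informative
  (exists k f, a * iota g ^+ k = iota f /\ substc j f = 0) then true else false.

Lemma substPP j a : reflect (exists k f, a * iota g ^+ k = iota f /\ substc j f = 0) (substP j a).
Proof. by rewrite /substP; case: excluded_middle_informative => h; constructor. Qed.

Lemma spg0 j k : substc j (g ^+ k) != 0.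
Proof.
apply/eqP => h; have := expf_neq0 k gc; rewrite -rmorphXn -(substc_eval j) h rmorph0 eqxx //.
Qed.

Lemma substP_iota j f : substP j (iota f) = (substc j f == 0).
Proof.
apply/substPP/eqP => [[k [h [e h0]]]|h]; last by exists 0%N, f; rewrite expr0 mulr1.
have e2 : f * g ^+ k = h by apply: iI; rewrite rmorphM rmorphXn.
move: h0; rewrite -e2 rmorphM => /eqP; rewrite mulf_eq0 (negbTE (spg0 j k)) orbF.
by move/eqP.
Qed.

Lemma substP_gX j k a : substP j (a * iota g ^+ k) = substP j a.
Proof.
apply/substPP/substPP => -[l [f [e f0]]]; first by exists (k + l)%N, f; rewrite exprD mulrA.
exists l, (f * g ^+ k); split; last by rewrite rmorphM f0 mul0r.
by rewrite rmorphM rmorphXn -e mulrAC.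
Qed.

Lemma substP_idealr j : idealr_closed (substP j).
Proof.
split=> [||a u v hu homv].
- have h : substP j 0 by have := substP_iota j 0; rewrite !rmorph0 eqxx.
  exact: h.
- have h : substP j 1 = false by have := substP_iota j 1; rewrite !rmorph1 oner_eq0.
  exact: (negbT h).
change (is_true (substP j u)) in hu; change (is_true (substP j v)) in homv.
change (is_true (substP j (a * u + v))).
have [k [f hf]] := iF a; have [l [h hh]] := iF u; have [r [e he]] := iF v.
move: hu homv; rewrite -(substP_gX j l) hh substP_iota -(substP_gX j r v) he substP_iota => /eqP h0 /eqP e0.
rewrite -(substP_gX j (k + l + r)) (_ : _ * _ = iota (f * h * g ^+ r + e * g ^+ (k + l))).
  by rewrite substP_iota rmorphD !rmorphM h0 e0 mulr0 !mul0r addr0.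
by rewrite rmorphD !rmorphM !rmorphXn -hf -hh -he !exprD; ring.
Qed.

Lemma substP_prime j : prime_idealr_closed (substP j).
Proof.
move=> u v; change (substP j (u * v) -> substP j u || substP j v); have [l [h hh]] := iF u; have [r [e he]] := iF v.
rewrite -(substP_gX j (l + r)) -(substP_gX j l u) -(substP_gX j r v) hh he exprD mulrACA hh he -rmorphM.
by rewrite !substP_iota rmorphM mulf_eq0.
Qed.

Definition substI j : prime_idealr A := HB.pack (substP j) (isIdealr.Build A (substP j) (substP_idealr j))
  (isPrimeIdealrClosed.Build A (substP j) (@substP_prime j)).

Lemma krull_lower : exists I : 'I_n.+1 -> prime_idealr A, prime_chain I.
Proof.
exists (fun i => substI i) => i j ltij; split.
  move=> a; change (substP i a -> substP j a); have [k [f hf]] := iF a.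
  rewrite -(substP_gX i k) -(substP_gX j k) hf !substP_iota => /eqP h.
  by rewrite -(substc_comp f (ltnW ltij)) h rmorph0.
have lin : (i < n)%N by apply: leq_trans ltij _; rewrite -ltnS.
exists (iota (ipolyX K n i - ipolyC K n (c i))); split.
  change (is_true (substP j (iota (ipolyX K n i - ipolyC K n (c i))))).
  by rewrite substP_iota rmorphB /substc ipevX // ipevC ltij subrr.
change (is_true (~~ substP i (iota (ipolyX K n i - ipolyC K n (c i))))).
rewrite substP_iota rmorphB /substc ipevX // ipevC ltnn.
(* x_i - c_i takes the value 1 at the point with coordinates c_l + 1, so it is not zero. *)
apply/eqP => /(congr1 (ipoly_eval idfun (fun l => c l + 1) n)).
by rewrite rmorphB ipevX // ipevC rmorph0 /= addrAC subrr add0r => /eqP; rewrite oner_eq0.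
Qed.
End Lower.
End KrullDimension.

(** * The complement of a hyperbolic plane *)

Section SymplecticForm.
Variables (A : comNzRingType) (N : nat).
Local Notation J := (symplectic_mx A N).
Local Notation om := (standard_form A N).
Implicit Types u v w : 'rV[A]_N.

Lemma sfDl c u v w : om (c *: u + v) w = c * om u w + om v w.
Proof. by rewrite /standard_form !mulmxDl -!scalemxAl !mxE. Qed.

Lemma symplectic_mx_anti i j : J i j = - J j i.
Proof.
rewrite !mxE; set a := (nat_of_ord i); set b := (nat_of_ord j).
have [h|h] := boolP (~~ odd a && (b == a.+1)).
  have -> : (~~ odd b && (a == b.+1)) = false by lia.
  have -> : (odd b && (b == a.+1)) = true by lia.
  by rewrite opprK.
have [h'|h'] := boolP (odd a && (a == b.+1)).
  by have -> : (~~ odd b && (a == b.+1)) = true by lia.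
have -> : (~~ odd b && (a == b.+1)) = false by lia.
have -> : (odd b && (b == a.+1)) = false by lia.
by rewrite oppr0.
Qed.

Lemma sf_anti u v : om u v = - om v u.
Proof.
have E (x y : 'rV[A]_N) : om x y = \sum_i \sum_j x 0 i * J i j * y 0 j.
  rewrite /standard_form mxE exchange_big; apply: eq_bigr => j _.
  by rewrite !mxE mulr_suml; apply: eq_bigr => i _; rewrite !mxE.
rewrite !E exchange_big -sumrN; apply: eq_bigr => j _; rewrite -sumrN; apply: eq_bigr => i _.
by rewrite (symplectic_mx_anti i j); ring.
Qed.

(** Antisymmetry does not suffice where 2 is not invertible, so the terms are paired across the
    diagonal, which is itself zero. *)
Lemma sf_alt u : om u u = 0.
Proof.
have E : om u u = \sum_i \sum_j u 0 i * J i j * u 0 j.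
  rewrite /standard_form mxE exchange_big; apply: eq_bigr => j _.
  by rewrite !mxE mulr_suml; apply: eq_bigr => i _; rewrite !mxE.
pose f (i j : 'I_N) := u 0 i * J i j * u 0 j.
have fN i j : f i j = - f j i.
  by rewrite /f (symplectic_mx_anti i j); ring.
have f0 i : f i i = 0.
  rewrite /f mxE (_ : (i == i.+1 :> nat) = false) ?andbF ?mulr0 ?mul0r //; apply: ltn_eqF; exact: ltnSn.
rewrite E (eq_bigr (fun i : 'I_N => \sum_(j : 'I_N | (i < j)%N) f i j + \sum_(j : 'I_N | (j < i)%N) f i j)); last first.
  move=> i _; rewrite (bigID (fun j : 'I_N => (i < j)%N)) /=; congr (_ + _).
  rewrite [LHS](bigD1 i) /= ?ltnn // [X in X + _](f0 i) add0r; apply: eq_bigl => j.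
  by rewrite -leqNgt ltn_neqAle andbC -(inj_eq val_inj).
rewrite big_split /= (exchange_big_dep xpredT) //= -big_split big1 // => i _ /=.
by rewrite -big_split big1 // => j _; rewrite /= fN addNr.
Qed.

Lemma symplectic_mx1 (i j : 'I_N) : ~~ odd i -> j = i.+1 :> nat -> J i j = 1.
Proof. by move=> ei e; rewrite mxE ei e eqxx. Qed.
Lemma symplectic_mxN1 (i j : 'I_N) : odd i -> i = j.+1 :> nat -> J i j = -1.
Proof. by move=> oi e; rewrite mxE oi e eqxx. Qed.
Lemma symplectic_mx0 (i j : 'I_N) : (if odd i then i != j.+1 :> nat else j != i.+1 :> nat) -> J i j = 0.
Proof. by rewrite mxE; case: (odd i) => /= /negbTE ->. Qed.

Lemma symplectic_mx_sq : ~~ odd N -> J *m J = - 1%:M.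
Proof.
move=> eN; apply/matrixP => i k; rewrite !mxE.
have [oi|ei] := boolP (odd i).
  have lt : (i.-1 < N)%N by apply: leq_ltn_trans (leq_pred i) (ltn_ord i).
  have i1 : i = (Ordinal lt).+1 :> nat by rewrite /= prednK //; case: (i : nat) oi.
  have e0 : ~~ odd (Ordinal lt) by move: oi i1 => /=; lia.
  rewrite (bigD1 (Ordinal lt)) //= big1 ?addr0 => [|j ne].
    rewrite (symplectic_mxN1 oi i1); have [<-|ne] := eqVneq i k.
      by rewrite (symplectic_mx1 e0 i1) mulr1.
    rewrite symplectic_mx0 ?mulr0 ?oppr0 // (negbTE e0) -i1.
    by rewrite eq_sym (inj_eq val_inj).
  rewrite symplectic_mx0 ?mul0r // oi; apply: contraNN ne => /eqP e.
  by rewrite -(inj_eq val_inj) /= e.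
have lt : (i.+1 < N)%N.
  rewrite ltn_neqAle ltn_ord andbT; apply: contraNneq eN => <-; by rewrite /= ei.
have oi : odd (Ordinal lt) by rewrite /= ei.
rewrite (bigD1 (Ordinal lt)) //= big1 ?addr0 => [|j ne].
  rewrite (@symplectic_mx1 i (Ordinal lt)) // mul1r; have [<-|ne] := eqVneq i k.
    by rewrite (symplectic_mxN1 oi).
  rewrite symplectic_mx0 ?oppr0 // oi /= eqSS.
  by rewrite (inj_eq val_inj).
rewrite symplectic_mx0 ?mul0r // (negbTE ei); apply: contraNN ne => /eqP e.
by rewrite -(inj_eq val_inj) /= e.
Qed.
End SymplecticForm.

Lemma cramer_scale (A : comNzRingType) (V : lmodType A) a b c d (x y : V) :
  b *: (- (c *: x + d *: y)) - d *: (- (a *: x + b *: y)) = (a * d - b * c) *: x.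
Proof.
rewrite !scalerN opprK !scalerDr !scalerA opprD addrACA [d * b]mulrC addNr addr0 addrC.
by rewrite scalerBl [d * a]mulrC.
Qed.

Section HyperbolicComplement.
Variables (A : comNzRingType) (m : nat) (v w : 'rV[A]_m.+2).
Local Notation om := (standard_form A m.+2).
Local Notation J := (symplectic_mx A m.+2).
Implicit Types x y : 'rV[A]_m.+2.

Lemma sfDr c x y z : om z (c *: x + y) = c * om z x + om z y.
Proof. by rewrite sf_anti sfDl (sf_anti z x) (sf_anti z y); ring. Qed.

Definition hcp x := (om v x == 0) && (om w x == 0).
Lemma hcp_submod : subsemimod_closed hcp.
Proof.
have h : 0 \in hcp by rewrite unfold_in /standard_form trmx0 !mulmx0 mxE eqxx.
have hl c x y : x \in hcp -> y \in hcp -> c *: x + y \in hcp.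
  rewrite !unfold_in => /andP[/eqP h1 /eqP h2] /andP[/eqP h3 /eqP h4].
  by rewrite /hcp !sfDr h1 h2 h3 h4 !mulr0 !addr0 eqxx.
split; first split=> // x y hx hy; first by have := hl 1 x y hx hy; rewrite scale1r.
by move=> c x hx; have := hl c x 0 hx h; rewrite addr0.
Qed.
HB.instance Definition _ := GRing.isSubmodClosed.Build A 'rV[A]_m.+2 hcp hcp_submod.

Record hcomp := Hcomp { hcval : 'rV[A]_m.+2; hcvalP : hcval \in hcp }.
HB.instance Definition _ := [isSub for hcval].
HB.instance Definition _ := [Choice of hcomp by <:].
HB.instance Definition _ := [SubChoice_isSubLmodule of hcomp by <:].

Definition hform (x y : hcomp) : A := om (hcval x) (hcval y).
Lemma hform_bilinear : bilinear_for (GRing.mul : GRing.Scale.law A A) (GRing.mul : GRing.Scale.law A A) hform.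
Proof. by split=> u c x y; rewrite /hform /= ?sfDl ?sfDr. Qed.
HB.instance Definition _ := bilinear_isBilinear.Build A hcomp hcomp A _ _ hform hform_bilinear.

Hypotheses (vw : om v w = 1) (m_even : ~~ odd m).

Lemma sf_row x y : om x y = \sum_j x 0 j * (J *m y^T) j 0.
Proof. by rewrite /standard_form -mulmxA mxE. Qed.

Definition hproj x := x - om x w *: v + om x v *: w.

Lemma hprojD c x y : hproj (c *: x + y) = c *: hproj x + hproj y.
Proof. by rewrite /hproj !sfDl; apply/rowP => j; rewrite !mxE; ring. Qed.

Lemma wv : om w v = -1. Proof. by rewrite sf_anti vw. Qed.

Lemma hproj_in x : hproj x \in hcp.
Proof.
have h z : om z (hproj x) = om z x - om x w * om z v + om x v * om z w.
  rewrite /hproj addrC sfDr; have := sfDr (- om x w) v x z; rewrite scaleNr addrC => ->.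
  ring.
rewrite unfold_in /hcp !h !sf_alt vw wv (sf_anti v x) (sf_anti w x).
by apply/andP; split; apply/eqP; ring.
Qed.
Definition hpr x : hcomp := Hcomp (hproj_in x).

Lemma hcp_sf x : x \in hcp -> [/\ om x v = 0, om x w = 0, om v x = 0 & om w x = 0].
Proof.
by rewrite unfold_in => /andP[/eqP h1 /eqP h2]; rewrite (sf_anti x v) (sf_anti x w) h1 h2 oppr0.
Qed.

Lemma hproj_id x : x \in hcp -> hproj x = x.
Proof. by move/hcp_sf => [h1 h2 _ _]; rewrite /hproj h1 h2 !scale0r subr0 addr0. Qed.

Lemma hprK (x : hcomp) : hpr (hcval x) = x.
Proof. by apply: val_inj; apply: hproj_id; apply: hcvalP. Qed.

Lemma hprD c x y : hpr (c *: x + y) = c *: hpr x + hpr y.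
Proof. by apply: val_inj; rewrite /= hprojD. Qed.
Lemma hpr0 : hpr 0 = 0.
Proof. by have := hprD (-1) 0 0; rewrite !scaleN1r oppr0 addr0 addNr. Qed.
Lemma hprZ c x : hpr (c *: x) = c *: hpr x.
Proof. by have := hprD c x 0; rewrite hpr0 !addr0. Qed.
Lemma hpr_sum (I : finType) (f : I -> 'rV[A]_m.+2) : hpr (\sum_i f i) = \sum_i hpr (f i).
Proof.
elim/big_rec2: _ => [|i x y _ <-]; first exact: hpr0.
by have := hprD 1 (f i) y; rewrite !scale1r.
Qed.

Lemma hproj_v : hpr v = 0.
Proof. by apply: val_inj; rewrite /= /hproj sf_alt vw scale0r addr0 scale1r subrr. Qed.
Lemma hproj_w : hpr w = 0.
Proof. by apply: val_inj; rewrite /= /hproj sf_alt wv scale0r subr0 scaleN1r subrr. Qed.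

Lemma hpr_coord x : hpr x = \sum_j x 0 j *: hpr (delta_mx 0 j).
Proof. by rewrite {1}(row_sum_delta x) hpr_sum; apply: eq_bigr => j _; rewrite hprZ. Qed.

Lemma sf_hproj x y : x \in hcp -> om x (hproj y) = om x y.
Proof.
move/hcp_sf => [h1 h2 _ _].
rewrite /hproj addrC sfDr h2 mulr0 add0r; have := sfDr (- om y w) v y x.
by rewrite scaleNr addrC h1 mulr0 add0r.
Qed.

Lemma symplectic_mx_inj x : x *m J = 0 -> x = 0.
Proof.
move/(congr1 (mulmx^~ J)); rewrite -mulmxA symplectic_mx_sq /= ?negbK // mulmxN mulmx1 mul0mx.
by move/eqP; rewrite oppr_eq0 => /eqP.
Qed.

Lemma sf_nondegenerate x : (forall y, om x y = 0) -> x = 0.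
Proof.
move=> h; apply: symplectic_mx_inj; apply/rowP => j; rewrite [RHS]mxE -(h (delta_mx 0 j)).
by rewrite /standard_form trmx_delta -colE [RHS]mxE.
Qed.

Lemma hform_alternating : alternating_form hform.
Proof. by move=> x; apply: sf_alt. Qed.

Lemma hform_perfect : perfect_form hform.
Proof.
split=> [x h|f].
  apply: val_inj; apply: sf_nondegenerate => y; rewrite -(sf_hproj _ (hcvalP x)).
  exact: (h (hpr y)).
pose c := \row_j f (hpr (delta_mx 0 j)); pose x0 := - (c *m J).
have x0E y : om x0 y = f (hpr y).
  rewrite /standard_form /x0 mulNmx -mulmxA symplectic_mx_sq /= ?negbK // mulmxN mulmx1 opprK mxE.
  rewrite hpr_coord linear_sum; apply: eq_bigr => j _; rewrite linearZ /= !mxE mulrC //.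
exists (hpr x0) => y; rewrite -[in RHS](hprK y) -x0E /hform.
by rewrite sf_anti [in RHS]sf_anti /= sf_hproj //; apply: hcvalP.
Qed.

(** Each v_j is [om v] of v_j w - w_j v, whose entries are minors. If [I] contained all minors it
    would contain [v], hence [om v w] = 1. *)
Lemma hcomp_minor (I : prime_idealr A) : exists i j, v 0 i * w 0 j - v 0 j * w 0 i \notin I.
Proof.
apply: NNPP => no; have hI i j : v 0 i * w 0 j - v 0 j * w 0 i \in I.
  by apply: contraT => h; case: no; exists i, j.
have vI j : v 0 j \in I.
  have -> : v 0 j = om v (v 0 j *: w - w 0 j *: v).
    have := sfDr (- w 0 j) v (v 0 j *: w) v; rewrite scaleNr addrC => ->.
    by have := sfDr (v 0 j) w 0 v; rewrite addr0 => ->; rewrite sf_alt vw /standard_form trmx0 mulmx0 mxE; ring.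
  rewrite sf_row; apply: rpred_sum => i _; apply: idealMr.
  rewrite mxE; apply: rpred_sum => l _; apply: idealMr.
  by rewrite !mxE; have := hI j l; rewrite [w 0 j * _]mulrC.
have : om v w \in I.
  by rewrite sf_row; apply: rpred_sum => i _; rewrite mulrC; apply: idealMr.
by rewrite vw idealr1.
Qed.

Lemma sum_lift2 (V : nmodType) (F : 'I_m.+2 -> V) i (l : 'I_m.+1) :
  \sum_k F k = F i + (F (lift i l) + \sum_(j < m) F (lift i (lift l j))).
Proof. by rewrite (bigD1_ord i) //= (bigD1_ord l). Qed.

(** The projections of the standard basis satisfy the relations given by [v] and [w]. Where a minor
    [s] is invertible, Cramer's rule eliminates the two basis vectors it involves, and the other m
    projections form a basis. *)
Lemma hcomp_vector_bundle : vector_bundle m hcomp.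
Proof.
move=> I; have [i [j hs]] := hcomp_minor I.
have ij : i != j by apply: contraNneq hs => ->; rewrite subrr idealr0.
have [l E _] := unlift_some ij; subst j.
set s := _ - _ in hs.
pose h (k : 'I_m) := lift i (lift l k).
exists s, (fun k => hpr (delta_mx 0 (h k))); split=> //; split=> [x|a ha k].
  pose e k := hpr (delta_mx 0 k).
  pose W (y : 'rV[A]_m.+2) := \sum_k y 0 (h k) *: e (h k).
  have rel (y : 'rV[A]_m.+2) : hpr y = 0 -> y 0 i *: e i + y 0 (lift i l) *: e (lift i l) = - W y.
    rewrite hpr_coord (sum_lift2 _ i l) addrA => /eqP; rewrite addr_eq0 => /eqP -> //.
  have rv := rel v hproj_v; have rw := rel w hproj_w.
  have si : s *: e i = v 0 (lift i l) *: W w - w 0 (lift i l) *: W v.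
    by rewrite -[W w]opprK -[W v]opprK -rv -rw cramer_scale.
  have sl : s *: e (lift i l) = w 0 i *: W v - v 0 i *: W w.
    rewrite -[W w]opprK -[W v]opprK -rv -rw ![_ *: e i + _]addrC cramer_scale.
    by congr (_ *: _); rewrite /s; ring.
  have lin a b (y z : 'rV[A]_m.+2) : a *: W y - b *: W z = \sum_k (a * y 0 (h k) - b * z 0 (h k)) *: e (h k).
    by rewrite !scaler_sumr -sumrB; apply: eq_bigr => k _; rewrite !scalerA -scalerBl.
  exists 1%N, (fun k => hcval x 0 i * (v 0 (lift i l) * w 0 (h k) - w 0 (lift i l) * v 0 (h k)) +
     (hcval x 0 (lift i l) * (w 0 i * v 0 (h k) - v 0 i * w 0 (h k)) + s * hcval x 0 (h k))).
  rewrite -[x in LHS]hprK hpr_coord (sum_lift2 _ i l) expr1 !scalerDr !scalerA ![s * _]mulrC -!scalerA.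
  rewrite -/(e i) -/(e (lift i l)) si sl !lin !scaler_sumr -!big_split.
  by apply: eq_bigr => k _ /=; rewrite !scalerA -!scalerDl [s * _]mulrC.
exists 1%N; rewrite expr1.
pose y : 'rV[A]_m.+2 := \sum_k a k *: delta_mx 0 (h k).
have y0 : hpr y = 0 by rewrite hpr_sum -[RHS]ha; apply: eq_bigr => q _; rewrite hprZ.
(* A relation puts [y] into the span of [v] and [w]. Two of its entries are 0, and by Cramer's rule
   [s] kills its coefficients. *)
have yE : y = om y w *: v - om y v *: w.
  have /(congr1 val) /= := y0; rewrite /hproj => h1; rewrite -[LHS]subr0 -[X in _ - X]h1.
  by apply/rowP => q; rewrite !mxE; ring.
have yi : y 0 i = 0.
  rewrite summxE big1 // => q _; rewrite !mxE eqxx (_ : (i == h q) = false) ?mulr0 //.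
  by apply/negbTE/neq_lift.
have yl : y 0 (lift i l) = 0.
  rewrite summxE big1 // => q _; rewrite !mxE eqxx (inj_eq (@lift_inj _ i)).
  by rewrite (_ : (l == lift l q) = false) ?mulr0 //; apply/negbTE/neq_lift.
have yh : y 0 (h k) = a k.
  rewrite summxE (bigD1 k) //= big1 => [|q ne]; first by rewrite !mxE !eqxx mulr1 addr0.
  rewrite !mxE eqxx !(inj_eq (@lift_inj _ _)) eq_sym (negbTE ne) mulr0 //.
move: (yE) => /rowP E; have := E i; have := E (lift i l); have := E (h k).
rewrite yi yl yh !mxE => -> e2 e1.
have za : s * om y w = 0.
  have -> : s * om y w = w 0 (lift i l) * (om y w * v 0 i - om y v * w 0 i) -
     w 0 i * (om y w * v 0 (lift i l) - om y v * w 0 (lift i l)) by rewrite /s; ring.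
  by rewrite -e1 -e2 !mulr0 subrr.
have zb : s * om y v = 0.
  have -> : s * om y v = v 0 (lift i l) * (om y w * v 0 i - om y v * w 0 i) -
     v 0 i * (om y w * v 0 (lift i l) - om y v * w 0 (lift i l)) by rewrite /s; ring.
  by rewrite -e1 -e2 !mulr0 subrr.
by rewrite mulrDr mulrN !mulrA za zb !mul0r subr0.
Qed.

Lemma hcomp_symplectic : symplectic_bundle m hform.
Proof. by split; [apply: hcomp_vector_bundle|apply: hform_alternating|apply: hform_perfect]. Qed.

Lemma sf2 (x y : 'rV[A]_2) : standard_form A 2 x y = x 0 0 * y 0 1 - x 0 1 * y 0 0.
Proof.
rewrite /standard_form mxE !big_ord_recl big_ord0 !mxE !big_ord_recl !big_ord0 !mxE /=.
rewrite (_ : lift ord0 ord0 = 1); last exact: val_inj.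
by rewrite (_ : ord0 = 0) //; ring.
Qed.

Definition hsum (x : hcomp * 'rV[A]_2) : 'rV[A]_m.+2 := hcval x.1 + x.2 0 0 *: v + x.2 0 1 *: w.
Lemma hsum_linear : linear hsum.
Proof. by move=> c x y; rewrite /hsum; apply/rowP => j; rewrite !mxE; ring. Qed.
HB.instance Definition _ := GRing.isLinear.Build A (hcomp * 'rV[A]_2)%type 'rV[A]_m.+2 _ hsum hsum_linear.

Lemma hcomp_stably_trivial : stably_trivial_symplectic m hform.
Proof.
have h4 a b z x : om (x + a *: v + b *: w) z = om x z + a * om v z + b * om w z.
  rewrite addrC sfDl; have := sfDl a v x z; rewrite addrC => ->; ring.
exists hsum; split=> [|x y].
  pose g u : hcomp * 'rV[A]_2 := (hpr u, \row_j if j == 0 then om u w else - om u v).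
  exists g => [x|u]; last first.
    change (hcval (g u).1 + (g u).2 0 0 *: v + (g u).2 0 1 *: w = u); rewrite /g /= !mxE /= /hproj; apply/rowP => j; rewrite !mxE; ring.
  have [h1 h2 _ _] := hcp_sf (hcvalP x.1).
  have e1 : om (hsum x) w = x.2 0 0 by rewrite /hsum h4 h2 vw sf_alt; ring.
  have e2 : om (hsum x) v = - x.2 0 1 by rewrite /hsum h4 h1 wv sf_alt; ring.
  change (g (hsum x) = x); rewrite /g e1 e2 [RHS]surjective_pairing; congr pair.
    apply: val_inj; rewrite /= /hproj e1 e2; apply/rowP => j; rewrite !mxE; ring.
  apply/rowP => j; rewrite mxE; case: eqP => [->//|/eqP ne]; rewrite opprK; congr (_ _ _).
  by apply/val_inj; case: j ne => -[|[|]].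
have [h1 h2 h3 h5] := hcp_sf (hcvalP x.1); have [k1 k2 k3 k5] := hcp_sf (hcvalP y.1).
rewrite /hsum h4 (sf_anti (hcval x.1)) (sf_anti v) (sf_anti w) !h4 /orthogonal_sum /hform sf2.
rewrite k1 k2 !sf_alt h3 h5 vw wv (sf_anti (hcval y.1) (hcval x.1)); ring.
Qed.

(** A trivialization gives a basis of the complement of the plane of [v] and [w]; with [v] and [w]
    in front it becomes a basis of the whole module. *)
Lemma trivial_completable : trivial_symplectic m hform ->
  exists M N : 'M[A]_m.+2, M *m N = 1%:M /\ row 0 M = v.
Proof.
move=> [f [[g fK gK] _]].
have gD c (x y : 'rV[A]_m) : g (c *: x + y) = c *: g x + g y.
  by apply: (can_inj fK); rewrite linearP !gK.
pose B : 'M[A]_(m, m.+2) := \matrix_j hcval (g (delta_mx 0 j)).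
have PB (x : hcomp) : hcval x = f x *m B.
  rewrite -[x in LHS]fK; move: (f x) => y; rewrite mulmx_sum_row {1}(row_sum_delta y).
  have g0 : g 0 = 0 by have := gD (-1) 0 0; rewrite !scaleN1r oppr0 addr0 addNr.
  elim: (index_enum _) => [|j s IH]; first by rewrite !big_nil g0.
  by rewrite !big_cons gD /= IH rowK.
pose M : 'M[A]_(1 + (1 + m)) := col_mx v (col_mx w B).
have [N hN] : exists N : 'M[A]_m.+2, forall j, row j (1%:M : 'M[A]_m.+2) = row j N *m M.
  apply: (@rows_exist _ m.+2 m.+2 (fun j r => row j (1%:M : 'M[A]_m.+2) = r *m M)) => j.
  set u := row j _; exists (row_mx (om u w)%:M (row_mx (- om u v)%:M (f (hpr u)))).
  have E (a b : 'M[A]_1) (c : 'rV_m) : row_mx a (row_mx b c) *m M = a *m v + (b *m w + c *m B).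
    by rewrite /M !mul_row_col.
  rewrite [RHS]E !mul_scalar_mx -PB /= /hproj scaleNr.
  by apply/rowP => q; rewrite !mxE; ring.
exists M, N; split.
  by apply: mulmx1C; apply/row_matrixP => j; rewrite row_mul -hN.
by apply/rowP => j; rewrite !mxE; case: splitP => // q; rewrite ord1.
Qed.
End HyperbolicComplement.

(** * Conclusion *)

Lemma fraction_rep (R : idomainType) (t : {fraction R}) :
  exists a b : R, b != 0 /\ t * tofrac b = tofrac a.
Proof.
exists (\n_(repr t)), (\d_(repr t)); split; first exact: denom_ratioP.
rewrite -{1}[t]reprK; unlock tofrac; rewrite -[LHS]FracField.pi_mul; apply/eqmodP.
rewrite /= FracField.equivfE /FracField.mulf !numden_Ratio ?mulf_neq0 ?oner_neq0 ?denom_ratioP //.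
by rewrite !mulr1 mulrC.
Qed.

(** For t = a / b, compare degrees in a^p = X^d b^p. *)
Lemma fraction_X_pow (k : fieldType) p d (t : {fraction {poly k}}) :
  t ^+ p = tofrac 'X ^+ d -> (p %| d)%N.
Proof.
have [a [b [b0 hb]]] := fraction_rep t => h.
have E : a ^+ p = 'X^d * b ^+ p.
  apply/eqP; rewrite -tofrac_eq tofracXn -hb exprMn h tofracM !tofracXn //.
have a0 : a ^+ p != 0 by rewrite E mulf_neq0 ?expf_neq0 ?polyX_eq0.
have := congr1 (fun f : {poly k} => (size f).-1) E.
rewrite mulrC size_mulXn ?expf_neq0 //.
have sE (f : {poly k}) : f != 0 -> (size (f ^+ p) = ((size f).-1 * p).+1)%N.
  by move=> f0; rewrite -(size_exp f p) prednK // size_poly_gt0 expf_neq0.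
case: p h E a0 sE => [|p] h E a0 sE; first by rewrite !expr0 size_poly1 addn1 => /= /esym ->.
have a0' : a != 0 by apply: contraNneq a0 => ->; rewrite expr0n.
rewrite !sE // addnS /= => /(congr1 (fun s => s - (size b).-1 * p.+1)%N).
by rewrite addnK -mulnBl => <-; apply: dvdn_mull.
Qed.

Section Bundle.
Variables (K : fieldType) (n m : nat) (g : ipoly K n) (x w : nat -> ipoly K n) (c : nat -> K).
Hypotheses (m_even : ~~ odd m) (xw : \sum_(i < m.+2) x i * w i = g) (gc : ipoly_eval idfun c n g != 0).
Hypothesis incomplete : forall (M N : 'M[ipoly K n]_m.+2) l, M *m N = (g ^+ l)%:M ->
  (forall i, M 0 i = x i) -> False.

Lemma clear_denominators (A : comAlgType K) (iota : {rmorphism ipoly K n -> A}) a b (M : 'M[A]_(a, b)) :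
  is_loc g iota -> exists k M', M *m (iota g ^+ k)%:M = map_mx iota M'.
Proof.
move=> [_ _ _ hF].
have [F hF'] := choice _ hF; pose k := \max_(ij : 'I_a * 'I_b) F (M ij.1 ij.2).
have hk i j : exists f, M i j * iota g ^+ k = iota f.
  have [f hf] := hF' (M i j); exists (f * g ^+ (k - F (M i j))).
  have le : (F (M i j) <= k)%N by apply: (@leq_bigmax _ (fun ij : 'I_a * 'I_b => F (M ij.1 ij.2)) (i, j)).
  by rewrite -[in LHS](subnKC le) exprD mulrA hf rmorphM rmorphXn.
have hk' ij : exists f, M ij.1 ij.2 * iota g ^+ k = iota f by apply: hk.
have [f hf] := choice _ hk'.
exists k, (\matrix_(i, j) f (i, j)); apply/matrixP => i j.
by rewrite mul_mx_scalar !mxE -(hf (i, j)) mulrC.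
Qed.

Lemma bundle_exists : exists A : comAlgType K,
  smooth_affine_variety A /\ krull_dimension A n /\
  exists (P : lmodType A) (b : {biscalar P}),
    [/\ symplectic_bundle m b, stably_trivial_symplectic m b & ~ trivial_symplectic m b].
Proof.
have g0 : g != 0 by apply: contraNneq gc => ->; rewrite rmorph0.
have [A [iota hl]] := loc_exists g0; exists A; split.
  by split; [exact: loc_fg hl|exact: loc_integral hl|exact: loc_smooth hl].
split; first split.
- exact (krull_lower hl gc).
- exact (krull_upper hl).
have [iC iI [z hz] _] := hl.
pose v : 'rV[A]_m.+2 := \row_i iota (x i).
pose w0 : 'cV[A]_m.+2 := \col_i (iota (w i) * z).
(* As J^2 = -1, pairing [v] with this vector gives the matrix product of [v] and [w0], which is
   1. *)
pose w1 : 'rV[A]_m.+2 := (- (symplectic_mx A m.+2 *m w0))^T.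
have vw : standard_form A m.+2 v w1 = 1.
  rewrite /standard_form /w1 trmxK mulmxN -mulmxA (mulmxA (symplectic_mx _ _)) symplectic_mx_sq /= ?negbK //.
  rewrite mulNmx mul1mx mulmxN opprK mxE -hz -xw rmorph_sum mulr_suml; apply: eq_bigr => i _.
  by rewrite !mxE rmorphM mulrA.
exists (hcomp v w1), (@hform A m v w1); split.
- exact: hcomp_symplectic.
- exact: hcomp_stably_trivial.
move=> /(trivial_completable vw) [M [N [MN rM]]].
have [k [M' hM']] := clear_denominators M hl.
have [l [N' hN']] := clear_denominators N hl.
(* The first row of [M] has no denominators and must stay equal to [x], so only the other rows are
   scaled by g^k; column 0 of [N1] carries the compensating factor. *)
pose M1 : 'M[ipoly K n]_m.+2 := \matrix_(i, j) if i == 0 then x j else M' i j.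
pose N1 : 'M[ipoly K n]_m.+2 := \matrix_(i, j) if j == 0 then g ^+ k * N' i j else N' i j.
apply: (@incomplete M1 N1 (k + l)%N); last by move=> i; rewrite mxE.
have inj : injective (map_mx iota : 'M_m.+2 -> 'M_m.+2).
  by move=> B C /matrixP h; apply/matrixP => i j; apply: iI; have := h i j; rewrite !mxE.
apply: inj; rewrite map_mxM map_scalar_mx rmorphXn.
pose d : 'rV[A]_m.+2 := \row_i if i == 0 then 1 else iota g ^+ k.
pose d' : 'rV[A]_m.+2 := \row_i if i == 0 then iota g ^+ k else 1.
have EM : map_mx iota M1 = diag_mx d *m M.
  rewrite mul_diag_mx; apply/matrixP => i j; rewrite !mxE; case: eqP => [->|_].
    by move/rowP/(_ j): rM; rewrite !mxE mul1r => ->.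
  by have /matrixP/(_ i j) := hM'; rewrite mul_mx_scalar !mxE => ->.
have EN : map_mx iota N1 = (N *m (iota g ^+ l)%:M) *m diag_mx d'.
  rewrite hN' mul_mx_diag; apply/matrixP => i j; rewrite !mxE; case: eqP => _.
    by rewrite rmorphM rmorphXn mulrC.
  by rewrite mulr1.
rewrite EM EN mulmxA -(mulmxA (diag_mx d)) (mulmxA M) MN mul1mx mul_mx_scalar -scalemxAl mul_diag_mx.
apply/matrixP => i j; rewrite !mxE exprD; have [e|ne] := eqVneq i j.
  subst j.
  rewrite !mulr1n; case: eqP => _; rewrite ?mul1r ?mulr1 1?mulrC //.
by rewrite /= !mulr0n !mulr0.
Qed.
End Bundle.

Lemma tower_row_incomplete (k : fieldType) p (M N : 'M[ipoly {fraction {poly k}} p.+1]_p.+1) l :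
  prime p -> odd p -> M *m N = (towerF (tofrac 'X) p p ^+ l)%:M ->
  (forall i, M 0 i = ipolyX _ p.+1 i) -> False.
Proof.
move=> p_pr p_odd; apply: (tower_row_not_completable p_pr p_odd) => d t.
exact: fraction_X_pow.
Qed.

Theorem theorem1p2 (k : closedFieldType) (hk : 2%N \notin [pchar k]) :
  (forall p : nat, prime p -> odd p ->
     exists A : comAlgType {fraction {poly k}},
       smooth_affine_variety A /\ krull_dimension A p.+1 /\
       exists (P : lmodType A) (b : {biscalar P}),
         [/\ symplectic_bundle p.-1 b,
             stably_trivial_symplectic p.-1 b
           & ~ trivial_symplectic p.-1 b]) /\
  (forall p : nat, prime p -> odd p ->
     exists A : comAlgType k,
       smooth_affine_variety A /\ krull_dimension A p.+2 /\
       exists (P : lmodType A) (b : {biscalar P}),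
         [/\ symplectic_bundle p.-1 b,
             stably_trivial_symplectic p.-1 b
           & ~ trivial_symplectic p.-1 b]).
Proof.
pose K : fieldType := {fraction {poly k}}; pose T : K := tofrac 'X.
split=> p p_pr p_odd; have p0 := prime_gt0 p_pr.
  case: p p_pr p_odd p0 => [//|m] p_pr p_odd p0.
  pose t := ipolyC K m.+2 T; pose x := ipolyX K m.+2.
  apply: (@bundle_exists K m.+2 m (towerF T m.+1 m.+1) x (tower_cofactor m.+1 t x m.+1) (fun i => (i == 0%N)%:R)).
  - by [].
  - exact: tower_cofactorE.
  - rewrite (_ : ipoly_eval _ _ _ _ = 1) ?oner_neq0 // -[RHS](tower_basepoint T m.+1 p0) rmorph_tower ipevC.
    by apply: eq_tower => i lei; rewrite ipevX.
  - by move=> M N l MN homogM; apply: (tower_row_incomplete p_pr p_odd MN).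
case: p p_pr p_odd p0 => [//|m] p_pr p_odd p0.
pose x i := ipolyX k m.+3 i.+1; pose t := ipolyX k m.+3 0.
(* The variable of index 0 becomes T and the others move down by one, so a completion over [k] maps
   to one over k(T). *)
pose th : {rmorphism ipoly k m.+3 -> ipoly K m.+2} :=
  ipoly_eval (ipolyC K m.+2 \o @tofrac {poly k} \o polyC) (fun i => if i is j.+1 then ipolyX K m.+2 j else ipolyC K m.+2 T) m.+3.
(* Index 1 is the first variable of the tower, so the base point has a 1 there and a 0 elsewhere,
   including at the variable that replaces T. *)
apply: (@bundle_exists k m.+3 m (tower m.+1 t x m.+1) x (tower_cofactor m.+1 t x m.+1) (fun i => (i == 1%N)%:R)).
- by [].
- exact: tower_cofactorE.
- rewrite (_ : ipoly_eval _ _ _ _ = 1) ?oner_neq0 // -[RHS](tower_basepoint ((0%N == 1%N)%:R : k) m.+1 p0) rmorph_tower.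
  rewrite /t ipevX //; apply: eq_tower => i lei; rewrite /x ipevX //.
- move=> M N l MN homogM; apply: (@tower_row_incomplete k m.+1 (map_mx th M) (map_mx th N) l) => // [|i].
    rewrite -map_mxM MN map_scalar_mx rmorphXn; congr ((_ ^+ _)%:M).
    rewrite rmorph_tower /t /th ipevX //; apply: eq_tower => i lei.
    by rewrite /x ipevX.
  rewrite mxE homogM /x /th; exact: (ipevX _ _ (ltn_ord i : (i.+1 < m.+3)%N)).
Qed.
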